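(* Let $q\in\mathbb{R}$ with $|q|>1$ and let $n\ge1$. For each sign $\pm$ let $\psi^{(2n)}_\pm$ be defined on the Hilbert space with orthonormal basis $\{|k_0,\dots,k_{n-1}\rangle: k_i\in\mathbb{Z}_{\ge0}\}$ by $$\psi^{(2n)}_\pm(x_0)|k_0,\dots,k_{n-1}\rangle=\pm q^{-(k_0+\dots+k_{n-1})}|k_0,\dots,k_{n-1}\rangle,$$ $$\psi^{(2n)}_\pm(x_i)|k_0,\dots,k_{n-1}\rangle=(1-q^{-2k_{i-1}})^{1/2}q^{-(k_i+\dots+k_{n-1})}|k_0,\dots,k_{i-1}-1,\dots,k_{n-1}\rangle,$$ $$\psi^{(2n)}_\pm(x_i^* )|k_0,\dots,k_{n-1}\rangle=(1-q^{-2(k_{i-1}+1)})^{1/2}q^{-(k_i+\dots+k_{n-1})}|k_0,\dots,k_{i-1}+1,\dots,k_{n-1}\rangle$$ for $i=1,\dots,n$. Then the irreducible $*$-representations of $A(S^{2n}_q)$, up to unitary equivalence, are indexed by the disjoint union of $n$ copies of $S^1$ and two points. The two points correspond to $\psi^{(2n)}_+$ and $\psi^{(2n)}_-$. The circles correspond to the representations $\psi^{(2m+1)}_\lambda$, $0\le m\le n-1$, $\lambda\in S^1$, of $A(S^{2m+1}_q)$ composed with the quotient homomorphism $A(S^{2n}_q)\to A(S^{2m+1}_q)$.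
   Context: The $*$-algebra $A(S^{2n}_q)$ is the unital complex $*$-algebra generated by $x_0=x_0^*$, $x_i,x_i^*$ ($i=1,\dots,n$) with relations $$x_ix_j=q\,x_jx_i\ (0\le i<j\le n),\quad x_i^*x_j=q\,x_jx_i^*\ (i\neq j),\quad [x_i,x_i^*]=(1-q^{-2})s_{i-1}\ (1\le i\le n),\quad s_n=1,$$ where $s_0:=x_0^2$ and $s_i:=s_{i-1}+x_i^*x_i$. For $m\ge0$, $A(S^{2m+1}_q)$ is generated by $x_i,x_i^*$ ($i=1,\dots,m+1$) with the same form of relations, with $x_0=0$, $s_0=0$ and $s_{m+1}=1$. The quotient homomorphism $A(S^{2n}_q)\to A(S^{2n-1}_q)$ sends $x_0\mapsto0$ and $x_i\mapsto x_i$ for $i\ge1$. The quotient homomorphism $A(S^{2N+1}_q)\to A(S^{2N-1}_q)$ sends $x_1\mapsto0$ and $x_i\mapsto x_{i-1}$ for $i\ge2$. The homomorphism $A(S^{2n}_q)\to A(S^{2m+1}_q)$ is the composition of these. For $m\ge 0$ and $\lambda\in S^1=\{\lambda\in\mathbb{C}:|\lambda|=1\}$, $\psi^{(2m+1)}_\lambda$ is the $*$-representation of $A(S^{2m+1}_q)$ on the Hilbert space with orthonormal basis $\{|k_1,\dots,k_m\rangle:k_i\in\mathbb{Z}_{\ge0}\}$ given by $x_1|k_1,\dots,k_m\rangle=\lambda q^{-(k_1+\dots+k_m)}|k_1,\dots,k_m\rangle$ and, for $i=2,\dots,m+1$, $x_i|k_1,\dots,k_m\rangle=(1-q^{-2k_{i-1}})^{1/2}q^{-(k_i+\dots+k_m)}|k_1,\dots,k_{i-1}-1,\dots,k_m\rangle$.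 (For $m=0$ it is one-dimensional with $x_1\mapsto\lambda$.) Irreducible $*$-representations are unital representations by bounded operators on a separable Hilbert space. *)

(* Defs.v *)
From HB Require Import structures.
From mathcomp Require Import all_boot all_order all_algebra complex.
From mathcomp Require Import all_classical all_reals all_analysis.

Set Implicit Arguments.
Unset Strict Implicit.
Unset Printing Implicit Defensive.
Import Order.TTheory GRing.Theory Num.Theory numFieldNormedType.Exports.
Local Open Scope quotient_scope.
Local Open Scope ring_scope.
Local Open Scope complex_scope.
Local Open Scope classical_set_scope.

HB.mixin Record isStarAlgebra (R : realType) (A : Type)
    & GRing.Algebra R[i] A := {
  star : A -> A ;
  starK : involutive star ;
  starD : forall a b, star (a + b) = star a + star b ;
  starZ : forall (c : R[i]) a, star (c *: a) = Num.conj c *: star a ;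
  starM : forall a b, star (a * b) = star b * star a
}.

#[short(type="starAlgType")]
HB.structure Definition StarAlgebra (R : realType) :=
  {A of GRing.Algebra R[i] A & isStarAlgebra R A}.

Section StarAlgebraTheory.
Variables (R : realType) (A : starAlgType R).
Implicit Types a b : A.

Lemma star0 : star (0 : A) = 0.
Proof. by rewrite -[X in star X](scale0r 0) starZ rmorph0 scale0r. Qed.

Lemma star1 : star (1 : A) = 1.
Proof. by rewrite -[LHS]mulr1 -[X in _ * X]starK -starM mulr1 starK. Qed.

End StarAlgebraTheory.

Section ComplexStar.
Variable R : realType.
Local Notation C := (R[i]^o).

Let conjCK : involutive (fun z : C => (Num.conj (z : R[i]) : C)).
Proof. by move=> z; exact: Num.Theory.conjCK. Qed.
Let conjCD (a b : C) :
  (Num.conj (a + b : R[i]) : C) = (Num.conj (a : R[i]) : C) + Num.conj (b : R[i]).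
Proof. exact: rmorphD. Qed.
Let conjCZ (c : R[i]) (a : C) :
  (Num.conj (c *: a : R[i]) : C) = Num.conj c *: (Num.conj (a : R[i]) : C).
Proof. exact: rmorphM. Qed.
Let conjCM (a b : C) :
  (Num.conj (a * b : R[i]) : C) = (Num.conj (b : R[i]) : C) * Num.conj (a : R[i]).
Proof. by rewrite rmorphM mulrC. Qed.

HB.instance Definition _ :=
  isStarAlgebra.Build R C conjCK conjCD conjCZ conjCM.

End ComplexStar.

Record starHom (R : realType) (A B : starAlgType R) := StarHom {
  star_hom_fun :> {lrmorphism A -> B} ;
  star_homP : forall a, star_hom_fun (star a) = star (star_hom_fun a)
}.

Definition star_hom_id (R : realType) (A : starAlgType R) : starHom A A :=
  @StarHom R A A (idfun : {lrmorphism A -> A}) (fun=> erefl).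

Section Comp.
Variables (R : realType) (A B D : starAlgType R).
Variables (g : starHom B D) (f : starHom A B).
Fact star_hom_comp_subproof a : (g \o f) (star a) = star ((g \o f) a).
Proof. by rewrite /= !star_homP. Qed.
Definition star_hom_comp : starHom A D :=
  @StarHom R A D (g \o f : {lrmorphism A -> D}) star_hom_comp_subproof.
End Comp.

Section Presentation.
Variable R : realType.
Local Notation C := R[i].

Inductive starTerm (X : Type) : Type :=
| Gen of X
| Zero
| One
| Add of starTerm X & starTerm X
| Mul of starTerm X & starTerm X
| Scale of C & starTerm X
| Star of starTerm X.
Arguments Zero {X}.
Arguments One {X}.

(* The smallest equivalence compatible with the operations that contains [rels]
   and makes the quotient a unital *-algebra. *)
Inductive starCong (X : Type) (rels : starTerm X -> starTerm X -> Prop) :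
  starTerm X -> starTerm X -> Prop :=
| cg_rel s t : rels s t -> starCong rels s t
| cg_refl t : starCong rels t t
| cg_sym s t : starCong rels s t -> starCong rels t s
| cg_trans s t u : starCong rels s t -> starCong rels t u -> starCong rels s u
| cg_Add s s' t t' : starCong rels s s' -> starCong rels t t' ->
    starCong rels (Add s t) (Add s' t')
| cg_Mul s s' t t' : starCong rels s s' -> starCong rels t t' ->
    starCong rels (Mul s t) (Mul s' t')
| cg_Scale c t t' : starCong rels t t' -> starCong rels (Scale c t) (Scale c t')
| cg_Star t t' : starCong rels t t' -> starCong rels (Star t) (Star t')
| cg_addA s t u : starCong rels (Add s (Add t u)) (Add (Add s t) u)
| cg_addC s t : starCong rels (Add s t) (Add t s)
| cg_add0 t : starCong rels (Add Zero t) t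
| cg_addN t : starCong rels (Add (Scale (-1) t) t) Zero
| cg_mulA s t u : starCong rels (Mul s (Mul t u)) (Mul (Mul s t) u)
| cg_mul1l t : starCong rels (Mul One t) t
| cg_mul1r t : starCong rels (Mul t One) t
| cg_mulDl s t u : starCong rels (Mul (Add s t) u) (Add (Mul s u) (Mul t u))
| cg_mulDr s t u : starCong rels (Mul s (Add t u)) (Add (Mul s t) (Mul s u))
| cg_scaleA c d t : starCong rels (Scale c (Scale d t)) (Scale (c * d) t)
| cg_scale1 t : starCong rels (Scale 1 t) t
| cg_scaleDr c s t :
    starCong rels (Scale c (Add s t)) (Add (Scale c s) (Scale c t))
| cg_scaleDl c d t :
    starCong rels (Scale (c + d) t) (Add (Scale c t) (Scale d t))
| cg_scaleAl c s t : starCong rels (Scale c (Mul s t)) (Mul (Scale c s) t)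
| cg_scaleAr c s t : starCong rels (Scale c (Mul s t)) (Mul s (Scale c t))
| cg_starK t : starCong rels (Star (Star t)) t
| cg_starD s t : starCong rels (Star (Add s t)) (Add (Star s) (Star t))
| cg_starZ c t : starCong rels (Star (Scale c t)) (Scale (Num.conj c) (Star t))
| cg_starM s t : starCong rels (Star (Mul s t)) (Mul (Star t) (Star s)).

(* [pres_neq10] is there because [algType] requires [1 != 0]. *)
Record presentation := Presentation {
  pres_gens : Type ;
  pres_rels : starTerm pres_gens -> starTerm pres_gens -> Prop ;
  pres_neq10 : ~ starCong pres_rels One Zero
}.

Fixpoint eval (A : starAlgType R) (X : Type) (f : X -> A) (t : starTerm X) : A :=
  match t with
  | Gen x => f x
  | Zero => 0
  | One => 1
  | Add s t => eval f s + eval f t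
  | Mul s t => eval f s * eval f t
  | Scale c t => c *: eval f t
  | Star t => star (eval f t)
  end.

Lemma eval_cong (A : starAlgType R) (X : Type) (rels : starTerm X -> starTerm X -> Prop)
    (f : X -> A) :
  (forall s t, rels s t -> eval f s = eval f t) ->
  forall s t, starCong rels s t -> eval f s = eval f t.
Proof.
move=> hf s t; elim=> //=.
- by move=> ? ? ? _ -> _ ->.
- by move=> ? ? ? ? _ -> _ ->.
- by move=> ? ? ? ? _ -> _ ->.
- by move=> ? ? ? _ ->.
- by move=> ? ? _ ->.
- by move=> *; rewrite addrA.
- by move=> *; rewrite addrC.
- by move=> *; rewrite add0r.
- by move=> *; rewrite scaleN1r addNr.
- by move=> *; rewrite mulrA.
- by move=> *; rewrite mul1r.
- by move=> *; rewrite mulr1.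
- by move=> *; rewrite mulrDl.
- by move=> *; rewrite mulrDr.
- by move=> *; rewrite scalerA.
- by move=> *; rewrite scale1r.
- by move=> *; rewrite scalerDr.
- by move=> *; rewrite scalerDl.
- by move=> *; rewrite scalerAl.
- by move=> *; rewrite scalerAr.
- by move=> *; rewrite starK.
- by move=> *; rewrite starD.
- by move=> *; rewrite starZ.
- by move=> *; rewrite starM.
Qed.

HB.instance Definition _ (X : Type) := gen_eqMixin (starTerm X).
HB.instance Definition _ (X : Type) := gen_choiceMixin (starTerm X).

Section Quotient.
Variable P : presentation.
Local Notation T := (starTerm (pres_gens P)).
Local Notation cong := (starCong (@pres_rels P)).

Definition pres_eqv (s t : T) : bool := `[< cong s t >].

Fact pres_eqv_refl : reflexive pres_eqv.
Proof. by move=> t; apply/asboolP; exact: cg_refl. Qed.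
Fact pres_eqv_sym : symmetric pres_eqv.
Proof. by move=> s t; apply/asboolP/asboolP; exact: cg_sym. Qed.
Fact pres_eqv_trans : transitive pres_eqv.
Proof.
by move=> t s u /asboolP st /asboolP tu; apply/asboolP; exact: cg_trans st tu.
Qed.

Canonical pres_equiv :=
  EquivRel pres_eqv pres_eqv_refl pres_eqv_sym pres_eqv_trans.

Definition presAlg := {eq_quot pres_equiv}.
HB.instance Definition _ := Choice.on presAlg.

Definition pcl (t : T) : presAlg := \pi_({eq_quot pres_equiv}) t.

Lemma pclP s t : reflect (pcl s = pcl t) `[< cong s t >].
Proof. exact: (@eqquotP _ pres_equiv {eq_quot pres_equiv} s t). Qed.

Lemma pcl_eq s t : cong s t -> pcl s = pcl t.
Proof. by move=> st; apply/pclP/asboolP. Qed.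

Lemma pcl_repr t : cong (repr (pcl t)) t.
Proof. by apply/asboolP/pclP; rewrite /pcl reprK. Qed.

Lemma pclW (K : presAlg -> Prop) : (forall t, K (pcl t)) -> forall a, K a.
Proof. by move=> h a; rewrite -[a]reprK; exact: h. Qed.

Definition pzero : presAlg := pcl Zero.
Definition pone : presAlg := pcl One.
Definition padd (a b : presAlg) : presAlg := pcl (Add (repr a) (repr b)).
Definition pmul (a b : presAlg) : presAlg := pcl (Mul (repr a) (repr b)).
Definition pscale (c : C) (a : presAlg) : presAlg := pcl (Scale c (repr a)).
Definition popp (a : presAlg) : presAlg := pscale (-1) a.
Definition pstar (a : presAlg) : presAlg := pcl (Star (repr a)).

Lemma paddE s t : padd (pcl s) (pcl t) = pcl (Add s t).
Proof. by apply: pcl_eq; apply: cg_Add; exact: pcl_repr. Qed.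
Lemma pmulE s t : pmul (pcl s) (pcl t) = pcl (Mul s t).
Proof. by apply: pcl_eq; apply: cg_Mul; exact: pcl_repr. Qed.
Lemma pscaleE c t : pscale c (pcl t) = pcl (Scale c t).
Proof. by apply: pcl_eq; apply: cg_Scale; exact: pcl_repr. Qed.
Lemma pstarE t : pstar (pcl t) = pcl (Star t).
Proof. by apply: pcl_eq; apply: cg_Star; exact: pcl_repr. Qed.
Let pE := (paddE, pmulE, pscaleE, pstarE).

Fact paddA : associative padd.
Proof.
elim/pclW=> s; elim/pclW=> t; elim/pclW=> u; rewrite !pE.
by apply: pcl_eq; exact: cg_addA.
Qed.
Fact paddC : commutative padd.
Proof.
by elim/pclW=> s; elim/pclW=> t; rewrite !pE; apply: pcl_eq; exact: cg_addC.
Qed.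
Fact padd0 : left_id pzero padd.
Proof. by elim/pclW=> s; rewrite !pE; apply: pcl_eq; exact: cg_add0. Qed.
Fact paddN : left_inverse pzero popp padd.
Proof. by elim/pclW=> s; rewrite /popp !pE; apply: pcl_eq; exact: cg_addN. Qed.

HB.instance Definition _ :=
  GRing.isZmodule.Build presAlg paddA paddC padd0 paddN.

Fact pmulA : associative pmul.
Proof.
elim/pclW=> s; elim/pclW=> t; elim/pclW=> u; rewrite !pE.
by apply: pcl_eq; exact: cg_mulA.
Qed.
Fact pmul1l : left_id pone pmul.
Proof. by elim/pclW=> s; rewrite !pE; apply: pcl_eq; exact: cg_mul1l. Qed.
Fact pmul1r : right_id pone pmul.
Proof. by elim/pclW=> s; rewrite !pE; apply: pcl_eq; exact: cg_mul1r. Qed.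
Fact pmulDl : left_distributive pmul padd.
Proof.
elim/pclW=> s; elim/pclW=> t; elim/pclW=> u; rewrite !pE.
by apply: pcl_eq; exact: cg_mulDl.
Qed.
Fact pmulDr : right_distributive pmul padd.
Proof.
elim/pclW=> s; elim/pclW=> t; elim/pclW=> u; rewrite !pE.
by apply: pcl_eq; exact: cg_mulDr.
Qed.
Fact pone_neq0 : pone != pzero.
Proof. by apply/eqP => /pclP/asboolP; exact: (@pres_neq10 P). Qed.

HB.instance Definition _ := GRing.Zmodule_isNzRing.Build presAlg
  pmulA pmul1l pmul1r pmulDl pmulDr pone_neq0.

Fact pscaleA c d a : pscale c (pscale d a) = pscale (c * d) a.
Proof. by elim/pclW: a => s; rewrite !pE; apply: pcl_eq; exact: cg_scaleA. Qed.
Fact pscale1 : left_id 1 pscale.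
Proof. by elim/pclW=> s; rewrite !pE; apply: pcl_eq; exact: cg_scale1. Qed.
Fact pscaleDr : right_distributive pscale padd.
Proof.
move=> c; elim/pclW=> s; elim/pclW=> t; rewrite !pE.
by apply: pcl_eq; exact: cg_scaleDr.
Qed.
Fact pscaleDl a : {morph pscale^~ a : c d / c + d >-> padd c d}.
Proof.
by move=> c d; elim/pclW: a => s; rewrite !pE; apply: pcl_eq; exact: cg_scaleDl.
Qed.

HB.instance Definition _ := GRing.Zmodule_isLmodule.Build C presAlg
  pscaleA pscale1 pscaleDr pscaleDl.

Fact pscaleAl c (a b : presAlg) : pscale c (pmul a b) = pmul (pscale c a) b.
Proof.
elim/pclW: a => s; elim/pclW: b => t; rewrite !pE.
by apply: pcl_eq; exact: cg_scaleAl.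
Qed.
HB.instance Definition _ := GRing.Lmodule_isLalgebra.Build C presAlg pscaleAl.

Fact pscaleAr c (a b : presAlg) : pscale c (pmul a b) = pmul a (pscale c b).
Proof.
elim/pclW: a => s; elim/pclW: b => t; rewrite !pE.
by apply: pcl_eq; exact: cg_scaleAr.
Qed.
HB.instance Definition _ := GRing.Lalgebra_isAlgebra.Build C presAlg pscaleAr.

Fact pstarK : involutive pstar.
Proof. by elim/pclW=> s; rewrite !pE; apply: pcl_eq; exact: cg_starK. Qed.
Fact pstarD a b : pstar (padd a b) = padd (pstar a) (pstar b).
Proof.
elim/pclW: a => s; elim/pclW: b => t; rewrite !pE.
by apply: pcl_eq; exact: cg_starD.
Qed.
Fact pstarZ c a : pstar (pscale c a) = pscale (Num.conj c) (pstar a).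
Proof. by elim/pclW: a => s; rewrite !pE; apply: pcl_eq; exact: cg_starZ. Qed.
Fact pstarM a b : pstar (pmul a b) = pmul (pstar b) (pstar a).
Proof.
elim/pclW: a => s; elim/pclW: b => t; rewrite !pE.
by apply: pcl_eq; exact: cg_starM.
Qed.
HB.instance Definition _ := isStarAlgebra.Build R presAlg
  pstarK pstarD pstarZ pstarM.

Definition pgen (x : pres_gens P) : presAlg := pcl (Gen x).

Lemma pcl_eval (t : T) : pcl t = eval pgen t.
Proof.
elim: t => //=.
- by move=> s <- t <-; rewrite -paddE.
- by move=> s <- t <-; rewrite -pmulE.
- by move=> c t <-; rewrite -pscaleE.
- by move=> t <-; rewrite -pstarE.
Qed.

Lemma pres_relsE s t : pres_rels s t -> eval pgen s = eval pgen t.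
Proof. by move=> st; rewrite -!pcl_eval; apply: pcl_eq; exact: cg_rel. Qed.

Section Lift.
Variables (B : starAlgType R) (f : pres_gens P -> B).
Hypothesis f_rels : forall s t, pres_rels s t -> eval f s = eval f t.

Definition pres_lift_fun (a : presAlg) : B := eval f (repr a).

Lemma pres_lift_funE t : pres_lift_fun (pcl t) = eval f t.
Proof. exact: eval_cong f_rels _ _ (pcl_repr t). Qed.

Fact pres_lift_linear : linear pres_lift_fun.
Proof.
move=> c; elim/pclW=> s; elim/pclW=> t.
rewrite -[c *: _]/(pscale c _) -[_ + _]/(padd _ _) !pE !pres_lift_funE.
by [].
Qed.
HB.instance Definition _ :=
  GRing.isLinear.Build C presAlg B _ pres_lift_fun pres_lift_linear.

Fact pres_lift_monoid : monoid_morphism pres_lift_fun.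
Proof.
split; first exact: (pres_lift_funE One).
elim/pclW=> s; elim/pclW=> t.
by rewrite -[_ * _]/(pmul _ _) !pE !pres_lift_funE.
Qed.
HB.instance Definition _ :=
  GRing.isMonoidMorphism.Build presAlg B pres_lift_fun pres_lift_monoid.

Fact pres_lift_star a : pres_lift_fun (star a) = star (pres_lift_fun a).
Proof.
by elim/pclW: a => s; rewrite -[star _]/(pstar _) !pE !pres_lift_funE.
Qed.

Definition pres_lift : starHom presAlg B :=
  @StarHom R presAlg B (pres_lift_fun : {lrmorphism presAlg -> B})
    pres_lift_star.

Lemma pres_lift_gen x : pres_lift (pgen x) = f x.
Proof. exact: (pres_lift_funE (Gen x)). Qed.

End Lift.
End Quotient.
End Presentation.

Arguments Zero {R X}.
Arguments One {R X}.
Arguments Gen {R X} _.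

Section Spheres.
Variables (R : realType) (q : R).

Section Relations.
Variables (X : Type) (x : nat -> starTerm R X).

Fixpoint sphere_s (i : nat) : starTerm R X :=
  if i is j.+1 then Add (sphere_s j) (Mul (Star (x i)) (x i))
  else Mul (x 0%N) (x 0%N).

(* Relations among [x 0, ..., x N]. For odd spheres [x 0] is the term [Zero],
   so that the relations involving it are trivial and [sphere_s 0] is zero. *)
Inductive sphere_rels (N : nat) : starTerm R X -> starTerm R X -> Prop :=
| sphere_x0 : sphere_rels N (Star (x 0%N)) (x 0%N)
| sphere_xx i j : (i < j <= N)%N ->
    sphere_rels N (Mul (x i) (x j)) (Scale q%:C (Mul (x j) (x i)))
| sphere_sx i j : (i <= N)%N -> (j <= N)%N -> i != j ->
    sphere_rels N (Mul (Star (x i)) (x j)) (Scale q%:C (Mul (x j) (Star (x i))))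
| sphere_comm i : (1 <= i <= N)%N ->
    sphere_rels N
      (Add (Mul (x i) (Star (x i))) (Scale (-1) (Mul (Star (x i)) (x i))))
      (Scale (1 - q ^- 2)%:C (sphere_s i.-1))
| sphere_sN : sphere_rels N (sphere_s N) One.

Section Eval.
Variables (B : starAlgType R) (y : nat -> B).

Fixpoint sphere_sv (i : nat) : B :=
  if i is j.+1 then sphere_sv j + star (y i) * y i else y 0%N * y 0%N.

Definition sphere_eqs (N : nat) : Prop :=
  [/\ star (y 0%N) = y 0%N,
      forall i j, (i < j <= N)%N -> y i * y j = q%:C *: (y j * y i),
      forall i j, (i <= N)%N -> (j <= N)%N -> i != j ->
        star (y i) * y j = q%:C *: (y j * star (y i)),
      forall i, (1 <= i <= N)%N ->
        y i * star (y i) - star (y i) * y i =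
          (1 - q ^- 2)%:C *: sphere_sv i.-1 &
      sphere_sv N = 1].

Variable f : X -> B.

Lemma eval_sphere_s N : (forall i, (i <= N)%N -> eval f (x i) = y i) ->
  forall k, (k <= N)%N -> eval f (sphere_s k) = sphere_sv k.
Proof.
move=> h; elim=> [|k IH] kN /=; first by rewrite h.
by rewrite IH ?(ltnW kN) // h.
Qed.

Lemma sphere_eqsP N : (forall i, (i <= N)%N -> eval f (x i) = y i) ->
  (forall s t, sphere_rels N s t -> eval f s = eval f t) <-> sphere_eqs N.
Proof.
move=> h; have hs := eval_sphere_s h; split=> [H|[H0 H1 H2 H3 H4] s t].
  split=> [|i j ij|i j iN jN ij|i iN|].
  - by have := H _ _ (sphere_x0 N); rewrite /= h.
  - have /andP[ij' jN] := ij; have iN := leq_trans (ltnW ij') jN.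
    by have := H _ _ (sphere_xx ij); rewrite /= !h.
  - by have := H _ _ (sphere_sx iN jN ij); rewrite /= !h.
  - have /andP[_ iN'] := iN; have := H _ _ (sphere_comm iN).
    by rewrite /= !h // scaleN1r hs // (leq_trans (leq_pred _)).
  - by have := H _ _ (sphere_sN N); rewrite /= hs.
move=> [|i j ij|i j iN jN ij|i iN|] /=.
- by rewrite h.
- have /andP[ij' jN] := ij; have iN := leq_trans (ltnW ij') jN.
  by rewrite !h // H1.
- by rewrite !h // H2.
- have /andP[_ iN'] := iN.
  by rewrite !h // scaleN1r hs ?(leq_trans (leq_pred _)) // H3.
- by rewrite hs.
Qed.

End Eval.

(* A character of the sphere: [x N] goes to 1 and the other [x i] to 0. *)
Lemma sphere_neq10 N (f : X -> R[i]^o) :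
  (forall i, (i <= N)%N -> eval f (x i) = (i == N)%:R) ->
  ~ starCong (sphere_rels N) One Zero.
Proof.
move=> hx /(@eval_cong R (R[i]^o : starAlgType R) X _ f) h.
suff /h/eqP : forall s t, sphere_rels N s t -> eval f s = eval f t.
  by rewrite /= oner_eq0.
have hst i : (i <= N)%N -> star (eval f (x i)) = (i == N)%:R.
  by move=> /hx ->; case: eqP => _; rewrite ?star0 ?star1.
have hs k : (k <= N)%N -> eval f (sphere_s k) = (k == N)%:R.
  elim: k => [|k IH] kN /=; first by rewrite hx // -natrM mulnb andbb.
  rewrite IH ?(ltnW kN)// hst// hx// -natrM mulnb andbb -natrD.
  by rewrite ltn_eqF.
move=> s t [|i j /andP[ij jN]|i j iN jN ij|i /andP[i0 iN]|] /=.
- by rewrite hst // hx.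
- by rewrite !hx ?(leq_trans (ltnW ij) jN) // (ltn_eqF (leq_trans ij jN)) mul0r
    mulr0 scaler0.
- rewrite hst // hx //; case: (i =P N) ij => [->|_] ij.
    by rewrite eq_sym (negbTE ij) mul0r mulr0 scaler0.
  by rewrite mul0r mulr0 scaler0.
- rewrite hst // hx // scaleN1r subrr hs ?(leq_trans (leq_pred _) iN) //.
  by rewrite ltn_eqF ?scaler0 // prednK.
- by rewrite hs // eqxx.
Qed.

End Relations.

(* Even spheres: the generators are x_0, ..., x_n. *)
Definition even_term n (i : nat) : starTerm R 'I_n.+1 := Gen (inord i).

(* Odd spheres: the [j]-th generator is x_(j+1), 0 <= j <= m, and x_0 := 0. *)
Definition odd_term m (i : nat) : starTerm R 'I_m.+1 :=
  if i is j.+1 then Gen (inord j) else Zero.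

Let last_char d (j : 'I_d.+1) : R[i]^o := (j == d :> nat)%:R.

Fact even_sphere_neq10 n : ~ starCong (sphere_rels (even_term n) n) One Zero.
Proof.
by apply: (sphere_neq10 (f := @last_char n)) => i iN; rewrite /= /last_char inordK.
Qed.

Fact odd_sphere_neq10 m : ~ starCong (sphere_rels (odd_term m) m.+1) One Zero.
Proof.
apply: (sphere_neq10 (f := @last_char m)) => -[|i] iN //=.
by rewrite /last_char inordK.
Qed.

Definition even_pres n := Presentation (@even_sphere_neq10 n).
Definition odd_pres m := Presentation (@odd_sphere_neq10 m).

(* A(S^{2n}_q) *)
Definition even_sphere n : starAlgType R :=
  presAlg (even_pres n).
(* A(S^{2m+1}_q) *)
Definition odd_sphere m : starAlgType R :=
  presAlg (odd_pres m).

Definition even_x n (i : nat) : even_sphere n :=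
  @pcl R (even_pres n) (even_term n i).
Definition odd_x m (i : nat) : odd_sphere m :=
  @pcl R (odd_pres m) (odd_term m i).

Lemma odd_x0 m : odd_x m 0 = 0. Proof. by []. Qed.

Lemma odd_sphere_eqs m : sphere_eqs (odd_x m) m.+1.
Proof.
apply/(@sphere_eqsP _ (odd_term m) _ _
  (@pgen R (odd_pres m))) => [i _|].
  by rewrite /odd_x pcl_eval.
exact: (@pres_relsE R (odd_pres m)).
Qed.

Lemma even_sphere_eqs n : sphere_eqs (even_x n) n.
Proof.
apply/(@sphere_eqsP _ (even_term n) _ _
  (@pgen R (even_pres n))) => [i _|].
  by rewrite /even_x pcl_eval.
exact: (@pres_relsE R (even_pres n)).
Qed.

Fact even_to_odd_rels n s t : sphere_rels (even_term n.+1) n.+1 s t ->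
  eval (fun i : 'I_n.+2 => odd_x n i) s = eval (fun i : 'I_n.+2 => odd_x n i) t.
Proof.
move: s t; apply/(sphere_eqsP (y := odd_x n)) => [i iN|].
  by rewrite /= inordK.
exact: odd_sphere_eqs.
Qed.

(* A(S^{2n+2}_q) -> A(S^{2n+1}_q), with x_0 |-> 0 and x_i |-> x_i for i >= 1 *)
Definition even_to_odd n : starHom (even_sphere n.+1) (odd_sphere n) :=
  pres_lift (P := even_pres n.+1) (@even_to_odd_rels n).

Fact odd_to_odd_rels m s t : sphere_rels (odd_term m.+1) m.+2 s t ->
  eval (fun j : 'I_m.+2 => odd_x m j) s = eval (fun j : 'I_m.+2 => odd_x m j) t.
Proof.
move: s t; apply/(sphere_eqsP (y := fun i => odd_x m i.-1)) => [[|i] iN //|].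
  by rewrite /= inordK.
have [H0 H1 H2 H3 H4] := odd_sphere_eqs m.
have hs k : sphere_sv (fun i => odd_x m i.-1) k.+1 = sphere_sv (odd_x m) k.
  elim: k => [|k IH]; first by rewrite /= odd_x0 !mul0r mulr0 addr0.
  by rewrite [RHS]/= -IH.
split=> [|i j ij|i j iN jN ij|i iN|].
- exact: H0.
- case: i j ij => [|i] [|j] // ij; first by rewrite odd_x0 mul0r mulr0 scaler0.
  exact: H1.
- case: i iN ij => [|i] iN ij; first by rewrite odd_x0 star0 mul0r mulr0 scaler0.
  case: j jN ij => [|j] jN ij; first by rewrite odd_x0 mul0r mulr0 scaler0.
  exact: H2.
- case: i iN => // -[|i] iN.
    by rewrite /= odd_x0 star0 !mul0r subrr scaler0.
  by rewrite hs; apply: H3.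
- by rewrite hs.
Qed.

(* A(S^{2m+3}_q) -> A(S^{2m+1}_q), with x_1 |-> 0 and x_i |-> x_(i-1), i >= 2 *)
Definition odd_to_odd m : starHom (odd_sphere m.+1) (odd_sphere m) :=
  pres_lift (P := odd_pres m.+1) (@odd_to_odd_rels m).

Lemma even_to_odd_x n i : (i <= n.+1)%N -> even_to_odd n (even_x n.+1 i) = odd_x n i.
Proof.
move=> iN; rewrite /even_x pcl_eval.
by rewrite (pres_lift_gen (P := even_pres n.+1) (@even_to_odd_rels n)) inordK.
Qed.

Lemma odd_to_odd_x m i : (1 <= i <= m.+2)%N ->
  odd_to_odd m (odd_x m.+1 i) = odd_x m i.-1.
Proof.
case: i => // i iN; rewrite [in LHS]/odd_x pcl_eval.
by rewrite (pres_lift_gen (P := odd_pres m.+1) (@odd_to_odd_rels m)) inordK.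
Qed.

Fixpoint odd_to_odd_iter d m : starHom (odd_sphere (d + m)) (odd_sphere m) :=
  if d is d'.+1 return starHom (odd_sphere (d + m)) (odd_sphere m)
  then star_hom_comp (odd_to_odd_iter d' m) (odd_to_odd (d' + m))
  else star_hom_id (odd_sphere m).

Fact even_dim n (m : 'I_n) : (n - m.+1 + m).+1 = n.
Proof. by rewrite -addnS subnK. Qed.

(* A(S^{2n}_q) -> A(S^{2m+1}_q) for m < n; the equation [even_dim m] only
   serves to type the composition. *)
Definition even_to_odd_comp n (m : 'I_n) :
    starHom (even_sphere n) (odd_sphere m) :=
  let: erefl in _ = n' := even_dim m
    return starHom (even_sphere n') (odd_sphere m) in
  star_hom_comp (odd_to_odd_iter (n - m.+1) m) (even_to_odd (n - m.+1 + m)).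

Lemma odd_to_odd_iter_x d m i : (i <= (d + m).+1)%N ->
  odd_to_odd_iter d m (odd_x (d + m) i) = odd_x m (i - d).
Proof.
elim: d i => [|d IH] i iN; first by rewrite subn0.
rewrite [LHS]/= -[star_hom_fun (odd_to_odd _) _]/(odd_to_odd _ _).
case: i iN => [|i] iN.
  by rewrite odd_x0 !rmorph0 sub0n odd_x0.
by rewrite (@odd_to_odd_x (d + m) i.+1) // subSS IH.
Qed.

Lemma even_to_odd_comp_x n (m : 'I_n) i : (i <= n)%N ->
  even_to_odd_comp m (even_x n i) = odd_x m (i - (n - m.+1)).
Proof.
rewrite /even_to_odd_comp; move: (even_dim m).
move: (n - m.+1)%N => d; move: (nat_of_ord m) => k {m} e; case: n / e => iN.
by rewrite /= even_to_odd_x // odd_to_odd_iter_x.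
Qed.

End Spheres.

(* Following the library's convention, the inner product is linear in its first
   argument and conjugate-linear in the second. *)
HB.mixin Record isHilbert (R : realType) (H : Type)
    & CompleteNormedModule R[i] H := {
  inner : {dot H for Num.conj} ;
  inner_norm : forall v : H, inner v v = `|v| ^+ 2
}.

#[short(type="hilbertType")]
HB.structure Definition Hilbert (R : realType) :=
  {H of CompleteNormedModule R[i] H & isHilbert R H}.

Section Representations.
Variable R : realType.
Local Notation C := R[i].

Definition separable (H : hilbertType R) : Prop :=
  exists D : set H, countable D /\ dense D.

Definition orthonormal_basis (H : hilbertType R) (I : eqType) (e : I -> H) : Prop :=
  (forall k l, inner (e k) (e l) = (k == l)%:R) /\
  closure [set v | exists (s : seq I) (c : I -> C),
                     v = \sum_(k <- s) c k *: e k] = setT.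

Record starRep (A : starAlgType R) := StarRep {
  rep_space : hilbertType R ;
  rep_op :> A -> {linear rep_space -> rep_space} ;
  rep_separable : separable rep_space ;
  rep_bounded : forall a, exists M : C, forall v, `|rep_op a v| <= M * `|v| ;
  rep_linear : forall (c : C) a b v,
    rep_op (c *: a + b) v = c *: rep_op a v + rep_op b v ;
  rep_1 : forall v, rep_op 1 v = v ;
  rep_M : forall a b v, rep_op (a * b) v = rep_op a (rep_op b v) ;
  rep_star : forall a v w,
    inner (rep_op a v) w = inner v (rep_op (star a) w)
}.

Section Pullback.
Variables (A B : starAlgType R) (f : starHom A B) (pi : starRep B).

Fact pullback_linear (c : C) (a b : A) v :
  pi (f (c *: a + b)) v = c *: pi (f a) v + pi (f b) v.
Proof. by rewrite linearP rep_linear. Qed.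
Fact pullback_1 v : pi (f 1) v = v.
Proof. by rewrite rmorph1 rep_1. Qed.
Fact pullback_M a b v : pi (f (a * b)) v = pi (f a) (pi (f b) v).
Proof. by rewrite rmorphM rep_M. Qed.
Fact pullback_star a v w :
  inner (pi (f a) v) w = inner v (pi (f (star a)) w).
Proof. by rewrite star_homP rep_star. Qed.

Definition pullback : starRep A :=
  @StarRep A (rep_space pi) (fun a => pi (f a)) (rep_separable pi)
    (fun a => rep_bounded pi (f a))
    pullback_linear pullback_1 pullback_M pullback_star.
End Pullback.

Definition irreducible (A : starAlgType R) (pi : starRep A) : Prop :=
  (exists v : rep_space pi, v != 0) /\
  forall V : set (rep_space pi),
    closed V -> V 0 -> (forall (c : C) u v, V u -> V v -> V (c *: u + v)) ->
    (forall a v, V v -> V (pi a v)) ->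
    V = [set 0] \/ V = setT.

Definition unitarily_equivalent (A : starAlgType R) (pi rho : starRep A) : Prop :=
  exists U : {linear rep_space pi -> rep_space rho},
    [/\ bijective U,
        forall v w, inner (U v) (U w) = inner v w &
        forall a v, U (pi a v) = rho a (U v)].

Definition circle := {z : C | `|z| == 1}.

Section Psi.
Variable q : R.

Definition raise n (k : {ffun 'I_n -> nat}) (j : 'I_n) : {ffun 'I_n -> nat} :=
  [ffun l => if l == j then (k l).+1 else k l].

(* When [k j = 0] the value is irrelevant: it is multiplied by
   [sqrt (1 - q ^- 0) = 0]. *)
Definition lower n (k : {ffun 'I_n -> nat}) (j : 'I_n) : {ffun 'I_n -> nat} :=
  [ffun l => if l == j then (k l).-1 else k l].

Definition total n (k : {ffun 'I_n -> nat}) : nat := (\sum_(l < n) k l)%N.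
Definition tail n (k : {ffun 'I_n -> nat}) (j : 'I_n) : nat :=
  (\sum_(l < n | j < l) k l)%N.

(* [pi] is psi^(2n)_+ for [s = false] and psi^(2n)_- for [s = true]. The basis
   vector |k_0, ..., k_(n-1)> is [e k], and [j] stands for i - 1. *)
Definition is_psi_even n (s : bool) (pi : starRep (even_sphere q n)) : Prop :=
  exists e : {ffun 'I_n -> nat} -> rep_space pi,
    [/\ orthonormal_basis e,
        forall k, pi (even_x q n 0) (e k) =
          ((-1) ^+ s * q ^- total k)%:C *: e k,
        forall (j : 'I_n) k, pi (even_x q n j.+1) (e k) =
          (Num.sqrt (1 - q ^- (2 * k j)%N) * q ^- tail k j)%:C *: e (lower k j) &
        forall (j : 'I_n) k, pi (star (even_x q n j.+1)) (e k) =
          (Num.sqrt (1 - q ^- (2 * (k j).+1)%N) * q ^- tail k j)%:C *: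
            e (raise k j)].

(* [pi] is psi^(2m+1)_lambda. The basis vector |k_1, ..., k_m> is
   [e [ffun j => k_(j+1)]], and [j] stands for i - 2. *)
Definition is_psi_odd m (lambda : circle) (pi : starRep (odd_sphere q m)) : Prop :=
  exists e : {ffun 'I_m -> nat} -> rep_space pi,
    [/\ orthonormal_basis e,
        forall k, pi (odd_x q m 1) (e k) =
          (val lambda * (q ^- total k)%:C) *: e k &
        forall (j : 'I_m) k, pi (odd_x q m j.+2) (e k) =
          (Num.sqrt (1 - q ^- (2 * k j)%N) * q ^- tail k j)%:C *: e (lower k j)].

Section Family.
Variables (n : nat) (psi_even : bool -> starRep (even_sphere q n)).
Variable psi_odd : forall m : nat, circle -> starRep (odd_sphere q m).

(* Two points (the signs) and [n] circles (indexed by 0 <= m <= n-1). *)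
Definition psi_index := (bool + 'I_n * circle)%type.

Definition psi_family (l : psi_index) : starRep (even_sphere q n) :=
  match l with
  | inl s => psi_even s
  | inr (m, lambda) => pullback (even_to_odd_comp q m) (psi_odd m lambda)
  end.

End Family.
End Psi.
End Representations.

(* Main.v *)
Require Import Defs.
From HB Require Import structures.
From mathcomp Require Import all_boot all_order all_algebra complex.
From mathcomp Require Import all_classical all_reals all_analysis.
From mathcomp Require Import ring lra.

(** Put s_i = x_0^2 + x_1^* x_1 + ... + x_i^* x_i. In an irreducible representation let r be the
least index with x_r <> 0. The kernel of s_r is invariant, hence zero, so that every s_i with
i >= r is injective. Descending from s_n = 1, the eigenspace s_(i-1) = 1 is found inside the
eigenspace s_i = 1: there x_i^* x_i = 1 - s_(i-1) and s_(i-1) x_i^* = q^-2 x_i^* s_(i-1), so the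
powers of s_(i-1) converge geometrically to a projection, and if that projection vanished then the
same relations would force s_(i-1) = 0. On the resulting vacuum space s_r = 1 the operator x_r is
unitary; by irreducibility it is a scalar lambda there, because the positive and the negative
part of a self-adjoint combination h of x_r and x_r^* generate orthogonal invariant subspaces. A
vacuum vector and the words in x_(r+1)^*, ..., x_n^* then produce the orthonormal basis in which
the x_i are weighted shifts. The pair (r, lambda) is a complete invariant, read off the vacuum. *)

Set Implicit Arguments.
Unset Strict Implicit.
Unset Printing Implicit Defensive.
Import Order.TTheory GRing.Theory Num.Theory numFieldNormedType.Exports.
Local Open Scope ring_scope.
Local Open Scope complex_scope.
Local Open Scope classical_set_scope.

(** * Hilbert spaces with a real-valued norm *)

(** The two points and the circles form one family. Every representation in the list is in
    [shift_form], with [r = 0] for the even ones and [r = n - m] for the pullback from the odd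
    sphere of index [m]; for [r = 0] the generator [x_r = x_0] is self-adjoint, which cuts the
    circle of eigenvalues down to its two real points. Irreducibility, completeness and uniqueness
    are therefore proved once, for [shift_form]. Spectral projections are never formed: an
    eigenspace is reached as the limit of powers of a positive contraction whose spectrum has a gap
    below 1, the gap being forced by [|q| > 1]. No such gap is available for the unitary [x_r] on
    the vacuum, whose spectrum could a priori be any part of the circle; there irreducibility has to
    do the work, through an absolute value. The algebras are given by generators and relations, so a
    concrete model has to be a star homomorphism into some star-algebra. Bounded operators on l2
    that carry an adjoint are made into one for this purpose, and a model then amounts to a check of
    [sphere_eqs]. *)

Section ComplexFacts.
Variable R : realType.
Implicit Types (x y : R[i]) (a b : R).

Lemma ReD x y : complex.Re (x + y) = complex.Re x + complex.Re y.
Proof. by case: x => ? ?; case: y. Qed.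
Lemma ReB x y : complex.Re (x - y) = complex.Re x - complex.Re y.
Proof. by case: x => ? ?; case: y. Qed.
Lemma ReZ a x : complex.Re (a%:C * x) = a * complex.Re x.
Proof. by case: x => u v; rewrite -[LHS]/(a * u - 0 * v) mul0r subr0. Qed.
Lemma conjCE x : Num.conj x = complex.Re x -i* complex.Im x.
Proof. by case: x. Qed.
Lemma conjC_real a : Num.conj a%:C = a%:C.
Proof. by rewrite conjCE /= oppr0. Qed.
End ComplexFacts.

Section HilbertBasics.
Variables (R : realType) (H : hilbertType R).
Implicit Types (u v w : H).

(** The norm of [H] takes values in [R[i]], whose order is only partial. A real copy makes linear
    arithmetic, square roots and suprema in [R] available. *)
Definition rnorm v : R := complex.Re `|v|.
Definition rinner u v : R := complex.Re (inner u v).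

Lemma normE v : `|v| = (rnorm v)%:C.
Proof.
have := normr_ge0 v; rewrite lecE /= /rnorm.
by case: `|v| => a b /= /andP[/eqP -> _].
Qed.

Lemma rnorm_ge0 v : 0 <= rnorm v.
Proof. by have := normr_ge0 v; rewrite normE ler0c. Qed.
Lemma rnorm0 : rnorm 0 = 0. Proof. by rewrite /rnorm normr0. Qed.
Lemma rnorm_eq0 v : (rnorm v == 0) = (v == 0).
Proof.
apply/eqP/eqP => [h|->]; last exact: rnorm0.
by apply/normr0_eq0; rewrite normE h.
Qed.
Lemma rnormD u v : rnorm (u + v) <= rnorm u + rnorm v.
Proof. by have := ler_normD u v; rewrite !normE -rmorphD lecR. Qed.
Lemma rnormN v : rnorm (- v) = rnorm v. Proof. by rewrite /rnorm normrN. Qed.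
Lemma rnormC u v : rnorm (u - v) = rnorm (v - u). Proof. by rewrite /rnorm distrC. Qed.
Lemma rnormZ (c : R[i]) v : rnorm (c *: v) = complex.Re `|c| * rnorm v.
Proof. by rewrite /rnorm normrZ normE normc_def ReZ. Qed.
Lemma rnormZr (a : R) v : rnorm (a%:C *: v) = `|a| * rnorm v.
Proof. by rewrite rnormZ normc_def /= expr0n addr0 sqrtr_sqr. Qed.


Lemma innerDl u v w : inner (u + v) w = inner u w + inner v w.
Proof. exact: linearDl. Qed.
Lemma innerDr u v w : inner u (v + w) = inner u v + inner u w.
Proof. exact: linearDr. Qed.
Lemma innerNl u v : inner (- u) v = - inner u v.
Proof. exact: linearNl. Qed.
Lemma innerNr u v : inner u (- v) = - inner u v.
Proof. exact: linearNr. Qed.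
Lemma innerBl u v w : inner (u - v) w = inner u w - inner v w.
Proof. by rewrite innerDl innerNl. Qed.
Lemma innerBr u v w : inner u (v - w) = inner u v - inner u w.
Proof. by rewrite innerDr innerNr. Qed.
Lemma innerZl c u v : inner (c *: u) v = c * inner u v.
Proof. exact: linearZl_LR. Qed.
Lemma innerZr c u v : inner u (c *: v) = Num.conj c * inner u v.
Proof. by rewrite linearZr_LR. Qed.
Lemma inner0l u : inner 0 u = 0. Proof. exact: linear0l. Qed.
Lemma inner0r u : inner u 0 = 0. Proof. exact: linear0r. Qed.
Lemma innerC u v : inner u v = Num.conj (inner v u).
Proof. by rewrite hermC expr0 mul1r. Qed.
Lemma inner_suml (I : Type) (s : seq I) (F : I -> H) v :
  inner (\sum_(i <- s) F i) v = \sum_(i <- s) inner (F i) v.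
Proof. exact: linear_sumlz. Qed.

Lemma innervv v : inner v v = (rnorm v ^+ 2)%:C.
Proof. by rewrite inner_norm normE rmorphXn. Qed.
Lemma rinnervv v : rinner v v = rnorm v ^+ 2. Proof. by rewrite /rinner innervv. Qed.
Lemma rinnerC u v : rinner u v = rinner v u.
Proof. by rewrite /rinner innerC conjCE. Qed.
Lemma rinnerDl u v w : rinner (u + v) w = rinner u w + rinner v w.
Proof. by rewrite /rinner innerDl ReD. Qed.
Lemma rinnerDr u v w : rinner u (v + w) = rinner u v + rinner u w.
Proof. by rewrite /rinner innerDr ReD. Qed.
Lemma rinnerNl u v : rinner (- u) v = - rinner u v.
Proof. by rewrite /rinner innerNl -[- inner _ _]sub0r ReB sub0r. Qed.
Lemma rinnerNr u v : rinner u (- v) = - rinner u v.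
Proof. by rewrite rinnerC rinnerNl rinnerC. Qed.
Lemma rinnerBl u v w : rinner (u - v) w = rinner u w - rinner v w.
Proof. by rewrite rinnerDl rinnerNl. Qed.
Lemma rinnerBr u v w : rinner u (v - w) = rinner u v - rinner u w.
Proof. by rewrite rinnerDr rinnerNr. Qed.
Lemma rinnerZl a u v : rinner (a%:C *: u) v = a * rinner u v.
Proof. by rewrite /rinner innerZl ReZ. Qed.
Lemma rinnerZr a u v : rinner u (a%:C *: v) = a * rinner u v.
Proof. by rewrite rinnerC rinnerZl rinnerC. Qed.
Lemma rinner0l u : rinner 0 u = 0. Proof. by rewrite /rinner inner0l. Qed.

(** Cauchy-Schwarz for the real part comes out of the triangle inequality, which the normed
    structure already provides: square it and cancel the two squared norms. *)
Lemma rinner_le u v : rinner u v <= rnorm u * rnorm v.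
Proof.
have h : rnorm (u + v) ^+ 2 <= (rnorm u + rnorm v) ^+ 2.
  by rewrite ler_sqr ?nnegrE ?addr_ge0 ?rnorm_ge0 // rnormD.
move: h; rewrite -rinnervv rinnerDl !rinnerDr !rinnervv (rinnerC v u) sqrrD; lra.
Qed.

Lemma inner_le u v : complex.Re `|inner u v| <= rnorm u * rnorm v.
Proof.
have [z0|z0] := eqVneq (inner u v) 0.
  by rewrite z0 normr0 /= mulr_ge0 ?rnorm_ge0.
(* The phase [c] rotates [u] until the inner product becomes real and equal to [|z|], so that the
   real version applies. *)
pose z := inner u v; pose c := Num.conj z / `|z|.
have nz : `|z| != 0 by rewrite normr_eq0.
have hc : `|c| = 1 by rewrite /c normrM norm_conjC normfV normr_id divff.
have hz : inner (c *: u) v = `|z|.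
  by rewrite innerZl /c mulrAC [_ * z]mulrC -normCK expr2 mulfK.
have := rinner_le (c *: u) v; rewrite /rinner hz rnormZ hc /= mul1r.
exact.
Qed.

Lemma inner_eq0_all u : (forall v, inner u v = 0) -> u = 0.
Proof.
move=> /(_ u) h; apply/eqP; rewrite -rnorm_eq0 -sqrf_eq0 -rinnervv /rinner h.
by [].
Qed.

Lemma rnorm_sqD u v : rnorm (u + v) ^+ 2 = rnorm u ^+ 2 + 2 * rinner u v + rnorm v ^+ 2.
Proof. by rewrite -!rinnervv rinnerDl !rinnerDr (rinnerC v u); ring. Qed.
Lemma rnorm_sqB u v : rnorm (u - v) ^+ 2 = rnorm u ^+ 2 - 2 * rinner u v + rnorm v ^+ 2.
Proof. by rewrite rnorm_sqD rnormN rinnerNr; ring. Qed.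

Definition seq_cvg (u : nat -> H) l :=
  forall e : R, 0 < e -> exists N, forall n, (N <= n)%N -> rnorm (u n - l) < e.

Lemma ltCE (e : R[i]) : 0 < e -> e = (complex.Re e)%:C /\ 0 < complex.Re e.
Proof. by rewrite ltcE /=; case: e => a b /= /andP[/eqP -> h]. Qed.

Lemma closureE (S : set H) v :
  closure S v <-> forall e : R, 0 < e -> exists s, S s /\ rnorm (v - s) < e.
Proof.
split=> [h e e0|h B /nbhs_ballP[e /= e0]].
  have e0' : 0 < e%:C by rewrite ltcR.
  have [s [Ss]] := h _ (nbhsx_ballx v _ e0').
  by rewrite -ball_normE /= normE ltcR; exists s.
have [-> {}e0] := ltCE e0; have [s [Ss vs]] := h _ e0.
rewrite -ball_normE => /(_ s) Bs; exists s; split => //; apply: Bs => /=.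
by rewrite normE ltcR.
Qed.

Lemma closedE (S : set H) : closed S <->
  forall v, (forall e : R, 0 < e -> exists s, S s /\ rnorm (v - s) < e) -> S v.
Proof. by split=> h v /closureE; [exact: h|exact: h]. Qed.

Lemma closed_cvs (S : set H) (u : nat -> H) l : closed S -> (forall n, S (u n)) -> seq_cvg u l ->
  S l.
Proof.
move=> /closedE h Su ul; apply: h => e e0; have [N hN] := ul _ e0.
by exists (u N); split => //; rewrite rnormC hN.
Qed.

(** The bound depends on the earlier index only, as for the tails of a convergent series;
    completeness is used in this form. *)
Lemma cauchy_cvs (u : nat -> H) (b : nat -> R) :
  (forall m n, (n <= m)%N -> rnorm (u m - u n) <= b n) ->
  (forall e : R, 0 < e -> exists n, b n < e) ->
  exists l, seq_cvg u l.
Proof.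
move=> hu hb.
have cu : cauchy (u @ \oo).
  apply: cauchy_exP => e /ltCE [-> e0].
  have [N hN] := hb _ e0; exists (u N); exists N => // n /= Nn.
  by rewrite -ball_normE /= distrC normE ltcR (le_lt_trans (hu _ _ Nn)).
have /cauchy_cvgP /cvg_ex [l /= hl] := cu; exists l => e e0.
have e0' : 0 < e%:C by rewrite ltcR.
have /hl := nbhsx_ballx l _ e0'; move=> [N _ hN]; exists N => n Nn.
have := hN n Nn.
by rewrite -ball_normE /= distrC normE ltcR.
Qed.

Lemma seq_cvg_uniq (u : nat -> H) l l' : seq_cvg u l -> seq_cvg u l' -> l = l'.
Proof.
move=> h h'; apply/eqP; rewrite -subr_eq0 -rnorm_eq0.
apply/eqP/le_anti; rewrite rnorm_ge0 andbT leNgt; apply/negP => e0.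
have [N hN] := h (rnorm (l - l') / 2) ltac:(lra).
have [N' hN'] := h' (rnorm (l - l') / 2) ltac:(lra).
have := hN _ (leq_maxl N N'); have := hN' _ (leq_maxr N N').
set w := u _; have := rnormD (l - w) (w - l').
by rewrite subrKA (rnormC l w); lra.
Qed.

Lemma seq_cvg_cst v : seq_cvg (fun=> v) v.
Proof. by move=> e e0; exists 0%N => n _; rewrite subrr rnorm0. Qed.

Lemma seq_cvgD (u u' : nat -> H) l l' : seq_cvg u l -> seq_cvg u' l' -> seq_cvg (fun n => u n + u' n) (l + l').
Proof.
move=> h h' e e0.
have [N hN] := h (e / 2) ltac:(lra); have [N' hN'] := h' (e / 2) ltac:(lra).
exists (maxn N N') => n; rewrite geq_max => /andP[Nn Nn'].
have := hN _ Nn; have := hN' _ Nn'.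
have := rnormD (u n - l) (u' n - l').
by rewrite opprD addrACA; lra.
Qed.

Lemma seq_cvgN (u : nat -> H) l : seq_cvg u l -> seq_cvg (fun n => - u n) (- l).
Proof.
move=> h e e0; have [N hN] := h e e0; exists N => n Nn.
by rewrite -opprD rnormN hN.
Qed.

Lemma seq_cvgB (u u' : nat -> H) l l' : seq_cvg u l -> seq_cvg u' l' -> seq_cvg (fun n => u n - u' n) (l - l').
Proof. by move=> h /seq_cvgN; exact: seq_cvgD. Qed.

Lemma seq_cvg_shift (u : nat -> H) l : seq_cvg u l -> seq_cvg (fun n => u n.+1) l.
Proof. by move=> h e e0; have [N hN] := h _ e0; exists N => n Nn; rewrite hN ?(leqW Nn). Qed.

Lemma seq_cvg_ext (u u' : nat -> H) l : u =1 u' -> seq_cvg u l -> seq_cvg u' l.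
Proof. by move=> e h d d0; have [N hN] := h _ d0; exists N => n Nn; rewrite -e hN. Qed.

Lemma rnorm_cvs_le (u : nat -> H) l (M : R) : seq_cvg u l -> (forall n, rnorm (u n) <= M) -> rnorm l <= M.
Proof.
move=> h hM; rewrite leNgt; apply/negP => lt.
have [N hN] := h (rnorm l - M) ltac:(lra).
have := hN N (leqnn _); have := hM N; have := rnormD (l - u N) (u N).
by rewrite subrK rnormC; lra.
Qed.

End HilbertBasics.

Section HilbertOps.
Variables (R : realType) (H K : hilbertType R).

Lemma seq_cvg_bounded (f : H -> K) (M : R) (u : nat -> H) l :
  (forall v w, rnorm (f v - f w) <= M * rnorm (v - w)) ->
  seq_cvg u l -> seq_cvg (fun n => f (u n)) (f l).
Proof.
move=> hf h e e0.
have M1 : 0 < `|M| + 1 by rewrite ltr_wpDl.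
have [N hN] := h (e / (`|M| + 1)) (divr_gt0 e0 M1).
exists N => n Nn; apply: le_lt_trans (hf _ _) _.
apply: (@le_lt_trans _ _ ((`|M| + 1) * rnorm (u n - l))).
  by rewrite ler_wpM2r ?rnorm_ge0 // (le_trans (ler_norm M)) // lerDl.
by rewrite mulrC -ltr_pdivlMr // hN.
Qed.

End HilbertOps.

(** * Orthonormal bases and absolute values *)

Section InnerLimits.
Variables (R : realType) (H K : hilbertType R).

(** Adjointness survives strong limits, by Cauchy-Schwarz in each slot. With a constant sequence in
    one slot the lemma also computes the limit of a coefficient. *)
Lemma inner_cvs (u : nat -> H) l w (u' : nat -> K) l' w' :
  seq_cvg u l -> seq_cvg u' l' -> (forall n, inner (u n) w = inner w' (u' n)) ->
  inner l w = inner w' l'.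
Proof.
move=> h h' e; apply/eqP; rewrite -subr_eq0 -normr_eq0; apply: contraT => z0.
suff: False by [].
set z := _ - _ in z0.
have [ez e0] : `|z| = (complex.Re `|z|)%:C /\ 0 < complex.Re `|z|.
  by apply: ltCE; rewrite lt_def z0 normr_ge0.
set d := complex.Re _ in ez e0.
have w1 : 0 < rnorm w + 1 by rewrite ltr_wpDl ?rnorm_ge0.
have w2 : 0 < rnorm w' + 1 by rewrite ltr_wpDl ?rnorm_ge0.
have d2 : 0 < d / 2 by lra.
have [N hN] := h _ (divr_gt0 d2 w1); have [N' hN'] := h' _ (divr_gt0 d2 w2).
have := hN _ (leq_maxl N N'); have := hN' _ (leq_maxr N N').
set n := maxn _ _; rewrite !ltr_pdivlMr // => b1 b2.
have : `|z| <= (rnorm (l - u n) * rnorm w + rnorm w' * rnorm (l' - u' n))%:C.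
  have -> : z = inner (l - u n) w - inner w' (l' - u' n).
    by rewrite innerBl innerBr e /z; ring.
  apply: le_trans (ler_normB _ _) _; rewrite rmorphD lerD //.
    by rewrite -[leLHS]RRe_real ?normr_real // lecR inner_le.
  by rewrite -[leLHS]RRe_real ?normr_real // lecR inner_le.
rewrite ez lecR; have := rnorm_ge0 (l - u n); have := rnorm_ge0 (l' - u' n).
rewrite (rnormC l) (rnormC l') => ? ?.
have : rnorm (u n - l) * rnorm w <= rnorm (u n - l) * (rnorm w + 1).
  by rewrite ler_wpM2l // lerDl.
have : rnorm w' * rnorm (u' n - l') <= rnorm (u' n - l') * (rnorm w' + 1).
  by rewrite mulrC ler_wpM2l // lerDl.
by lra.
Qed.

End InnerLimits.

Section OrthonormalBasis.
Variables (R : realType) (H : hilbertType R) (I : eqType) (e : I -> H).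
Hypothesis he : orthonormal_basis e.

Lemma onb_inner k l : inner (e k) (e l) = (k == l)%:R.
Proof. by case: he. Qed.

Lemma onb_ind (V : set H) : closed V -> V 0 ->
  (forall (c : R[i]) u v, V u -> V v -> V (c *: u + v)) ->
  (forall k, V (e k)) -> forall v, V v.
Proof.
move=> cV V0 VL Ve v; apply: cV; case: he => _ hd.
have : closure V v; last by [].
have : [set: H] v by [].
rewrite -hd; apply: closure_subset => _ [s [c ->]].
elim: s => [|k s IH]; first by rewrite big_nil.
by rewrite big_cons; apply: VL.
Qed.

Lemma closed_ortho (v : H) : closed [set w | inner v w = 0].
Proof.
apply/closedE => w h /=; apply/eqP; rewrite -normr_eq0; apply: contraT => z0.
suff: False by [].
have [ez e0] : `|inner v w| = (complex.Re `|inner v w|)%:C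
   /\ 0 < complex.Re `|inner v w|.
  by apply: ltCE; rewrite lt_def z0 normr_ge0.
have w1 : 0 < rnorm v + 1 by rewrite ltr_wpDl ?rnorm_ge0.
have [s [Ss]] := h _ (divr_gt0 e0 w1); rewrite ltr_pdivlMr // => b.
have {}Ss : inner v s = 0 := Ss.
have := inner_le v (w - s); rewrite innerBr Ss subr0.
have : rnorm v * rnorm (w - s) <= rnorm (w - s) * (rnorm v + 1).
  by rewrite mulrC ler_wpM2l ?rnorm_ge0 // lerDl.
by lra.
Qed.

Lemma onb_eq0 (v : H) : (forall k, inner v (e k) = 0) -> v = 0.
Proof.
move=> h; apply: inner_eq0_all => w.
apply: (@onb_ind [set w | inner v w = 0]) => //=.
- exact: closed_ortho.
- exact: inner0r.
- by move=> c x y /= hx hy; rewrite innerDr innerZr hx hy mulr0 addr0.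
Qed.

Lemma onb_inj (v w : H) : (forall k, inner v (e k) = inner w (e k)) -> v = w.
Proof.
move=> h; apply/eqP; rewrite -subr_eq0; apply/eqP/onb_eq0 => k.
by rewrite innerBl h subrr.
Qed.

End OrthonormalBasis.

Section RepBasics.
Variables (R : realType) (A : starAlgType R) (pi : starRep A).
Local Notation H := (rep_space pi).
Implicit Types (a b : A) (v w : H).

Lemma repD a b v : pi (a + b) v = pi a v + pi b v.
Proof. by have := rep_linear 1 a b v; rewrite !scale1r. Qed.
Lemma rep0 v : pi 0 v = 0.
Proof. by have := repD 0 0 v; rewrite addr0 => /eqP; rewrite -subr_eq0 opprD addNKr oppr_eq0 => /eqP. Qed.
Lemma repZ c a v : pi (c *: a) v = c *: pi a v.
Proof. by have := rep_linear c a 0 v; rewrite !addr0 rep0 addr0. Qed.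
Lemma repN a v : pi (- a) v = - pi a v.
Proof. by rewrite -scaleN1r repZ scaleN1r. Qed.
Lemma repB a b v : pi (a - b) v = pi a v - pi b v.
Proof. by rewrite repD repN. Qed.
Lemma rep_vZ a c v : pi a (c *: v) = c *: pi a v. Proof. exact: linearZ. Qed.
Lemma rep_vD a u v : pi a (u + v) = pi a u + pi a v. Proof. exact: linearD. Qed.
Lemma rep_vB a u v : pi a (u - v) = pi a u - pi a v. Proof. exact: linearB. Qed.
Lemma rep_v0 a : pi a 0 = 0. Proof. exact: linear0. Qed.
Lemma rep_starr a v w : inner (pi (star a) v) w = inner v (pi a w).
Proof. by rewrite rep_star starK. Qed.

Lemma rinner_star a v w : rinner (pi a v) w = rinner v (pi (star a) w).
Proof. by rewrite /rinner rep_star. Qed.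
Lemma rinner_starr a v w : rinner (pi (star a) v) w = rinner v (pi a w).
Proof. by rewrite /rinner rep_starr. Qed.

Lemma rep_lip a : exists M : R, forall v w, rnorm (pi a v - pi a w) <= M * rnorm (v - w).
Proof.
have [M hM] := rep_bounded pi a; exists (complex.Re M) => v w.
rewrite -linearB; have := hM (v - w); rewrite !normE lecE => /andP[_ /=].
by rewrite mulrC ReZ mulrC.
Qed.

Lemma rep_cvs a (u : nat -> H) l : seq_cvg u l -> seq_cvg (fun n => pi a (u n)) (pi a l).
Proof. by have [M hM] := rep_lip a; apply: seq_cvg_bounded hM. Qed.

Lemma closed_rep_eq a b : closed [set v : H | pi a v = pi b v].
Proof.
apply/closedE => v h /=; apply/eqP; rewrite -subr_eq0 -rnorm_eq0.
apply/eqP/le_anti; rewrite rnorm_ge0 andbT leNgt; apply/negP => e0.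
have [M hM] := rep_lip (a - b).
have M1 : 0 < `|M| + 1 by rewrite ltr_wpDl.
have [s [/= es]] := h _ (divr_gt0 e0 M1); rewrite ltr_pdivlMr // => lt.
have := hM v s; rewrite !repB es subrr subr0.
have : M * rnorm (v - s) <= rnorm (v - s) * (`|M| + 1).
  by rewrite mulrC ler_wpM2l ?rnorm_ge0 // (le_trans (ler_norm M)) // lerDl.
by lra.
Qed.

(** Bounded operators carry the closure of an invariant subspace into itself, so irreducibility also
    applies to subspaces that are not closed, such as spans of words. *)
Lemma irreducible_closure (S : set H) : irreducible pi -> S 0 ->
  (forall (c : R[i]) u v, S u -> S v -> S (c *: u + v)) ->
  (forall a v, S v -> S (pi a v)) ->
  (exists v, S v /\ v != 0) -> closure S = setT.
Proof.
move=> [_ irr] S0 SL SA [v [Sv v0]].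
have [||||h|//] := irr (closure S).
- exact: closed_closure.
- exact: subset_closure.
- move=> c x y /closureE hx /closureE hy; apply/closureE => e e0.
  have c1 : 0 < complex.Re `|c| + 1.
    by rewrite ltr_wpDl // -ler0c RRe_real ?normr_real.
  have [s [Ss hs]] := hx (e / 2 / (complex.Re `|c| + 1)) ltac:(rewrite divr_gt0 //; lra).
  have [t [St ht]] := hy (e / 2) ltac:(lra).
  exists (c *: s + t); split; first exact: SL.
  rewrite opprD addrACA -scalerBr; apply: le_lt_trans (rnormD _ _) _; rewrite rnormZ.
  move: hs; rewrite ltr_pdivlMr // mulrDr mulr1 mulrC; have := rnorm_ge0 (x - s).
  by lra.
- move=> a x /closureE hx; apply/closureE => e e0.
  have [M hM] := rep_lip a.
  have M1 : 0 < `|M| + 1 by rewrite ltr_wpDl.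
  have [s [Ss]] := hx _ (divr_gt0 e0 M1); rewrite ltr_pdivlMr // => lt.
  exists (pi a s); split; first exact: SA.
  have : M * rnorm (x - s) <= rnorm (x - s) * (`|M| + 1).
    by rewrite mulrC ler_wpM2l ?rnorm_ge0 // (le_trans (ler_norm M)) // lerDl.
  by have := hM x s; lra.
- have : closure S v by exact: subset_closure.
  by rewrite h => /= ev; rewrite ev eqxx in v0.
Qed.

End RepBasics.

Section AbsoluteValue.
Variables (R : realType) (A : starAlgType R) (pi : starRep A).
Local Notation H := (rep_space pi).

Section Iteration.
Variable b : A.
Hypothesis sb : star b = b.
Hypothesis nb : forall v : H, rnorm (pi b v) <= rnorm v.

Let half : R[i] := (2^-1 : R)%:C.

(* This iteration, started at 0, converges to y = 1 - sqrt(1 - b), the solution of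
   y = (b + y^2) / 2; the same recursion with b = 1 bounds the operators and their increments,
   so no functional calculus is needed. *)
Fixpoint sqrt_iter n : A :=
  if n is m.+1 then half *: (b + sqrt_iter m * sqrt_iter m) else 0.
Fixpoint sqrt_bound n : R :=
  if n is m.+1 then 2^-1 * (1 + sqrt_bound m * sqrt_bound m) else 0.
Local Notation y := sqrt_iter.
Local Notation z := sqrt_bound.

Let z_ge0_le1 n : 0 <= z n <= 1.
Proof.
elim: n => [|n /andP[h0 h1]] /=; first by rewrite lexx ler01.
by apply/andP; split; nra.
Qed.

Let z_mono n : z n <= z n.+1.
Proof.
elim: n => [|n IH]; first by case/andP: (z_ge0_le1 1).
have /andP[h0 _] := z_ge0_le1 n; have /andP[h1 _] := z_ge0_le1 n.+1.
have zS m : z m.+1 = 2^-1 * (1 + z m * z m) by [].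
move: IH h0 h1; rewrite (zS n.+1); have := zS n.
set u := z n.+1; set w := z n => eu wu w0 u0.
have : w * w <= u * u by apply: ler_pM.
by lra.
Qed.

Let y_comm a : a * b = b * a -> forall n, a * y n = y n * a.
Proof.
move=> ab; elim=> [|n IH] /=; first by rewrite mulr0 mul0r.
by rewrite -scalerAr -scalerAl mulrDr mulrDl ab !mulrA IH -!mulrA IH.
Qed.

Let y_commy m n : y m * y n = y n * y m.
Proof. by apply: y_comm; rewrite -y_comm. Qed.

Let y_star n : star (y n) = y n.
Proof.
elim: n => [|n IH] /=; first exact: star0.
by rewrite starZ starD starM IH sb conjCE /= oppr0.
Qed.

Let y_bound n v : rnorm (pi (y n) v) <= z n * rnorm v.
Proof.
elim: n v => [|n IH] v /=; first by rewrite rep0 rnorm0 mul0r.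
rewrite repZ rnormZr ger0_norm ?invr_ge0 // -mulrA ler_wpM2l ?invr_ge0 //.
rewrite repD mulrDl mul1r; apply: le_trans (rnormD _ _) _; rewrite lerD //.
rewrite rep_M; apply: le_trans (IH _) _; rewrite -mulrA ler_wpM2l //.
by case/andP: (z_ge0_le1 n).
Qed.

Let y_diff n v : rnorm (pi (y n.+1 - y n) v) <= (z n.+1 - z n) * rnorm v.
Proof.
elim: n v => [|n IH] v; first by have := y_bound 1 v; rewrite /= !subr0.
(* The iterates are polynomials in [b] and commute, so the difference of squares factors. The scalar
   recursion factors in the same way, and the bounds match factor by factor. *)
have -> : y n.+2 - y n.+1 = half *: ((y n.+1 - y n) * (y n.+1 + y n)).
  rewrite -[y n.+2]/(half *: (b + y n.+1 * y n.+1)).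
  rewrite -[X in _ - X]/(half *: (b + y n * y n)) -scalerBr; congr (_ *: _).
  rewrite mulrDr !mulrBl (y_commy n n.+1) opprD addrACA subrr add0r.
  by rewrite addrA subrK.
have -> : z n.+2 - z n.+1 = 2^-1 * ((z n.+1 - z n) * (z n.+1 + z n)).
  rewrite -[z n.+2]/(2^-1 * (1 + z n.+1 * z n.+1)).
  by rewrite -[X in _ - X]/(2^-1 * (1 + z n * z n)); ring.
rewrite repZ rnormZr ger0_norm ?invr_ge0 // -mulrA ler_wpM2l ?invr_ge0 //.
rewrite rep_M; apply: le_trans (IH _) _; rewrite -mulrA ler_wpM2l ?subr_ge0 //.
by rewrite repD mulrDl; apply: le_trans (rnormD _ _) _; rewrite lerD.
Qed.

Let y_diffm m n v : (n <= m)%N ->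
  rnorm (pi (y m) v - pi (y n) v) <= (z m - z n) * rnorm v.
Proof.
move=> /subnK <-; elim: (m - n)%N => [|d IH].
  by rewrite add0n !subrr rnorm0 mul0r.
rewrite addSn -(subrKA (pi (y (d + n)) v)); apply: le_trans (rnormD _ _) _.
have := y_diff (d + n) v; rewrite repB.
by move: IH; set D := (d + n)%N; nra.
Qed.

Let Y_ex v : exists l, seq_cvg (fun n => pi (y n) v) l.
Proof.
have zs : has_sup (range z).
  split; first by exists (z 0); exists 0%N.
  by exists 1 => _ [n _ <-]; case/andP: (z_ge0_le1 n).
apply: (@cauchy_cvs _ _ _ (fun n => (sup (range z) - z n) * rnorm v)).
  move=> m n nm_; apply: le_trans (y_diffm v nm_) _.
  by rewrite ler_wpM2r ?rnorm_ge0 // lerB //; apply: sup_upper_bound.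
move=> e e0; have v1 : 0 < rnorm v + 1 by rewrite ltr_wpDl ?rnorm_ge0.
have [_ [n _ <-] hn] := sup_adherent (divr_gt0 e0 v1) zs.
exists n; move: hn; rewrite ltrBlDr -ltrBlDl ltr_pdivlMr //.
apply: le_lt_trans; rewrite ler_wpM2l ?lerDl // subr_ge0.
by apply: sup_upper_bound.
Qed.

(** The strong limit of the iterates. The default 0 of [xget] is never reached, because [Y_ex]
    provides a limit for every vector. *)
Let Y v := xget 0 [set l | seq_cvg (fun n => pi (y n) v) l].
Let YP v : seq_cvg (fun n => pi (y n) v) (Y v).
Proof. by rewrite /Y; case: xgetP => // h; have [l hl] := Y_ex v; case: (h l). Qed.

Let Y_le v : rnorm (Y v) <= rnorm v.
Proof.
apply: rnorm_cvs_le (YP v) _ => n; apply: le_trans (y_bound _ _) _.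
by have /andP[_ ?] := z_ge0_le1 n; rewrite ler_piMl ?rnorm_ge0.
Qed.

Let Y_comm a : (forall v : H, pi a (pi b v) = pi b (pi a v)) ->
  forall v, pi a (Y v) = Y (pi a v).
Proof.
move=> ab v; apply: seq_cvg_uniq (rep_cvs a (YP v)) _.
apply: seq_cvg_ext (YP (pi a v)) => n.
elim: n v => [|n IH] v /=; first by rewrite !rep0 linear0.
by rewrite !repZ !repD !rep_M rep_vZ rep_vD ab !IH.
Qed.

Let Y_linear c u v : Y (c *: u + v) = c *: Y u + Y v.
Proof.
apply: seq_cvg_uniq (YP _) _.
have hZ : seq_cvg (fun n => pi (y n) (c *: u)) (c *: Y u).
  have hc : seq_cvg (fun n => pi (c *: (1 : A)) (pi (y n) u)) (pi (c *: (1 : A)) (Y u)).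
    exact: rep_cvs (YP u).
  rewrite repZ rep_1 in hc; apply: seq_cvg_ext hc => n.
  by rewrite repZ rep_1 linearZ.
by apply: seq_cvg_ext (seq_cvgD hZ (YP v)) => n; rewrite linearD.
Qed.

Let Y_sa u v : inner (Y u) v = inner u (Y v).
Proof.
by apply: inner_cvs (YP u) (YP v) _ => n; rewrite rep_star y_star.
Qed.

Let Y_eq v : Y (Y v) = Y v + Y v - pi b v.
Proof.
apply/eqP; rewrite -subr_eq0; apply/eqP.
have h2 : seq_cvg (fun n => pi (y n) (pi (y n) v)) (Y (Y v)).
  (* All [y n] are contractions, so applying them to the vanishing difference [pi (y n) v - Y v]
     still gives a null sequence. *)
  have hd : seq_cvg (fun n => pi (y n) (pi (y n) v - Y v)) 0.
    move=> e e0; have [N hN] := YP v e0; exists N => n Nn.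
    rewrite subr0; apply: le_lt_trans (y_bound _ _) _.
    apply: le_lt_trans (hN n Nn).
    by have /andP[_ ?] := z_ge0_le1 n; rewrite ler_piMl ?rnorm_ge0.
  have := seq_cvgD hd (YP (Y v)); rewrite add0r; apply: seq_cvg_ext => n.
  by rewrite linearB /= subrK.
have h1 := seq_cvg_shift (YP v).
apply: (@seq_cvg_uniq _ _ (fun=> 0)); last exact: seq_cvg_cst.
have := seq_cvgB h2 (seq_cvgB (seq_cvgD h1 h1) (seq_cvg_cst (pi b v))); apply: seq_cvg_ext => n /=.
rewrite repZ repD rep_M -scalerDl -rmorphD.
have -> : (2^-1 + 2^-1 : R) = 1 by field.
by rewrite scale1r addrAC subrr add0r subrr.
Qed.

(** With [S = 1 - Y], the equation [Y^2 = 2 Y - b] gives [S^2 = 1 - b], and [S] is positive because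
    [Y] is a contraction. [S] need not come from the algebra; the last clause is the substitute that
    makes it preserve eigenspaces of operators commuting with [b]. *)
Lemma sqrt_one_minus : exists S : H -> H,
  [/\ forall c u v, S (c *: u + v) = c *: S u + S v,
      forall v, S (S v) = v - pi b v,
      forall v, 0 <= rinner (S v) v,
      forall u v, inner (S u) v = inner u (S v) &
      forall a, (forall v : H, pi a (pi b v) = pi b (pi a v)) ->
        forall v, pi a (S v) = S (pi a v)].
Proof.
have YB u v : Y (u - v) = Y u - Y v.
  by rewrite addrC -scaleN1r Y_linear scaleN1r addrC.
exists (fun v => v - Y v); split.
- by move=> c u v; rewrite Y_linear scalerBr opprD addrACA.
- move=> v; rewrite YB Y_eq; set p := Y v; set c := pi b v.
  have -> : p - (p + p - c) = c - p by rewrite opprB addrCA opprD addNKr.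
  by rewrite opprB addrA subrK.
- move=> v; rewrite rinnerBl rinnervv subr_ge0 expr2.
  by apply: le_trans (rinner_le _ _) _; rewrite ler_wpM2r ?rnorm_ge0.
- by move=> u v; rewrite innerBl innerBr Y_sa.
- by move=> a /Y_comm h v; rewrite linearB /= h.
Qed.

End Iteration.

(** The absolute value is the square root of [h^2 = 1 - b] for [b = 1 - h^2]. *)
Lemma rep_abs (h : A) : star h = h -> (forall v : H, rnorm (pi h v) <= rnorm v) ->
  exists S : H -> H,
  [/\ forall c u v, S (c *: u + v) = c *: S u + S v,
      forall v, S (S v) = pi h (pi h v),
      forall v, 0 <= rinner (S v) v,
      forall u v, inner (S u) v = inner u (S v) &
      forall a, (forall v : H, pi a (pi h v) = pi h (pi a v)) ->
        forall v, pi a (S v) = S (pi a v)].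
Proof.
move=> sh nh.
have bE v : pi (1 - h * h) v = v - pi h (pi h v) by rewrite repB rep_1 rep_M.
have [||S [SL SS Spos Ssa Sc]] := @sqrt_one_minus (1 - h * h).
- by rewrite starD star1 -scaleN1r starZ starM sh rmorphN rmorph1.
(* [|v - h^2 v|^2 = |v|^2 - 2 |h v|^2 + |h^2 v|^2], and the last term is at most [|h v|^2]. *)
- move=> v; rewrite bE -ler_sqr ?nnegrE ?rnorm_ge0 // rnorm_sqB.
  have -> : rinner v (pi h (pi h v)) = rnorm (pi h v) ^+ 2.
    by rewrite -rinnervv rinner_star sh.
  have : rnorm (pi h (pi h v)) ^+ 2 <= rnorm (pi h v) ^+ 2.
    by rewrite ler_sqr ?nnegrE ?rnorm_ge0.
  by have := sqr_ge0 (rnorm (pi h v)); lra.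
exists S; split => //.
- by move=> v; rewrite SS bE subKr.
- by move=> a ha; apply: Sc => v; rewrite !bE linearB /= !ha.
Qed.

End AbsoluteValue.

(** * Square-summable families *)

Section CountableSums.
Variables (R : realType) (I : countType).
Implicit Types (h : I -> R).

(** Sums over a countable type are taken along the pickling codes; [pmap] drops the codes that
    decode to nothing. *)
Definition enum_upto N : seq I := pmap (@pickle_inv I) (iota 0 N).

Lemma enum_upto_uniq N : uniq (enum_upto N).
Proof.
apply: pmap_uniq (iota_uniq _ _).
exact: pickle_invK.
Qed.

Lemma mem_enum_upto N i : (pickle i < N)%N -> i \in enum_upto N.
Proof.
move=> lt; rewrite mem_pmap; apply/mapP; exists (pickle i); last by rewrite pickleK_inv.
by rewrite mem_iota.
Qed.

Lemma sub_enum_upto (s : seq I) : exists N, {subset s <= enum_upto N}.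
Proof.
exists (\max_(i <- s) pickle i).+1 => i si; apply: mem_enum_upto.
by rewrite ltnS (big_rem i) //= leq_maxl.
Qed.

Definition psum h : R^nat := fun N => \sum_(i <- enum_upto N) h i.
(* Meaningful only when the partial sums converge; limits of divergent sequences are junk. *)
Definition csum h : R := limn (psum h).

Lemma psumE h : psum h = series (fun k => oapp h 0 (@pickle_inv I k)).
Proof.
apply/funext => N; rewrite /psum /series /enum_upto /= /index_iota subn0.
elim: (iota 0 N) => [|k s IH] /=; first by rewrite !big_nil.
by rewrite [RHS]big_cons -IH; case: pickle_inv => [i|] /=; rewrite ?big_cons ?add0r.
Qed.

Lemma le_sum_uniq h (s t : seq I) : (forall i, 0 <= h i) -> uniq s ->
  {subset s <= t} -> uniq t -> \sum_(i <- s) h i <= \sum_(i <- t) h i.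
Proof.
move=> h0 us st ut; rewrite [leRHS](bigID (mem s)) /=.
rewrite -[X in _ <= X + _]big_filter [X in _ <= X + _](perm_big s) /=; last first.
  apply: uniq_perm => [||i] //; first exact: filter_uniq.
  by rewrite mem_filter /= andb_idr // => /st.
by rewrite lerDl sumr_ge0.
Qed.

(** Bounding all finite subsums, not only the partial sums of one enumeration, makes comparison and
    reindexing independent of the order. *)
Definition sum_bounded h (M : R) :=
  forall s : seq I, uniq s -> \sum_(i <- s) h i <= M.

Lemma psum_nd h : (forall i, 0 <= h i) -> nondecreasing_seq (psum h).
Proof.
move=> h0; rewrite psumE; apply/nondecreasing_seqP => n.
by rewrite !seriesEnat /= big_nat_recr //= lerDl; case: pickle_inv => /=.
Qed.

Lemma psum_cvg h M : (forall i, 0 <= h i) -> sum_bounded h M -> cvgn (psum h).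
Proof.
move=> h0 hM; apply: nondecreasing_is_cvgn; first exact: psum_nd.
by exists M => _ [N _ <-]; apply/hM/enum_upto_uniq.
Qed.

Lemma csum_le h M : (forall i, 0 <= h i) -> sum_bounded h M -> csum h <= M.
Proof.
move=> h0 hM; apply: limr_le; first exact: psum_cvg hM.
by apply: nearW => N; apply/hM/enum_upto_uniq.
Qed.

Lemma sum_le_csum h M : (forall i, 0 <= h i) -> sum_bounded h M ->
  sum_bounded h (csum h).
Proof.
move=> h0 hM s us; have [N sN] := sub_enum_upto s.
apply: (@le_trans _ _ (psum h N)); first exact: le_sum_uniq (enum_upto_uniq N).
by apply: nondecreasing_cvgn_le; [exact: psum_nd|exact: psum_cvg hM].
Qed.

Definition abs_summable h := exists M, sum_bounded (fun i => `|h i|) M.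

Lemma abs_summable_cvg h : abs_summable h -> cvgn (psum h).
Proof.
move=> [M hM]; rewrite psumE; apply: normed_cvg.
have := @psum_cvg (fun i => `|h i|) M (fun i => normr_ge0 _) hM.
have e : (fun k => oapp (fun i => `|h i|) 0 (@pickle_inv I k)) =
    (fun k => `|oapp h 0 (@pickle_inv I k)|).
  by apply/funext => k; case: pickle_inv => //=; rewrite normr0.
by rewrite psumE e.
Qed.

Lemma abs_summable_le h (g : I -> R) :
  abs_summable g -> (forall i, `|h i| <= `|g i|) -> abs_summable h.
Proof.
move=> [M hM] le; exists M => s us; apply: le_trans (hM s us).
exact: ler_sum.
Qed.

Lemma abs_summableD h g : abs_summable h -> abs_summable g ->
  abs_summable (fun i => h i + g i).
Proof.
move=> [M hM] [M' hM']; exists (M + M') => s us.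
apply: le_trans (lerD (hM s us) (hM' s us)); rewrite -big_split /=.
by apply: ler_sum => i _; exact: ler_normD.
Qed.

Lemma abs_summableZ (a : R) h : abs_summable h -> abs_summable (fun i => a * h i).
Proof.
move=> [M hM]; exists (`|a| * M) => s us.
apply: (@le_trans _ _ (`|a| * \sum_(i <- s) `|h i|)); last by rewrite ler_wpM2l ?hM.
by rewrite mulr_sumr; apply: ler_sum => i _; rewrite normrM.
Qed.

Lemma csumD h g : abs_summable h -> abs_summable g ->
  csum (fun i => h i + g i) = csum h + csum g.
Proof.
move=> ah ag; rewrite /csum -limD; try exact: abs_summable_cvg.
by congr (limn _); apply/funext => N; rewrite /psum big_split.
Qed.

Lemma csumZ (a : R) h : abs_summable h -> csum (fun i => a * h i) = a * csum h.
Proof.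
move=> ah; apply/cvg_lim => //.
have -> : psum (fun i => a * h i) = (fun N => a * psum h N).
  by apply/funext => N; rewrite /psum mulr_sumr.
exact: cvgMl_tmp (abs_summable_cvg ah).
Qed.

Lemma csum1 h k : (forall i, i != k -> h i = 0) -> csum h = h k.
Proof.
move=> hk; apply/cvg_lim => //; apply: cvg_near_cst.
exists (pickle k).+1 => // N /= kN; rewrite /psum.
have kE : k \in enum_upto N by exact: mem_enum_upto.
rewrite (big_rem k) //= big_seq big1 ?addr0 // => i.
by rewrite mem_rem_uniq ?enum_upto_uniq // => /andP[/hk].
Qed.

End CountableSums.

Section SquareSummable.
Variables (R : realType) (I : countType).
Local Notation C := R[i].
Implicit Types (f g : I -> C).

Definition sqnorm (z : C) : R := complex.Re z ^+ 2 + complex.Im z ^+ 2.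

Lemma sqnorm_ge0 z : 0 <= sqnorm z.
Proof. by rewrite addr_ge0 ?sqr_ge0. Qed.

Lemma sqnormD z w : sqnorm (z + w) <= 2 * (sqnorm z + sqnorm w).
Proof.
case: z w => a b [c d]; rewrite /sqnorm /=.
have := sqr_ge0 (a - c); have := sqr_ge0 (b - d).
by rewrite !sqrrD !sqrrN !mulrN; lra.
Qed.

Lemma sqnormM z w : sqnorm (z * w) = sqnorm z * sqnorm w.
Proof.
case: z w => a b [c d]; rewrite -[_ * _]/((a * c - b * d) +i* (a * d + b * c)).
by rewrite /sqnorm /=; ring.
Qed.

Lemma sqnorm_eq0 z : sqnorm z = 0 -> z = 0.
Proof.
case: z => a b /eqP; rewrite /sqnorm /= paddr_eq0 ?sqr_ge0 // !sqrf_eq0.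
by move=> /andP[/eqP -> /eqP ->].
Qed.

Definition square_summable f := exists M, sum_bounded (fun i => sqnorm (f i)) M.

Lemma square_summableD f g : square_summable f -> square_summable g ->
  square_summable (f + g).
Proof.
move=> [M hM] [M' hM']; exists (2 * (M + M')) => s us.
apply: (@le_trans _ _ (\sum_(i <- s) 2 * (sqnorm (f i) + sqnorm (g i)))).
  by apply: ler_sum => i _; exact: sqnormD.
by rewrite -mulr_sumr big_split ler_wpM2l // lerD ?hM ?hM'.
Qed.

Lemma square_summableZ (c : C) f : square_summable f -> square_summable (c *: f).
Proof.
move=> [M hM]; exists (sqnorm c * M) => s us.
apply: (@le_trans _ _ (\sum_(i <- s) sqnorm c * sqnorm (f i))).
  by apply: ler_sum => i _; rewrite -sqnormM.
by rewrite -mulr_sumr ler_wpM2l ?sqnorm_ge0 ?hM.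
Qed.

Definition l2_pred : {pred I -> C} := fun f => `[< square_summable f >].

Fact l2_submod : submod_closed l2_pred.
Proof.
split=> [|c f g /asboolP hf /asboolP hg]; apply/asboolP.
  by exists 0 => s us; rewrite big1 // => i _; rewrite /sqnorm /= !expr0n addr0.
by apply: square_summableD => //; exact: square_summableZ.
Qed.

HB.instance Definition _ := GRing.isSubmodClosed.Build C (I -> C) l2_pred l2_submod.

Record l2 := L2 { l2_fun :> I -> C; l2_funP : l2_fun \in l2_pred }.
HB.instance Definition _ := [isSub for l2_fun].
HB.instance Definition _ := [Choice of l2 by <:].
HB.instance Definition _ := [SubChoice_isSubLmodule of l2 by <:].

End SquareSummable.

(** * The Hilbert space l2 over a countable index type *)

Section L2Inner.
Variables (R : realType) (I : countType).
Local Notation C := R[i].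
Local Notation l2 := (l2 R I).
Implicit Types (f g h : l2).

Lemma l2_sq f : square_summable f. Proof. by apply/asboolP; case: f. Qed.
Lemma l2_ext f g : f =1 g -> f = g.
Proof. by move=> e; apply: val_inj; apply/funext. Qed.
Lemma l2_addE f g i : (f + g) i = f i + g i. Proof. by []. Qed.
Lemma l2_scaleE (c : C) f i : (c *: f) i = c * f i. Proof. by []. Qed.
Lemma l2_subE f g i : (f - g) i = f i - g i. Proof. by []. Qed.

(** With [l2_im], the real and imaginary parts of [f i * conj (g i)]: the complex series is split
    into two real ones, to which [csum] applies. *)
Definition l2_re f g i : R :=
  complex.Re (f i) * complex.Re (g i) + complex.Im (f i) * complex.Im (g i).
Definition l2_im f g i : R :=
  complex.Im (f i) * complex.Re (g i) - complex.Re (f i) * complex.Im (g i).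

Definition l2_inner f g : C := csum (l2_re f g) +i* csum (l2_im f g).

Let sqnormD_ge0 (z w : C) : 0 <= sqnorm z + sqnorm w.
Proof. by apply: addr_ge0; exact: sqnorm_ge0. Qed.

Let l2_sum f g : abs_summable (fun i => sqnorm (f i) + sqnorm (g i)).
Proof.
have [M hM] := l2_sq f; have [M' hM'] := l2_sq g; exists (M + M') => s us.
rewrite (eq_bigr (fun i => sqnorm (f i) + sqnorm (g i))) => [|i _].
  by rewrite big_split lerD ?hM ?hM'.
by rewrite ger0_norm ?sqnormD_ge0.
Qed.

Lemma l2_re_sum f g : abs_summable (l2_re f g).
Proof.
apply: abs_summable_le (l2_sum f g) _ => i.
rewrite [leRHS]ger0_norm ?sqnormD_ge0 // ler_norml /l2_re /sqnorm.
set a := complex.Re _; set b := complex.Re _; set c := complex.Im _; set d := complex.Im _.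
have := sqr_ge0 (a - b); have := sqr_ge0 (a + b).
have := sqr_ge0 (c - d); have := sqr_ge0 (c + d).
rewrite !sqrrD !sqrrN !mulrN => *; apply/andP; split; nra.
Qed.

Lemma l2_im_sum f g : abs_summable (l2_im f g).
Proof.
apply: abs_summable_le (l2_sum f g) _ => i.
rewrite [leRHS]ger0_norm ?sqnormD_ge0 // ler_norml /l2_im /sqnorm.
set a := complex.Im _; set b := complex.Re _; set c := complex.Re _; set d := complex.Im _.
have := sqr_ge0 (a - b); have := sqr_ge0 (a + b).
have := sqr_ge0 (c - d); have := sqr_ge0 (c + d).
rewrite !sqrrD !sqrrN !mulrN => *; apply/andP; split; nra.
Qed.

Let csum_ext (h h' : I -> R) : h =1 h' -> csum h = csum h'.
Proof. by move=> e; congr csum; apply/funext. Qed.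

Lemma l2_innerC f g : l2_inner f g = Num.conj (l2_inner g f).
Proof.
rewrite conjCE /l2_inner /=; congr (_ +i* _).
  by apply: csum_ext => i; rewrite /l2_re mulrC [X in _ + X]mulrC.
rewrite -mulN1r -csumZ; last exact: l2_im_sum.
by apply: csum_ext => i; rewrite /l2_im; ring.
Qed.

Lemma l2_inner_linear g : GRing.linear_for *%R (l2_inner^~ g).
Proof.
move=> [a b] f h; rewrite /l2_inner.
rewrite -[(a +i* b) * _]/((a * _ - b * _) +i* (a * _ + b * _)).
rewrite -[(_ +i* _) + _]/((_ + _) +i* (_ + _)).
have re := l2_re_sum f g; have im := l2_im_sum f g.
have re' := l2_re_sum h g; have im' := l2_im_sum h g.
congr (_ +i* _).
- rewrite -mulNr -!csumZ // -!csumD //; try by apply: abs_summableD; exact: abs_summableZ.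
  + apply: csum_ext => i; rewrite /l2_re /l2_im l2_addE l2_scaleE.
    by case: (f i) (h i) (g i) => u v [w x] [y z] /=; ring.
  + exact: abs_summableZ.
  + exact: abs_summableZ.
- rewrite -!csumZ // -!csumD //; try by apply: abs_summableD; exact: abs_summableZ.
  + apply: csum_ext => i; rewrite /l2_re /l2_im l2_addE l2_scaleE.
    by case: (f i) (h i) (g i) => u v [w x] [y z] /=; ring.
  + exact: abs_summableZ.
  + exact: abs_summableZ.
Qed.

Definition l2_sqnorm f : R := csum (fun i => sqnorm (f i)).

Lemma l2_inner_diag f : l2_inner f f = (l2_sqnorm f)%:C.
Proof.
rewrite /l2_inner /l2_sqnorm; congr (_ +i* _).
rewrite (csum_ext (h' := fun i => 0 * l2_im f f i)) => [|i].
  by rewrite csumZ ?mul0r //; exact: l2_im_sum.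
by rewrite /l2_im mul0r mulrC subrr.
Qed.

Lemma l2_sqnorm_ub f : sum_bounded (fun i => sqnorm (f i)) (l2_sqnorm f).
Proof. by have [M hM] := l2_sq f; apply: sum_le_csum hM => i; exact: sqnorm_ge0. Qed.

Lemma l2_sqnorm_coord f i : sqnorm (f i) <= l2_sqnorm f.
Proof. by have := l2_sqnorm_ub f (s := [:: i]) isT; rewrite big_seq1. Qed.

Lemma l2_sqnorm_ge0 f : 0 <= l2_sqnorm f.
Proof. by have := l2_sqnorm_ub f (s := [::]) isT; rewrite big_nil. Qed.

Lemma l2_sqnorm_eq0 f : l2_sqnorm f = 0 -> f = 0.
Proof.
move=> h; apply: l2_ext => i; apply: sqnorm_eq0; apply/le_anti.
by rewrite sqnorm_ge0 andbT -h l2_sqnorm_coord.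
Qed.

Lemma l2_sqnorm_le f (M : R) : sum_bounded (fun i => sqnorm (f i)) M ->
  l2_sqnorm f <= M.
Proof. by apply: csum_le => i; exact: sqnorm_ge0. Qed.

Fact l2_inner_bilinear : bilinear_for *%R (Num.conj \; *%R) l2_inner.
Proof.
split=> [g|f]; first exact: l2_inner_linear.
move=> c g h; rewrite l2_innerC (l2_inner_linear f c g h) rmorphD rmorphM.
by congr (_ * _ + _); rewrite [RHS]l2_innerC.
Qed.

HB.instance Definition _ := bilinear_isBilinear.Build C l2 l2 C *%R
  (Num.conj \; *%R) l2_inner l2_inner_bilinear.

Fact l2_inner_hermitian f g :
  l2_inner f g = (-1) ^+ false * Num.conj (l2_inner g f).
Proof. by rewrite expr0 mul1r l2_innerC. Qed.

HB.instance Definition _ := isHermitianSesquilinear.Build C l2 false Num.conj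
  l2_inner l2_inner_hermitian.

Fact l2_inner_dot f : f != 0 -> 0 < l2_inner f f.
Proof.
move=> f0; rewrite l2_inner_diag ltcR lt_def l2_sqnorm_ge0 andbT.
by apply: contra f0 => /eqP/l2_sqnorm_eq0 ->.
Qed.

HB.instance Definition _ := isDotProduct.Build C l2 l2_inner l2_inner_dot.

Definition l2_norm f : C := (Num.sqrt (l2_sqnorm f))%:C.

(** Cauchy-Schwarz is proved afresh here: [rinner_le] presupposes the triangle inequality, which on
    l2 is deduced from this lemma. *)
Lemma l2_re_le f g :
  complex.Re (l2_inner f g) <= Num.sqrt (l2_sqnorm f) * Num.sqrt (l2_sqnorm g).
Proof.
(* The quadratic polynomial [|t g + f|^2] in a real variable; the bound is its value at the minimum
   [t = - B / l2_sqnorm g]. *)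
have Q (t : R) : 0 <= l2_sqnorm f + 2 * t * complex.Re (l2_inner f g) + t ^+ 2 * l2_sqnorm g.
  have := l2_sqnorm_ge0 (t%:C *: g + f).
  have -> : l2_sqnorm (t%:C *: g + f) =
      complex.Re (l2_inner (t%:C *: g + f) (t%:C *: g + f)) by rewrite l2_inner_diag.
  rewrite l2_inner_linear !(l2_inner_bilinear.2 _ t%:C g f) !l2_inner_diag.
  rewrite (l2_innerC g f) !conjCE /=.
  case: (l2_inner f g) => a b /=; move: (l2_sqnorm f) (l2_sqnorm g) => u v.
  by rewrite /real_complex_def; simpc => /=; rewrite expr2; lra.
have [g0|g0] := eqVneq (l2_sqnorm g) 0.
  have -> := l2_sqnorm_eq0 g0.
  have -> : l2_inner f 0 = 0 by exact: linear0r.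
  by rewrite mulr_ge0 ?sqrtr_ge0.
have gp : 0 < l2_sqnorm g by rewrite lt_def g0 l2_sqnorm_ge0.
set B := complex.Re _ in Q *.
have [B0|B0] := leP B 0; first by rewrite (le_trans B0) ?mulr_ge0 ?sqrtr_ge0.
rewrite -sqrtrM ?l2_sqnorm_ge0 // -[leLHS]gtr0_norm // -sqrtr_sqr.
rewrite ler_sqrt; last by rewrite mulr_ge0 ?l2_sqnorm_ge0.
have := Q (- B / l2_sqnorm g); set G := l2_sqnorm g in gp g0 *.
have -> : l2_sqnorm f + 2 * (- B / G) * B + (- B / G) ^+ 2 * G = (l2_sqnorm f * G - B ^+ 2) / G.
  by field.
by rewrite pmulr_lge0 ?invr_gt0 // subr_ge0.
Qed.

Let l2_innerDl f h g : l2_inner (f + h) g = l2_inner f g + l2_inner h g.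
Proof. by have := l2_inner_linear g 1 f h; rewrite scale1r mul1r. Qed.
Let l2_innerDr f g h : l2_inner f (g + h) = l2_inner f g + l2_inner f h.
Proof. by rewrite l2_innerC l2_innerDl rmorphD /=; congr (_ + _); rewrite [RHS]l2_innerC. Qed.

Fact l2_normD f g : l2_norm (f + g) <= l2_norm f + l2_norm g.
Proof.
rewrite /l2_norm -rmorphD lecR -ler_sqr ?nnegrE ?addr_ge0 ?sqrtr_ge0 //.
rewrite sqrrD !sqr_sqrtr ?l2_sqnorm_ge0 //.
have -> : l2_sqnorm (f + g) = complex.Re (l2_inner (f + g) (f + g)).
  by rewrite l2_inner_diag.
rewrite l2_innerDl !l2_innerDr !ReD !l2_inner_diag (l2_innerC g f) conjCE /=.
by have /= := l2_re_le f g; lra.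
Qed.

Fact l2_normZ (c : C) f : l2_norm (c *: f) = `|c| * l2_norm f.
Proof.
rewrite /l2_norm normc_def -rmorphM; congr (_%:C).
rewrite -sqrtrM ?sqnorm_ge0 //; congr Num.sqrt.
have hs : abs_summable (fun i => sqnorm (f i)).
  by apply: abs_summable_le (l2_re_sum f f) _ => i; rewrite /l2_re -!expr2.
by rewrite -csumZ //; apply: csum_ext => i; rewrite l2_scaleE sqnormM.
Qed.

Fact l2_norm_eq0 f : l2_norm f = 0 -> f = 0.
Proof.
move=> /complexI/eqP; rewrite sqrtr_eq0 => h; apply: l2_sqnorm_eq0.
by apply/le_anti; rewrite h l2_sqnorm_ge0.
Qed.

HB.instance Definition _ :=
  Lmodule_isNormed.Build C l2 l2_normD l2_normZ l2_norm_eq0.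

Lemma l2_normE f : `|f| = (Num.sqrt (l2_sqnorm f))%:C. Proof. by []. Qed.

(** Only finite subsums pass to a coordinatewise limit; this suffices, since norms on l2 are bounded
    through finite subsums. *)
Lemma sqnorm_cvg (F : set_system l2) (FF : Filter F) (g : I -> C) (x : l2) (s : seq I) :
  (forall k, (fun f => complex.Re (f k)) @ F --> complex.Re (g k)) ->
  (forall k, (fun f => complex.Im (f k)) @ F --> complex.Im (g k)) ->
  (fun f : l2 => \sum_(k <- s) sqnorm (f k - x k)) @ F -->
    \sum_(k <- s) sqnorm (g k - x k).
Proof.
move=> hr hi; elim: s => [|k s IH].
  rewrite big_nil; under eq_fun do rewrite big_nil.
  exact: cvg_cst.
rewrite big_cons; under eq_fun do rewrite big_cons.
apply: cvgD => //.
have sE (z w : C) : sqnorm (z - w) =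
    (complex.Re z - complex.Re w) * (complex.Re z - complex.Re w) +
    (complex.Im z - complex.Im w) * (complex.Im z - complex.Im w).
  by case: z w => ? ? [].
rewrite sE; under eq_fun do rewrite sE.
by apply: cvgD; apply: cvgM; apply: cvgB => //; exact: cvg_cst.
Qed.

Lemma ball_l2 (x f : l2) (e : R) : ball x e%:C f ->
  0 < e /\ l2_sqnorm (f - x) < e ^+ 2.
Proof.
rewrite -ball_normE /= distrC l2_normE ltcR => h.
have e0 : 0 < e by apply: le_lt_trans h; exact: sqrtr_ge0.
split=> //; move: h; rewrite -{1}[e]gtr0_norm // -sqrtr_sqr ltr_sqrt //.
by rewrite exprn_gt0.
Qed.

Lemma l2_complete (F : set_system l2) : ProperFilter F -> cauchy F -> cvg F.
Proof.
move=> FF /cauchyP cF.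
have coord (p : C -> R) : (forall (z w : C), (p z - p w) ^+ 2 <= sqnorm (z - w)) ->
    forall k, cvg ((fun f : l2 => p (f k)) @ F).
  move=> hp k; apply/cauchy_cvgP; apply: cauchy_exP => e e0.
  have e0' : 0 < e%:C by rewrite ltcR.
  have [x hx] := cF _ e0'; exists (p (x k)).
  suff : F [set f : l2 | ball (p (x k)) e (p (f k))] by [].
  apply: filterS hx => f /ball_l2 [_ h] /=.
  rewrite -ball_normE /= distrC -ltr_sqr ?nnegrE ?(ltW e0) // real_normK ?num_real //.
  apply: le_lt_trans h; apply: le_trans (hp _ _) _.
  by rewrite -l2_subE l2_sqnorm_coord.
have hRe k : cvg ((fun f : l2 => complex.Re (f k)) @ F).
  by apply: coord => -[a b] [c d]; rewrite /sqnorm /= lerDl sqr_ge0.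
have hIm k : cvg ((fun f : l2 => complex.Im (f k)) @ F).
  by apply: coord => -[a b] [c d]; rewrite /sqnorm /= lerDr sqr_ge0.
pose g k : C := lim ((fun f : l2 => complex.Re (f k)) @ F) +i*
  lim ((fun f : l2 => complex.Im (f k)) @ F).
(* If [F] concentrates in a ball around [x], the coordinatewise limit [g] stays within the same
   radius of [x]. This yields both the square-summability of [g], through [g - x0], and the
   convergence of [F] to it in norm. *)
have gx (x : l2) (e : R) : F (ball x e%:C) ->
    sum_bounded (fun k => sqnorm (g k - x k)) (e ^+ 2).
  move=> hx s us.
  have FF' : Filter F by exact: filter_filter.
  have hc := sqnorm_cvg FF' (g := g) (x := x) (s := s) hRe hIm.
  rewrite -(cvg_lim _ hc) //; apply: limr_le; first by apply/cvg_ex; eexists; exact: hc.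
  apply: filterS hx => f /ball_l2 [_ h] /=; apply: le_trans _ (ltW h).
  exact: (l2_sqnorm_ub (f - x)).
have [x0 hx0] := cF _ (ltr01 : 0 < 1 :> C).
have gl : g \in l2_pred (R := R) (I := I).
  have hd : (g - x0 : I -> C) \in l2_pred (R := R) (I := I).
    by apply/asboolP; exists (1 ^+ 2); exact: (gx x0 1).
  by have := rpredD hd (l2_funP x0); rewrite subrK.
apply/cvg_ex; exists (L2 gl); apply/cvg_ballP => e /ltCE [-> e0].
have e2 : 0 < (complex.Re e / 2)%:C by rewrite ltcR divr_gt0.
have [x hx] := cF _ e2.
have hb : `|L2 gl - x| <= (complex.Re e / 2)%:C.
  rewrite l2_normE lecR -[leRHS]gtr0_norm ?divr_gt0 // -sqrtr_sqr.
  rewrite ler_sqrt ?sqr_ge0 //; apply: l2_sqnorm_le; exact: gx hx.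
apply: filterS hx => f /=; rewrite -!ball_normE /= => hf.
rewrite -(subrKA x); apply: le_lt_trans (ler_normD _ _) _.
rewrite [X in _ < X%:C](splitr (complex.Re e)) rmorphD /=.
exact: ler_ltD.
Qed.

HB.instance Definition _ := Uniform_isComplete.Build l2 l2_complete.

Fact l2_inner_norm f : l2_inner f f = `|f| ^+ 2.
Proof. by rewrite l2_inner_diag l2_normE -rmorphXn sqr_sqrtr ?l2_sqnorm_ge0. Qed.

HB.instance Definition _ := isHilbert.Build R l2 l2_inner_norm.

End L2Inner.

(** * Coefficient expansion in an orthonormal basis *)

Section OnbExpansion.
Variables (R : realType) (H : hilbertType R) (I : countType) (e : I -> H).
Local Notation C := R[i].
Hypothesis he : orthonormal_basis e.

Lemma onb_sum_coef (s : seq I) (c : I -> C) k : uniq s ->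
  inner (\sum_(i <- s) c i *: e i) (e k) = if k \in s then c k else 0.
Proof.
move=> us; rewrite inner_suml.
under eq_bigr => i _ do rewrite innerZl (onb_inner he).
case: ifP => ks.
  rewrite (big_rem k) //= eqxx mulr1 big_seq big1 ?addr0 // => i.
  by rewrite mem_rem_uniq // => /andP[/negbTE /= -> _]; rewrite mulr0.
rewrite big_seq big1 // => i si; case: eqP si => [->|_ _]; first by rewrite ks.
by rewrite mulr0.
Qed.

Lemma sqnormE (z : C) : (sqnorm z)%:C = z * Num.conj z.
Proof. by rewrite -normCK /sqnorm add_Re2_Im2. Qed.

Lemma onb_sum_norm (s : seq I) (c : I -> C) : uniq s ->
  rnorm (\sum_(i <- s) c i *: e i) ^+ 2 = \sum_(i <- s) sqnorm (c i).
Proof.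
move=> us; apply: complexI; rewrite -innervv rmorph_sum /=.
set v := (X in inner _ X); rewrite inner_suml big_seq [RHS]big_seq.
apply: eq_bigr => i si; rewrite innerZl sqnormE innerC /v onb_sum_coef //.
by rewrite si.
Qed.

Lemma bessel v : sum_bounded (fun k => sqnorm (inner v (e k))) (rnorm v ^+ 2).
Proof.
move=> s us; set p := \sum_(i <- s) inner v (e i) *: e i.
have pn : rnorm p ^+ 2 = \sum_(i <- s) sqnorm (inner v (e i)) by exact: onb_sum_norm.
rewrite -pn; have := sqr_ge0 (rnorm (v - p)); rewrite rnorm_sqB.
suff -> : rinner v p = rnorm p ^+ 2 by lra.
apply: complexI; rewrite pn rmorph_sum /= rinnerC.
suff h : inner p v = (\sum_(i <- s) sqnorm (inner v (e i)))%:C.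
  by rewrite /rinner h /= rmorph_sum.
rewrite /p inner_suml rmorph_sum /=; apply: eq_bigr => i _.
by rewrite innerZl [inner (e i) v]innerC sqnormE.
Qed.

Lemma enum_upto_cat M N : (N <= M)%N ->
  exists s, enum_upto I M = enum_upto I N ++ s.
Proof.
move=> /subnKC <-; exists (pmap (@pickle_inv I) (iota N (M - N))).
by rewrite /enum_upto iotaD pmap_cat.
Qed.

Lemma riesz_fischer (c : I -> C) : square_summable c ->
  exists v : H, (forall k, inner v (e k) = c k) /\
    rnorm v ^+ 2 = csum (fun k => sqnorm (c k)).
Proof.
move=> [M hM]; pose h k := sqnorm (c k).
have h0 k : 0 <= h k by exact: sqnorm_ge0.
have hc := psum_cvg h0 hM.
pose u N : H := \sum_(i <- enum_upto I N) c i *: e i.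
have uN N : rnorm (u N) ^+ 2 = psum h N by apply: onb_sum_norm; exact: enum_upto_uniq.
have psum_le N : psum h N <= csum h by apply: nondecreasing_cvgn_le => //; exact: psum_nd.
have psum_lim (d : R) : 0 < d -> exists N, csum h - psum h N < d.
  move=> d0; have /cvgrPdist_lt /(_ _ d0) [N _ hN] : psum h @ \oo --> csum h by exact: hc.
  by exists N; have := hN N (leqnn N); apply: le_lt_trans; exact: ler_norm.
have [||l hl] := @cauchy_cvs _ _ u (fun N => Num.sqrt (csum h - psum h N)).
- move=> m n /enum_upto_cat [s es].
  have us : uniq s by have := enum_upto_uniq I m; rewrite es cat_uniq => /and3P[].
  have -> : u m - u n = \sum_(i <- s) c i *: e i by rewrite /u es big_cat addrAC subrr add0r.
  rewrite -[leLHS]ger0_norm ?rnorm_ge0 // -sqrtr_sqr ler_sqrt ?subr_ge0 //.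
  rewrite onb_sum_norm // lerBrDl.
  by apply: le_trans (psum_le m); rewrite /psum es big_cat.
- move=> d d0; have [N hN] := psum_lim _ (exprn_gt0 2 d0); exists N.
  by rewrite -[ltRHS]gtr0_norm // -sqrtr_sqr ltr_sqrt ?exprn_gt0.
exists l; split=> [k|].
  (* From [N0] on the index [k] has been enumerated, so the k-th coefficient of the partial sums is
     constant. *)
  pose N0 := (pickle k).+1.
  have hl' : seq_cvg (fun n => u (n + N0)%N) l.
    move=> d d0; have [N hN] := hl _ d0; exists N => n Nn.
    by rewrite hN // (leq_trans Nn) // leq_addr.
  (* The constant [c k] is written as an inner product to fit the two-sided form of [inner_cvs]. *)
  have hk : forall n, inner (u (n + N0)%N) (e k) = inner (e k) (Num.conj (c k) *: e k).
    move=> n; rewrite innerZr Num.Theory.conjCK (onb_inner he) eqxx mulr1 onb_sum_coef ?enum_upto_uniq //.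
    by rewrite mem_enum_upto // leq_addl.
  rewrite (inner_cvs hl' (seq_cvg_cst (Num.conj (c k) *: e k)) hk).
  by rewrite innerZr Num.Theory.conjCK (onb_inner he) eqxx mulr1.
apply/le_anti/andP; split.
  have := rnorm_cvs_le hl (M := Num.sqrt (csum h)).
  have c0 : 0 <= csum h by apply: le_trans (psum_le 0); rewrite -uN sqr_ge0.
  move=> le; rewrite -[leRHS]sqr_sqrtr // ler_sqr ?nnegrE ?rnorm_ge0 ?sqrtr_ge0 //.
  apply: le => n; rewrite -[leLHS]ger0_norm ?rnorm_ge0 // -sqrtr_sqr uN.
  by rewrite ler_sqrt.
apply: csum_le => // s us.
have [N sN] := sub_enum_upto s.
apply: le_trans (le_sum_uniq h0 us sN (enum_upto_uniq I N)) _.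
rewrite -/(psum h N) -uN ler_sqr ?nnegrE ?rnorm_ge0 //.
rewrite leNgt; apply/negP => lt.
have [N' hN'] := hl (rnorm (u N) - rnorm l) ltac:(lra).
have := hN' (maxn N N') (leq_maxr _ _).
have : rnorm (u N) <= rnorm (u (maxn N N')).
  rewrite -ler_sqr ?nnegrE ?rnorm_ge0 // !uN.
  by apply: (@psum_nd R I h h0); rewrite leq_maxl.
by have := rnormD (u (maxn N N') - l) l; rewrite subrK; lra.
Qed.

Lemma coef_square_summable v : square_summable (fun k => inner v (e k)).
Proof. by exists (rnorm v ^+ 2); exact: bessel. Qed.

(** Equality in Bessel: the vector that [riesz_fischer] builds from the coefficients of [v] has the
    same coefficients as [v], hence is [v]. *)
Lemma parseval v : rnorm v ^+ 2 = csum (fun k => sqnorm (inner v (e k))).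
Proof.
have [w [wk <-]] := riesz_fischer (coef_square_summable v).
by have -> : w = v by exact: (onb_inj he).
Qed.

End OnbExpansion.

Section UnitaryFromBases.
Variables (R : realType) (H K : hilbertType R) (I : countType).
Variables (e : I -> H) (f : I -> K).
Hypotheses (he : orthonormal_basis e) (hf : orthonormal_basis f).

(** Polarisation: the real part is read off [|u + v|^2], and the imaginary part is the real part
    against ['i *: v]. *)
Lemma inner_of_norm (U : H -> K) : (forall (c : R[i]) u v, U (c *: u + v) = c *: U u + U v) ->
  (forall v, rnorm (U v) = rnorm v) -> forall u v, inner (U u) (U v) = inner u v.
Proof.
move=> UL Un.
have hip u v : rinner (U u) (U v) = rinner u v.
  have := Un (u + v); have -> : U (u + v) = U u + U v.
    by have := UL 1 u v; rewrite !scale1r.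
  move=> h; have := rnorm_sqD (U u) (U v); rewrite h rnorm_sqD !Un.
  by lra.
move=> u v.
have iE (L : hilbertType R) (x y : L) : inner x y = rinner x y +i* rinner x ('i *: y).
  rewrite /rinner innerZr /=; case: (inner x y) => a b; congr (_ +i* _).
  by rewrite conjCE /=; simpc.
rewrite !iE hip; congr (_ +i* _); rewrite -[RHS]hip; congr (rinner _ _).
have := UL 'i v 0; rewrite !addr0 => ->.
have -> : U 0 = 0 by apply/eqP; rewrite -rnorm_eq0 Un rnorm0.
by rewrite addr0.
Qed.

Lemma unitary_of_bases : exists U : {linear H -> K},
  [/\ bijective U, forall v w, inner (U v) (U w) = inner v w &
      forall v k, inner (U v) (f k) = inner v (e k)].
Proof.
have hU v : exists w : K, forall k, inner w (f k) = inner v (e k).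
  have [w [wk _]] := riesz_fischer hf (coef_square_summable he v).
  by exists w.
have hV w : exists v : H, forall k, inner v (e k) = inner w (f k).
  have [v [vk _]] := riesz_fischer he (coef_square_summable hf w).
  by exists v.
have [U UP] := choice hU; have [V VP] := choice hV.
have UL : linear U.
  move=> c u v; apply: (onb_inj hf) => k.
  by rewrite innerDl innerZl !UP innerDl innerZl.
pose Um := GRing.isLinear.Build _ _ _ _ U UL.
pose Ul : {linear H -> K} := HB.pack U Um.
exists Ul; split.
- exists V => v; first by apply: (onb_inj he) => k; rewrite VP UP.
  by apply: (onb_inj hf) => k; rewrite UP VP.
- apply: (@inner_of_norm U) => // v.
  apply/eqP; rewrite -(@eqrXn2 _ 2) ?rnorm_ge0 //; apply/eqP.
  rewrite (parseval hf) (parseval he); congr csum.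
  by apply/funext => k; rewrite UP.
- exact: UP.
Qed.

End UnitaryFromBases.

Section L2Basis.
Variables (R : realType) (I : countType).
Local Notation C := R[i].
Local Notation l2 := (l2 R I).

Fact delta_l2 (k : I) : (fun i => (i == k)%:R : C) \in l2_pred (R := R) (I := I).
Proof.
apply/asboolP; exists 1 => s us.
case ks : (k \in s).
  rewrite (big_rem k) //= eqxx big_seq big1 => [|i].
    by rewrite /sqnorm /= expr1n expr0n !addr0.
  rewrite mem_rem_uniq // => /andP[/negbTE /= -> _].
  by rewrite /sqnorm /= expr0n addr0.
rewrite big_seq big1 // => i si; case: eqP si => [->|_ _]; first by rewrite ks.
by rewrite /sqnorm /= expr0n addr0.
Qed.

Definition l2_delta k : l2 := L2 (delta_l2 k).

Lemma l2_inner_delta (f : l2) k : inner f (l2_delta k) = f k.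
Proof.
rewrite -[LHS]/(csum (l2_re f (l2_delta k)) +i* csum (l2_im f (l2_delta k))).
rewrite (csum1 (k := k)) => [|i /negbTE ik]; last first.
  by rewrite /l2_re /= ik /= !mulr0 addr0.
rewrite (csum1 (k := k)) => [|i /negbTE ik]; last first.
  by rewrite /l2_im /= ik /= !mulr0 subrr.
rewrite /l2_re /l2_im /= eqxx /= !mulr1 !mulr0 addr0 subr0.
by case: (f k).
Qed.

Lemma l2_delta_orthonormal k l : inner (l2_delta k) (l2_delta l) = (k == l)%:R.
Proof. by rewrite l2_inner_delta /= eq_sym. Qed.

Lemma l2_nmE (f : l2) : rnorm f ^+ 2 = l2_sqnorm f.
Proof. by rewrite /rnorm l2_normE sqr_sqrtr ?l2_sqnorm_ge0. Qed.

Lemma l2_delta_sumE (s : seq I) (c : I -> C) i : uniq s ->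
  (\sum_(k <- s) c k *: l2_delta k) i = if i \in s then c i else 0.
Proof.
move=> us; rewrite -l2_inner_delta inner_suml.
under eq_bigr => k _ do rewrite innerZl l2_delta_orthonormal.
case: ifP => ks.
  rewrite (big_rem i) //= eqxx mulr1 big_seq big1 ?addr0 // => k.
  by rewrite mem_rem_uniq // => /andP[/negbTE /= -> _]; rewrite mulr0.
rewrite big_seq big1 // => k si; case: eqP si => [->|_ _]; first by rewrite ks.
by rewrite mulr0.
Qed.

Lemma l2_approx (f : l2) (e : R) : 0 < e -> exists s : seq I,
  rnorm (f - \sum_(k <- s) f k *: l2_delta k) < e.
Proof.
move=> e0; have [M hM] := l2_sq f; pose h k := sqnorm (f k).
have h0 k : 0 <= h k by exact: sqnorm_ge0.
have hc := psum_cvg h0 hM.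
have e2 : 0 < e ^+ 2 / 2 by rewrite divr_gt0 // exprn_gt0.
have /cvgrPdist_lt /(_ _ e2) [N _ hN] : psum h @ \oo --> csum h by exact: hc.
exists (enum_upto I N); set s := enum_upto I N.
have us : uniq s by exact: enum_upto_uniq.
rewrite -ltr_sqr ?nnegrE ?rnorm_ge0 ?(ltW e0) // l2_nmE.
apply: (@le_lt_trans _ _ (e ^+ 2 / 2)); last by have := exprn_gt0 2 e0; lra.
apply: (@le_trans _ _ (csum h - psum h N)); last first.
  by apply: ltW; apply: le_lt_trans (ler_norm _) (hN N (leqnn N)).
apply: l2_sqnorm_le => t ut; rewrite lerBrDl.
(* The remainder keeps exactly the coordinates outside [s]. The part of [t] outside [s], joined to
   [s], is duplicate-free, so the two sums together stay below [csum h]. *)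
rewrite (eq_bigr (fun i => if i \notin s then h i else 0)) => [|i _]; last first.
  rewrite l2_subE l2_delta_sumE //; case: ifP => _; last by rewrite subr0.
  by rewrite subrr /sqnorm /= expr0n addr0.
rewrite -big_mkcond -big_filter.
rewrite -big_cat; apply: (sum_le_csum h0 hM).
rewrite cat_uniq us filter_uniq // andbT; apply/hasPn => i.
by rewrite mem_filter => /andP[].
Qed.

Lemma l2_delta_basis : orthonormal_basis l2_delta.
Proof.
split; first exact: l2_delta_orthonormal.
apply/seteqP; split => // f _; apply/closureE => e e0.
have [s hs] := l2_approx f e0.
by exists (\sum_(k <- s) f k *: l2_delta k); split => //; exists s, f.
Qed.

Lemma rat_approx (x e : R) : 0 < e -> exists r : rat, `|x - ratr r| < e.
Proof.
move=> e0; have [r] := @rat_in_itvoo R (x - e) (x + e) ltac:(lra).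
rewrite in_itv /= => /andP[h1 h2]; exists r; rewrite ltr_norml; lra.
Qed.

(** Finite combinations of basis vectors with rational real and imaginary parts are countable and
    dense. The rounding error is split into [e / 2] for the rest of the list and [e / 4] for each
    part of the new coefficient. *)
Lemma l2_separable : separable l2.
Proof.
pose rc (p : rat * rat) : C := ratr p.1 +i* ratr p.2.
pose F (s : seq (I * (rat * rat))) : l2 := \sum_(p <- s) rc p.2 *: l2_delta p.1.
exists (range F); split; first by apply: card_le_trans (card_image_le _ _) _; exact: countableP.
have FS (f : l2) s (e : R) : 0 < e ->
    exists t, rnorm (\sum_(k <- s) f k *: l2_delta k - F t) < e.
  elim: s e => [|k s IH] e e0; first by exists [::]; rewrite /F !big_nil subrr rnorm0.
  have [t ht] := IH (e / 2) ltac:(lra).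
  have [a ha] := rat_approx (complex.Re (f k)) (e := e / 4) ltac:(lra).
  have [b hb] := rat_approx (complex.Im (f k)) (e := e / 4) ltac:(lra).
  exists ((k, (a, b)) :: t); rewrite /F !big_cons opprD addrACA -scalerBl /=.
  apply: le_lt_trans (rnormD _ _) _; rewrite rnormZ.
  have -> : rnorm (l2_delta k) = 1.
    have := innervv (l2_delta k); rewrite l2_delta_orthonormal eqxx => /complexI /esym/eqP.
    by rewrite sqrf_eq1 => /orP[/eqP //|/eqP h]; have := rnorm_ge0 (l2_delta k); rewrite h; lra.
  have hz (z : C) : complex.Re `|z| <= `|complex.Re z| + `|complex.Im z|.
    rewrite normc_def /= -[leRHS]ger0_norm ?addr_ge0 // -sqrtr_sqr.
    rewrite ler_sqrt ?sqr_ge0 // sqrrD !real_normK ?num_real //.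
    by rewrite -addrA lerD2l lerDr mulrn_wge0 // mulr_ge0.
  have := hz (f k - rc (a, b)).
  have -> : complex.Re (f k - rc (a, b)) = complex.Re (f k) - ratr a by case: (f k).
  have -> : complex.Im (f k - rc (a, b)) = complex.Im (f k) - ratr b by case: (f k).
  by rewrite /F in ht; lra.
have FD : forall f : l2, closure (range F) f.
  move=> f; apply/closureE => e e0.
  have [s hs] := l2_approx f (e := e / 2) ltac:(lra).
  have [t ht] := FS f s (e / 2) ltac:(lra).
  exists (F t); split; first by exists t.
  by rewrite -(subrKA (\sum_(k <- s) f k *: l2_delta k)); apply: le_lt_trans (rnormD _ _) _; lra.
move=> O [x Ox] oO; have [y [ry Oy]] := FD x O (open_nbhs_nbhs (conj oO Ox)).
by exists y.
Qed.

End L2Basis.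

(** * The star-algebra of adjointable operators *)

Section AdjointableOperators.
Variables (R : realType) (H : hilbertType R).
Local Notation C := R[i].
Implicit Types (u v w : H).

Definition adjoint_pair (T S : H -> H) := forall u v, inner (T u) v = inner u (S v).
Definition rnorm_bounded (T : H -> H) := exists M : R, 0 <= M /\ forall v, rnorm (T v) <= M * rnorm v.

Lemma adjoint_pairC T S : adjoint_pair T S -> adjoint_pair S T.
Proof. by move=> h u v; rewrite innerC -h -innerC. Qed.

Lemma adjoint_linear T S : adjoint_pair T S -> linear T.
Proof.
move=> h c u v; apply/eqP; rewrite -subr_eq0; apply/eqP/inner_eq0_all => w.
by rewrite innerBl innerDl innerZl !h innerDl innerZl subrr.
Qed.

(** [|S v|^2 = <T (S v), v> <= M |S v| |v|]. Hence [bop] only has to record a bound for the operator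
    itself. *)
Lemma adjoint_bounded T S : adjoint_pair T S -> rnorm_bounded T -> rnorm_bounded S.
Proof.
move=> h [M [M0 hM]]; exists M; split=> // v.
have [->|S0] := eqVneq (S v) 0; first by rewrite rnorm0 mulr_ge0 ?rnorm_ge0.
have p : 0 < rnorm (S v) by rewrite lt_def rnorm_eq0 S0 rnorm_ge0.
rewrite -(ler_pM2r p) -expr2 -rinnervv.
rewrite -[rinner _ _]/(complex.Re (inner _ _)) -h.
apply: le_trans (rinner_le _ _) _; rewrite mulrAC ler_wpM2r ?rnorm_ge0 //.
Qed.

Lemma adjoint_unique T S S' : adjoint_pair T S -> adjoint_pair T S' -> S = S'.
Proof.
move=> h h'; apply/funext => v; apply/eqP; rewrite -subr_eq0; apply/eqP.
by apply: inner_eq0_all => w; rewrite innerBl (adjoint_pairC h) (adjoint_pairC h') subrr.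
Qed.

(* The parameter [h] only serves to have [1 != 0]. *)
Record bop (v0 : H) (h : v0 != 0) := BOp {
  bfun :> H -> H ;
  badj : H -> H ;
  bop_adj : adjoint_pair bfun badj ;
  bop_bounded : rnorm_bounded bfun
}.

Variables (v0 : H) (h : v0 != 0).
Local Notation B := (bop h).
Implicit Types (S T : B).

(** The adjoint is determined by the operator and the remaining fields are propositions, so all
    algebraic identities can be checked on vectors. *)
Lemma bop_ext S T : S =1 T -> S = T.
Proof.
case: S T => [s s' sa sb] [t t' ta tb] /= /funext e; subst t.
have e := adjoint_unique sa ta; subst t'.
by congr BOp; apply: Prop_irrelevance.
Qed.

HB.instance Definition _ := gen_eqMixin B.
HB.instance Definition _ := gen_choiceMixin B.

Fact bop0_adj : adjoint_pair (fun=> 0) (fun=> 0).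
Proof. by move=> u v; rewrite inner0l inner0r. Qed.
Fact bop0_bounded : rnorm_bounded (fun=> 0).
Proof. by exists 0; split=> // v; rewrite rnorm0 mul0r. Qed.
Definition bop0 : B := BOp h bop0_adj bop0_bounded.

Fact bop1_adj : adjoint_pair (fun v => v) (fun v => v). Proof. by []. Qed.
Fact bop1_bounded : rnorm_bounded (fun v => v).
Proof. by exists 1; split=> // v; rewrite mul1r. Qed.
Definition bop1 : B := BOp h bop1_adj bop1_bounded.

Fact bopD_adj S T : adjoint_pair (fun v => S v + T v) (fun v => badj S v + badj T v).
Proof. by move=> u v; rewrite innerDl innerDr !bop_adj. Qed.
Fact bopD_bounded S T : rnorm_bounded (fun v => S v + T v).
Proof.
have [M [M0 hM]] := bop_bounded S; have [N [N0 hN]] := bop_bounded T.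
exists (M + N); split=> [|v]; first exact: addr_ge0.
by rewrite mulrDl; apply: le_trans (rnormD _ _) _; exact: lerD.
Qed.
Definition bopD S T : B := BOp h (@bopD_adj S T) (bopD_bounded S T).

Fact bopZ_adj c S : adjoint_pair (fun v => c *: S v) (fun v => Num.conj c *: badj S v).
Proof. by move=> u v; rewrite innerZl innerZr Num.Theory.conjCK bop_adj. Qed.
Fact bopZ_bounded (c : C) S : rnorm_bounded (fun v => c *: S v).
Proof.
have [M [M0 hM]] := bop_bounded S.
have c0 : 0 <= complex.Re `|c| by rewrite -ler0c RRe_real ?normr_real.
exists (complex.Re `|c| * M); split=> [|v]; first exact: mulr_ge0.
by rewrite rnormZ -mulrA ler_wpM2l.
Qed.
Definition bopZ c S : B := BOp h (@bopZ_adj c S) (bopZ_bounded c S).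

Fact bopM_adj S T : adjoint_pair (fun v => S (T v)) (fun v => badj T (badj S v)).
Proof. by move=> u v; rewrite !bop_adj. Qed.
Fact bopM_bounded S T : rnorm_bounded (fun v => S (T v)).
Proof.
have [M [M0 hM]] := bop_bounded S; have [N [N0 hN]] := bop_bounded T.
exists (M * N); split=> [|v]; first exact: mulr_ge0.
by apply: le_trans (hM _) _; rewrite -mulrA ler_wpM2l.
Qed.
Definition bopM S T : B := BOp h (@bopM_adj S T) (bopM_bounded S T).

Definition bop_star S : B :=
  BOp h (adjoint_pairC (@bop_adj _ _ S)) (adjoint_bounded (@bop_adj _ _ S) (bop_bounded S)).

Lemma bop_linear T : linear T. Proof. exact: adjoint_linear (@bop_adj _ _ T). Qed.
Lemma bop_linD T u v : T (u + v) = T u + T v.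
Proof. by have := bop_linear T 1 u v; rewrite !scale1r. Qed.
Lemma bop_linZ T c u : T (c *: u) = c *: T u.
Proof.
have T0 : T 0 = 0 by have := bop_linear T (-1) 0 0; rewrite scaler0 addr0 scaleN1r addNr.
by have := bop_linear T c u 0; rewrite T0 !addr0.
Qed.

Fact bop_addA : associative bopD. Proof. by move=> S T U; apply: bop_ext => v /=; rewrite addrA. Qed.
Fact bop_addC : commutative bopD. Proof. by move=> S T; apply: bop_ext => v /=; rewrite addrC. Qed.
Fact bop_add0 : left_id bop0 bopD. Proof. by move=> S; apply: bop_ext => v /=; rewrite add0r. Qed.
Fact bop_addN : left_inverse bop0 (bopZ (-1)) bopD.
Proof. by move=> S; apply: bop_ext => v /=; rewrite scaleN1r addNr. Qed.
HB.instance Definition _ := GRing.isZmodule.Build B bop_addA bop_addC bop_add0 bop_addN.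

Fact bop_mulA : associative bopM. Proof. by move=> S T U; exact: bop_ext. Qed.
Fact bop_mul1l : left_id bop1 bopM. Proof. by move=> S; exact: bop_ext. Qed.
Fact bop_mul1r : right_id bop1 bopM. Proof. by move=> S; exact: bop_ext. Qed.
Fact bop_mulDl : left_distributive bopM bopD. Proof. by move=> S T U; exact: bop_ext. Qed.
Fact bop_mulDr : right_distributive bopM bopD.
Proof. by move=> S T U; apply: bop_ext => v /=; rewrite bop_linD. Qed.
Fact bop_neq10 : bop1 != bop0.
Proof. by apply/eqP => /(congr1 (fun T : B => T v0)) /= /eqP; apply/negP. Qed.
HB.instance Definition _ := GRing.Zmodule_isNzRing.Build B
  bop_mulA bop_mul1l bop_mul1r bop_mulDl bop_mulDr bop_neq10.

Fact bop_scaleA c d S : bopZ c (bopZ d S) = bopZ (c * d) S.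
Proof. by apply: bop_ext => v /=; rewrite scalerA. Qed.
Fact bop_scale1 : left_id 1 bopZ.
Proof. by move=> S; apply: bop_ext => v /=; rewrite scale1r. Qed.
Fact bop_scaleDr : right_distributive bopZ bopD.
Proof. by move=> c S T; apply: bop_ext => v /=; rewrite scalerDr. Qed.
Fact bop_scaleDl S : {morph bopZ^~ S : c d / c + d >-> bopD c d}.
Proof. by move=> c d; apply: bop_ext => v /=; rewrite scalerDl. Qed.
HB.instance Definition _ := GRing.Zmodule_isLmodule.Build C B
  bop_scaleA bop_scale1 bop_scaleDr bop_scaleDl.

Fact bop_scaleAl c S T : bopZ c (bopM S T) = bopM (bopZ c S) T.
Proof. exact: bop_ext. Qed.
HB.instance Definition _ := GRing.Lmodule_isLalgebra.Build C B bop_scaleAl.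
Fact bop_scaleAr c S T : bopZ c (bopM S T) = bopM S (bopZ c T).
Proof. by apply: bop_ext => v /=; rewrite bop_linZ. Qed.
HB.instance Definition _ := GRing.Lalgebra_isAlgebra.Build C B bop_scaleAr.

Fact bop_starK : involutive bop_star. Proof. by move=> S; exact: bop_ext. Qed.
Fact bop_starD S T : bop_star (bopD S T) = bopD (bop_star S) (bop_star T).
Proof. exact: bop_ext. Qed.
Fact bop_starZ c S : bop_star (bopZ c S) = bopZ (Num.conj c) (bop_star S).
Proof. exact: bop_ext. Qed.
Fact bop_starM S T : bop_star (bopM S T) = bopM (bop_star T) (bop_star S).
Proof. exact: bop_ext. Qed.
HB.instance Definition _ := isStarAlgebra.Build R B
  bop_starK bop_starD bop_starZ bop_starM.

Lemma bop1v v : (1 : B) v = v. Proof. by []. Qed.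
Lemma bopDv S T v : (S + T) v = S v + T v. Proof. by []. Qed.
Lemma bopBv S T v : (S - T) v = S v - T v.
Proof. by rewrite -[LHS]/(S v + (-1) *: T v) scaleN1r. Qed.
Lemma bopZv c T v : (c *: T) v = c *: T v. Proof. by []. Qed.
Lemma bopMv S T v : (S * T) v = S (T v). Proof. by []. Qed.

Definition bop_lin (T : B) : {linear H -> H} :=
  HB.pack (bfun T) (GRing.isLinear.Build C H H _ (bfun T) (bop_linear T)).

Section RepOfHom.
Variables (A : starAlgType R) (phi : starHom A B) (hs : separable H).

Fact bop_rep_bounded a : exists M : C, forall v, `|bop_lin (phi a) v| <= M * `|v|.
Proof.
have [M [M0 hM]] := bop_bounded (phi a); exists M%:C => v.
by rewrite !normE -rmorphM lecR; exact: hM.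
Qed.
Fact bop_rep_linear (c : C) a b v :
  bop_lin (phi (c *: a + b)) v = c *: bop_lin (phi a) v + bop_lin (phi b) v.
Proof.
have -> : phi (c *: a + b) = c *: phi a + phi b by exact: linearP.
by [].
Qed.
Fact bop_rep_1 v : bop_lin (phi 1) v = v.
Proof. by rewrite rmorph1. Qed.
Fact bop_rep_M a b v : bop_lin (phi (a * b)) v = bop_lin (phi a) (bop_lin (phi b) v).
Proof. by rewrite rmorphM. Qed.
Fact bop_rep_star a v w :
  inner (bop_lin (phi a) v) w = inner v (bop_lin (phi (star a)) w).
Proof. by rewrite star_homP; exact: bop_adj. Qed.

Definition bop_rep : starRep A := StarRep hs bop_rep_bounded bop_rep_linear
  bop_rep_1 bop_rep_M bop_rep_star.

End RepOfHom.
End AdjointableOperators.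

(** * Weighted composition operators on l2 *)

Section WeightedComposition.
Variables (R : realType) (I : countType).
Local Notation C := R[i].
Local Notation l2 := (l2 R I).

(* The condition, required in both directions, for f |-> (k |-> a k * f (phi k)) and
   f |-> (k |-> b k * f (psi k)) to be adjoint to each other. *)
Definition adjoint_weights (a b : I -> C) (phi psi : I -> I) :=
  forall k, a k != 0 -> psi (phi k) = k /\ b (phi k) = Num.conj (a k).

Section Operator.
Variables (a b : I -> C) (phi psi : I -> I).
Hypotheses (ab : adjoint_weights a b phi psi) (a1 : forall k, sqnorm (a k) <= 1).

(** Where the weight is nonzero, [psi] undoes [phi]. So [phi] is injective on the indices that
    count, and the reindexed finite sum has no repetition. *)
Lemma weighted_comp_le (f : l2) : sum_bounded (fun k => sqnorm (a k * f (phi k))) (l2_sqnorm f).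
Proof.
move=> s us; rewrite (bigID (fun k => a k != 0)) /= addrC big1 ?add0r; last first.
  by move=> k /negPn/eqP ->; rewrite mul0r /sqnorm /= expr0n addr0.
rewrite -big_filter; pose t := [seq k <- s | a k != 0].
apply: (@le_trans _ _ (\sum_(k <- map phi t) sqnorm (f k))).
  rewrite big_map; apply: ler_sum => k _; rewrite sqnormM.
  by rewrite ler_piMl ?sqnorm_ge0.
apply: l2_sqnorm_ub; rewrite map_inj_in_uniq ?filter_uniq // /t.
move=> k l; rewrite !mem_filter => /andP[ak _] /andP[al _] e.
by rewrite -(ab ak).1 e (ab al).1.
Qed.

Fact weighted_comp_l2 (f : l2) : (fun k => a k * f (phi k)) \in l2_pred (R := R) (I := I).
Proof. by apply/asboolP; exists (l2_sqnorm f); exact: weighted_comp_le. Qed.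

Definition weighted_comp (f : l2) : l2 := L2 (weighted_comp_l2 f).

Lemma weighted_comp_nm f : rnorm (weighted_comp f) <= rnorm f.
Proof.
rewrite -ler_sqr ?nnegrE ?rnorm_ge0 // !l2_nmE; apply: l2_sqnorm_le.
exact: weighted_comp_le.
Qed.

Lemma weighted_comp_bounded : rnorm_bounded weighted_comp.
Proof. by exists 1; split=> // f; rewrite mul1r weighted_comp_nm. Qed.

End Operator.

Variables (a b : I -> C) (phi psi : I -> I).
Hypotheses (ab : adjoint_weights a b phi psi) (ba : adjoint_weights b a psi phi).
Hypotheses (a1 : forall k, sqnorm (a k) <= 1) (b1 : forall k, sqnorm (b k) <= 1).

Let T := weighted_comp ab a1.
Let S := weighted_comp ba b1.

(** [S] pulls coordinates back along [psi], so it pushes basis vectors forward along [phi]. *)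
Lemma weighted_comp_delta l : S (l2_delta R l) = Num.conj (a l) *: l2_delta R (phi l).
Proof.
apply: l2_ext => k; rewrite l2_scaleE /=.
have [bk|bk] := eqVneq (b k) 0.
  rewrite bk mul0r; case: eqP => [e|_]; last by rewrite mulr0.
  have [al|al] := eqVneq (a l) 0; first by rewrite al rmorph0 mul0r.
  by have [_] := ab al; rewrite -e bk => /esym ->; rewrite mul0r.
have [pk ak] := ba bk; case: eqP => [e|ne].
  by rewrite -e ak Num.Theory.conjCK pk eqxx.
rewrite mulr0; have [al|al] := eqVneq (a l) 0; first by rewrite al rmorph0 mul0r.
case: eqP => [e|_]; last by rewrite mulr0.
by case: ne; rewrite e (ab al).1.
Qed.

(** By density the second argument may be a basis vector, where both sides equal [a l * f (phi l)].
    The work lies in the closedness of the set of good [g], which uses that both operators are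
    bounded. *)
Lemma weighted_comp_adjoint : adjoint_pair T S.
Proof.
move=> f g.
suff h : inner f (S g) - inner (T f) g = 0 by apply/esym/eqP; rewrite -subr_eq0 h.
pose V := [set g | inner f (S g) - inner (T f) g = 0].
have SL : linear S by move=> c u v; apply: l2_ext => k /=; rewrite mulrDr mulrCA.
apply: (@onb_ind _ _ _ _ (l2_delta_basis R I) V).
- apply/closedE => v h /=; apply/eqP; rewrite -normr_eq0; apply: contraT => z0.
  suff: False by [].
  set z := _ - _ in z0.
  have [_ e0] : `|z| = (complex.Re `|z|)%:C /\ 0 < complex.Re `|z|.
    by apply: ltCE; rewrite lt_def z0 normr_ge0.
  set d := complex.Re _ in e0.
  have M1 : 0 < rnorm f + rnorm (T f) + 1 by rewrite ltr_wpDl ?addr_ge0 ?rnorm_ge0.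
  have [s [Vs]] := h _ (divr_gt0 e0 M1); rewrite ltr_pdivlMr // => lt.
  have {}Vs : inner f (S s) - inner (T f) s = 0 := Vs.
  have SB : S v - S s = S (v - s).
    by have := SL (-1) s v; rewrite !scaleN1r addrC => <-; rewrite addrC.
  have : `|z| <= ((rnorm f + rnorm (T f)) * rnorm (v - s))%:C.
    have -> : z = inner f (S (v - s)) - inner (T f) (v - s).
      rewrite -SB !innerBr /z -[LHS]subr0 -Vs; ring.
    apply: le_trans (ler_normB _ _) _; rewrite mulrDl rmorphD lerD //.
      rewrite -[leLHS]RRe_real ?normr_real // lecR; apply: le_trans (inner_le _ _) _.
      by rewrite ler_wpM2l ?rnorm_ge0 // weighted_comp_nm.
    by rewrite -[leLHS]RRe_real ?normr_real // lecR inner_le.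
  rewrite -[leLHS]RRe_real ?normr_real // lecR -/d.
  have := rnorm_ge0 (v - s); move: lt; rewrite mulrC; set p := _ + rnorm (T f).
  by rewrite mulrDl mul1r; lra.
- by rewrite /V /= -(scale0r (0 : l2)) -[0 *: 0]addr0 SL !scale0r !add0r
   [S 0](_ : _ = 0) ?inner0r ?subrr //; apply: l2_ext => k /=; rewrite mulr0.
- rewrite /V => c u v /= hu hv; rewrite SL !innerDr !innerZr opprD addrACA -mulrBr.
  by rewrite hu hv mulr0 addr0.
- move=> l; rewrite /V /= weighted_comp_delta innerZr !l2_inner_delta Num.Theory.conjCK /=.
  by rewrite subrr.
Qed.

Definition weighted_bop (v0 : l2) (h : v0 != 0) : bop h :=
  BOp h weighted_comp_adjoint (weighted_comp_bounded ab a1).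

End WeightedComposition.

Section Multiindices.
Variable d : nat.
Implicit Types (k : {ffun 'I_d -> nat}) (i j l : 'I_d).

Definition tailn k (m : nat) : nat := (\sum_(l < d | m <= l) k l)%N.

Lemma tailE k j : tail k j = tailn k j.+1. Proof. by []. Qed.
Lemma totalE k : Defs.total k = tailn k 0. Proof. by []. Qed.

Lemma raiseE k j l : raise k j l = if l == j then (k l).+1 else k l.
Proof. by rewrite ffunE. Qed.
Lemma lower_raise k j : lower (raise k j) j = k.
Proof. by apply/ffunP => l; rewrite !ffunE; case: eqP. Qed.
Lemma raise_lower k j : (0 < k j)%N -> raise (lower k j) j = k.
Proof. by move=> kj; apply/ffunP => l; rewrite !ffunE; case: eqP => // ->; rewrite prednK. Qed.
Lemma raise_comm k i j : raise (raise k i) j = raise (raise k j) i.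
Proof. by apply/ffunP => l; rewrite !ffunE; case: (l == i); case: (l == j). Qed.
Lemma raise_lower_comm k i j : i != j -> raise (lower k i) j = lower (raise k j) i.
Proof.
move=> ij; apply/ffunP => l; rewrite !ffunE.
by case: (eqVneq l i) => [->|]; rewrite ?(negbTE ij) //; case: eqP.
Qed.

Lemma tailn_raise k j m : tailn (raise k j) m = (tailn k m + (m <= j))%N.
Proof.
rewrite /tailn; have [mj|mj] := leqP m j.
  rewrite (bigD1 j) //= [in RHS](bigD1 j) //= raiseE eqxx addSn addn1; congr _.+1.
  congr addn; apply: eq_bigr => l /andP[_ /negbTE lj].
  by rewrite raiseE lj.
rewrite addn0; apply: eq_bigr => l ml; rewrite raiseE; case: eqP => // e.
by move: ml; rewrite e leqNgt mj.
Qed.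

Lemma tailn_lower k j m : (0 < k j)%N -> tailn k m = (tailn (lower k j) m + (m <= j))%N.
Proof. by move=> kj; rewrite -tailn_raise raise_lower. Qed.

Lemma tailnS k j : tailn k j = (k j + tailn k j.+1)%N.
Proof.
rewrite /tailn (bigD1 j) //=; congr addn; apply: eq_bigl => l.
by rewrite [RHS]ltn_neqAle eq_sym andbC.
Qed.

Lemma tailn_ge k m : (d <= m)%N -> tailn k m = 0%N.
Proof.
by move=> dm; rewrite /tailn big1 // => l ml; have := leq_trans (ltn_ord l) (leq_trans dm ml);
  rewrite ltnn.
Qed.

Lemma multi_ind (P : {ffun 'I_d -> nat} -> Prop) :
  P [ffun=> 0%N] -> (forall k j, P k -> P (raise k j)) -> forall k, P k.
Proof.
move=> P0 PS k; have [m] := ubnP (Defs.total k); elim: m k => // m IH k km.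
have [k0|[j kj]] : (forall j, k j = 0%N) \/ exists j, (0 < k j)%N.
- have [/existsP[j kj]|/existsPn h] := boolP [exists j, (0 < k j)%N]; first by right; exists j.
  by left=> j; apply/eqP; rewrite -leqn0 leqNgt.
- suff -> : k = [ffun=> 0%N] by [].
  by apply/ffunP => j; rewrite k0 ffunE.
rewrite -(raise_lower kj); apply: PS; apply: IH.
by move: km; rewrite !totalE (tailn_lower 0 kj) addn1.
Qed.

End Multiindices.

Section QPowers.
Variables (R : realType) (q : R).
Hypothesis hq : 1 < `|q|.

Lemma q_neq0 : q != 0.
Proof. by rewrite -normr_gt0 (lt_trans ltr01). Qed.

Lemma qVn_norm n : `|q ^- n| <= 1.
Proof. by rewrite normfV normrX invf_le1 ?exprn_gt0 ?(lt_trans ltr01) // exprn_ege1 // ltW. Qed.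

Lemma qV2 n : q ^- (2 * n) = (q ^- n) ^+ 2.
Proof. by rewrite mulnC exprM exprVn. Qed.

Lemma qV2D m n : q ^- (2 * (m + n)) = q ^- (2 * m) * q ^- (2 * n).
Proof. by rewrite mulnDr (exprD q (2 * m) (2 * n)) invfM. Qed.

Lemma qV2_gt0 n : 0 < q ^- (2 * n).
Proof. by rewrite qV2 exprn_even_gt0 //= invr_eq0 expf_neq0 // q_neq0. Qed.

Lemma qV2_le1 n : q ^- (2 * n) <= 1.
Proof.
by rewrite qV2 -[leLHS]real_normK ?num_real // exprn_ile1 ?qVn_norm.
Qed.

Lemma qV2_lt1 n : (0 < n)%N -> q ^- (2 * n) < 1.
Proof.
move=> n0; rewrite qV2 -[ltLHS]real_normK ?num_real // normfV normrX exprn_ilt1 //.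
by rewrite invf_lt1 ?exprn_gt0 ?(lt_trans ltr01) // exprn_egt1 // -lt0n.
Qed.

Lemma sqrt_1q2 n : Num.sqrt (1 - q ^- (2 * n)) ^+ 2 = 1 - q ^- (2 * n).
Proof. by rewrite sqr_sqrtr // subr_ge0 qV2_le1. Qed.

End QPowers.

(** * The weighted shifts satisfy the sphere relations *)

Section ShiftCoefficients.
Variables (R : realType) (q : R) (hq : 1 < `|q|) (d : nat).
Local Notation C := R[i].
Local Notation I := {ffun 'I_d -> nat}.
Local Notation l2 := (l2 R I).
Implicit Types k : I.

Definition shift_coef (k : I) (j : 'I_d) : C :=
  (Num.sqrt (1 - q ^- (2 * k j)%N) * q ^- tail k j)%:C.

Definition diag_coef (z : C) (k : I) : C := z * (q ^- Defs.total k)%:C.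

Lemma sqnorm_real (x : R) : sqnorm x%:C = x ^+ 2.
Proof. by rewrite /sqnorm /= expr0n addr0. Qed.

Lemma shift_coef_le1 k j : sqnorm (shift_coef k j) <= 1.
Proof.
rewrite sqnorm_real exprMn sqrt_1q2 // -qV2 mulr_ile1 ?qV2_le1 ?(ltW (qV2_gt0 _ _)) //.
  by rewrite subr_ge0 qV2_le1.
by rewrite gerDl oppr_le0 ltW ?qV2_gt0.
Qed.

Lemma shift_coef0 k j : k j = 0%N -> shift_coef k j = 0.
Proof. by move=> e; rewrite /shift_coef e muln0 expr0 invr1 subrr sqrtr0 mul0r. Qed.

Lemma diag_coef_le1 (z : C) (hz : `|z| = 1) k : sqnorm (diag_coef z k) <= 1.
Proof.
rewrite sqnormM sqnorm_real -qV2.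
have -> : sqnorm z = 1 by apply: complexI; rewrite sqnormE -normCK hz expr1n.
by rewrite mul1r qV2_le1.
Qed.

(** In coordinates, the operator lowering basis vectors sends [f] to [k |-> shift_coef (raise k j) j
    * f (raise k j)]; this is why its index map is [raise]. *)
Lemma shift_adjoint_weights j : adjoint_weights (fun k => shift_coef (raise k j) j) (fun k => shift_coef k j)
  (fun k => raise k j) (fun k => lower k j).
Proof. by move=> k _; rewrite lower_raise conjCE /= oppr0. Qed.

Lemma shift_star_adjoint_weights j : adjoint_weights (fun k => shift_coef k j) (fun k => shift_coef (raise k j) j)
  (fun k => lower k j) (fun k => raise k j).
Proof.
(* The weight vanishes at [k j = 0], the only place where [raise] fails to undo [lower]. *)
move=> k nz; have kj : (0 < k j)%N.
  by rewrite lt0n; apply: contra nz => /eqP/shift_coef0 ->.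
by rewrite raise_lower //; split=> //; exact/esym/conjC_real.
Qed.

Lemma diag_adjoint_weights (z z' : C) : z' = Num.conj z -> adjoint_weights (diag_coef z) (diag_coef z') id id.
Proof.
by move=> -> k _; rewrite /diag_coef rmorphM; split=> //; congr (_ * _); exact/esym/conjC_real.
Qed.


Let Q : C := q%:C.
Let Qi : C := q^-1%:C.

Lemma qC_qVC : Q * Qi = 1.
Proof. by rewrite -rmorphM divff ?q_neq0. Qed.

Lemma shift_coef_raise k (i j : 'I_d) : i != j ->
  shift_coef (raise k i) j = (if (j < i)%N then Qi else 1) * shift_coef k j.
Proof.
move=> ij; rewrite /shift_coef !tailE tailn_raise raiseE eq_sym (negbTE ij).
case: ltnP => _; rewrite ?mul1r ?addn0 // -rmorphM; congr (_%:C).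
by rewrite addn1 exprS invfM mulrCA.
Qed.

Lemma shift_coef_lower k (i j : 'I_d) : i != j -> (0 < k i)%N ->
  shift_coef (lower k i) j = (if (j < i)%N then Q else 1) * shift_coef k j.
Proof.
move=> ij ki; rewrite -[in RHS](raise_lower ki) shift_coef_raise // mulrA.
by case: ifP => _; rewrite ?qC_qVC !mul1r.
Qed.

Lemma qV_total_raise k j :
  (q ^- Defs.total (raise k j))%:C = Qi * (q ^- Defs.total k)%:C :> C.
Proof. by rewrite totalE tailn_raise -totalE addn1 exprS invfM rmorphM. Qed.

Lemma qV_total_lower k j : (0 < k j)%N ->
  (q ^- Defs.total (lower k j))%:C = Q * (q ^- Defs.total k)%:C :> C.
Proof. by move=> kj; rewrite -[in RHS](raise_lower kj) qV_total_raise mulrA qC_qVC mul1r. Qed.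

Lemma shift_coef_sq k j :
  shift_coef k j * shift_coef k j = ((1 - q ^- (2 * k j)) * q ^- (2 * tail k j))%:C.
Proof. by rewrite -rmorphM; congr (_%:C); rewrite mulrACA -!expr2 sqrt_1q2 // -qV2. Qed.

Lemma qV_tailnS k (j : 'I_d) : q ^- (2 * tailn k j) = q ^- (2 * k j) * q ^- (2 * tail k j).
Proof. by rewrite tailnS mulnDr exprD invfM. Qed.

End ShiftCoefficients.

Section ShiftRelations.
Variables (R : realType) (q : R) (hq : 1 < `|q|) (d r : nat) (lambda : R[i]).
Hypotheses (hl : `|lambda| = 1) (hr : r = 0%N -> Num.conj lambda = lambda).
Local Notation C := R[i].
Local Notation I := {ffun 'I_d -> nat}.
Local Notation l2 := (l2 R I).
Local Notation sc := (shift_coef q).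
Local Notation Q := (q%:C : C).
Local Notation Qi := (q^-1%:C : C).
Implicit Types k : I.
Variables (v0 : l2) (h : v0 != 0) (D : bop h) (X : 'I_d -> bop h).
Hypothesis DE : forall f k, D f k = lambda * (q ^- Defs.total k)%:C * f k.
Hypothesis DsE : forall f k,
  (star D : bop h) f k = Num.conj lambda * (q ^- Defs.total k)%:C * f k.
Hypothesis XE : forall j f k, X j f k = sc (raise k j) j * f (raise k j).
Hypothesis XsE : forall j f k, (star (X j) : bop h) f k = sc k j * f (lower k j).

(** The value 0 beyond [r + d] is a mere default: [model_sphere_eqs] concerns indices up to [r + d]
    only. *)
Definition model_x (i : nat) : bop h :=
  if (i < r)%N then 0 else if i == r then D else
  if insub (i - r.+1)%N is Some j then X j else 0.

Lemma model_x_lt i : (i < r)%N -> model_x i = 0.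
Proof. by rewrite /model_x => ->. Qed.
Lemma model_x_eq : model_x r = D.
Proof. by rewrite /model_x ltnn eqxx. Qed.
Lemma model_x_gt (j : 'I_d) : model_x (r.+1 + j) = X j.
Proof.
rewrite /model_x ltnNge (leq_trans (leqnSn r)) ?leq_addr //=.
by rewrite gtn_eqF ?addSn ?ltnS ?leq_addr // subSS addKn valK.
Qed.

Variant index_spec (i : nat) : Prop :=
| IndexLt of (i < r)%N
| IndexEq of i = r
| IndexGt (j : 'I_d) of i = (r.+1 + j)%N.

Lemma indexP i : (i <= r + d)%N -> index_spec i.
Proof.
move=> id; case: (ltngtP i r) => ir; [exact: IndexLt| |exact: IndexEq].
have jd : (i - r.+1 < d)%N by rewrite ltn_subLR // addSn ltnS.
by apply: (@IndexGt _ (Ordinal jd)); rewrite /= subnKC.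
Qed.

Lemma bop_l2_ext (S T : bop h) : (forall f k, S f k = T f k) -> S = T.
Proof. by move=> e; apply: bop_ext => f; apply: l2_ext => k; exact: e. Qed.

(** Inserting [Q * Qi] on one side lets [ring] close identities whose two sides carry different
    powers of [q]. *)
Let qq (z : C) : z = Q * Qi * z. Proof. by rewrite qC_qVC ?mul1r. Qed.

Lemma model_DX j : D * X j = Q *: (X j * D).
Proof.
apply: bop_l2_ext => f k; rewrite bopZv !bopMv l2_scaleE DE !XE DE.
rewrite qV_total_raise // [LHS]qq; ring.
Qed.

Lemma model_DsX j : star D * X j = Q *: (X j * star D).
Proof.
apply: bop_l2_ext => f k; rewrite bopZv !bopMv l2_scaleE DsE !XE DsE.
rewrite qV_total_raise // [LHS]qq; ring.
Qed.

Lemma model_XsD j : star (X j) * D = Q *: (D * star (X j)).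
Proof.
apply: bop_l2_ext => f k; rewrite bopZv !bopMv l2_scaleE !XsE !DE XsE.
have [kj|kj] := posnP (k j); first by rewrite shift_coef0 //; ring.
rewrite qV_total_lower //; ring.
Qed.

Lemma model_XX (i j : 'I_d) : (i < j)%N -> X i * X j = Q *: (X j * X i).
Proof.
move=> ij; have nij : i != j by rewrite -val_eqE neq_ltn ij.
have nji : j != i by rewrite eq_sym.
apply: bop_l2_ext => f k; rewrite bopZv !bopMv l2_scaleE !XE.
have e1 : sc (raise (raise k i) j) j = sc (raise k j) j.
  by rewrite raise_comm shift_coef_raise // ltnNge ltnW // mul1r.
have e2 : sc (raise (raise k j) i) i = Qi * sc (raise k i) i.
  by rewrite raise_comm shift_coef_raise // ij.
rewrite e1 e2 (raise_comm k j i) [LHS]qq; ring.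
Qed.

Lemma model_XsX (i j : 'I_d) : i != j -> star (X i) * X j = Q *: (X j * star (X i)).
Proof.
move=> nij; have nji : j != i by rewrite eq_sym.
apply: bop_l2_ext => f k; rewrite bopZv !bopMv l2_scaleE !XsE !XE XsE.
have rk : raise k j i = k i by rewrite raiseE (negbTE nij).
have [ki|ki] := posnP (k i).
  by rewrite [sc k i]shift_coef0 // [sc (raise k j) i]shift_coef0 ?rk //; ring.
rewrite raise_lower_comm // shift_coef_lower ?rk // (shift_coef_raise q k nji).
case: (ltngtP i j) => ij.
- by rewrite mul1r [LHS]qq; ring.
- by ring.
- by move: nij; rewrite (val_inj ij) eqxx.
Qed.

Lemma model_XsX_self j f k : (star (X j) * X j) f k = sc k j * sc k j * f k.
Proof.
rewrite bopMv XsE XE; have [kj|kj] := posnP (k j).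
  by rewrite [sc k j]shift_coef0 // !mul0r.
by rewrite raise_lower // mulrA.
Qed.

Lemma model_XXs_self j f k :
  (X j * star (X j)) f k = sc (raise k j) j * sc (raise k j) j * f k.
Proof. by rewrite bopMv XE XsE lower_raise mulrA. Qed.

Let ll : lambda * Num.conj lambda = 1.
Proof. by rewrite -normCK hl expr1n. Qed.

Local Notation s := (sphere_sv model_x).

Lemma model_s_lt i : (i < r)%N -> s i = 0.
Proof.
elim: i => [|i IH] ir /=; first by rewrite model_x_lt // mul0r.
by rewrite IH ?(ltnW ir) // model_x_lt // mulr0 add0r.
Qed.

Let DD f k : (star D * D) f k = (q ^- (2 * tailn k 0))%:C * f k.
Proof.
rewrite bopMv DsE DE -totalE qV2 expr2 rmorphM /= -[RHS]mul1r -ll; ring.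
Qed.

(** The sum telescopes: with [t = q ^- (2 * tail k j)] the next summand is
    [(1 - q ^- (2 * k j)) * t], and the value so far is [q ^- (2 * k j) * t]. At [r = 0] the reality
    of [lambda] enters, since [s_0] is [x_0^2] and not [x_0^* x_0]. *)
Lemma model_s m f k : (m <= d)%N -> s (r + m) f k = (q ^- (2 * tailn k m))%:C * f k.
Proof.
elim: m => [_|m IH md].
  rewrite addn0 -DD; case er : r => [|r'].
    have xD : model_x 0 = D by have := model_x_eq; rewrite er.
    by rewrite -[sphere_sv _ 0]/(model_x 0 * model_x 0) xD !bopMv DsE !DE hr.
  have xD : model_x r'.+1 = D by have := model_x_eq; rewrite er.
  rewrite -[sphere_sv _ r'.+1]/(s r' + star (model_x r'.+1) * model_x r'.+1).
  by rewrite model_s_lt ?er // add0r xD.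
rewrite addnS -[s (r + m).+1]/(s (r + m) + star (model_x (r + m).+1) * model_x (r + m).+1).
rewrite bopDv l2_addE IH ?(ltnW md) //.
have -> : model_x (r + m).+1 = X (Ordinal md) by rewrite -addSn (model_x_gt (Ordinal md)).
rewrite model_XsX_self shift_coef_sq // -mulrDl -rmorphD; congr (_%:C * _).
by rewrite (qV_tailnS q k (Ordinal md)) tailE /= -mulrDl addrC subrK mul1r.
Qed.

Lemma model_sphere_eqs : sphere_eqs q model_x (r + d).
Proof.
split.
- case er : r => [|r'].
    have xD : model_x 0 = D by have := model_x_eq; rewrite er.
    by rewrite xD; apply: bop_l2_ext => f k; rewrite DsE DE hr.
  by rewrite model_x_lt ?er // star0.
- move=> i j /andP[ij jd]; have id := ltnW (leq_trans ij jd).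
  case: (indexP id) => [ir|ir|i' ei]; first by rewrite model_x_lt // mul0r mulr0 scaler0.
    case: (indexP jd) => [jr|jr|j' ej].
    + by move: ij; rewrite ir ltnNge ltnW.
    + by move: ij; rewrite ir jr ltnn.
    + by rewrite ir ej model_x_eq model_x_gt model_DX.
  case: (indexP jd) => [jr|jr|j' ej].
  + by move: ij; rewrite ei ltnNge (leq_trans (ltnW jr)) // addSn leqW // leq_addr.
  + by move: ij; rewrite ei jr ltnNge addSn leqW // leq_addr.
  + by move: ij; rewrite ei ej !model_x_gt ltn_add2l => /model_XX.
- move=> i j id jd ij.
  case: (indexP id) => [ir|ir|i' ei]; first by rewrite model_x_lt // star0 mul0r mulr0 scaler0.
    case: (indexP jd) => [jr|jr|j' ej].
    + by rewrite [model_x j]model_x_lt // mulr0 mul0r scaler0.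
    + by move: ij; rewrite ir jr eqxx.
    + by rewrite ir ej model_x_eq model_x_gt model_DsX.
  case: (indexP jd) => [jr|jr|j' ej].
  + by rewrite [model_x j]model_x_lt // mulr0 mul0r scaler0.
  + by rewrite ei jr model_x_eq model_x_gt model_XsD.
  + by rewrite ei ej !model_x_gt model_XsX //; move: ij; rewrite ei ej eqn_add2l.
- move=> i /andP[i0 id].
  case: (indexP id) => [ir|ir|j ei].
  + rewrite model_x_lt // star0 mul0r subrr model_s_lt ?scaler0 //.
    by apply: leq_ltn_trans ir; exact: leq_pred.
  (* At [i = r] both sides vanish: [D] is normal and [s (r - 1)] is zero. *)
  + rewrite model_s_lt; last by rewrite ir prednK // -ir.
    rewrite ir model_x_eq scaler0; apply: bop_l2_ext => f k.
    rewrite bopBv l2_subE !bopMv DE !DsE DE.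
    rewrite -[RHS](subrr (lambda * (q ^- Defs.total k)%:C * (Num.conj lambda * (q ^- Defs.total k)%:C * f k))).
    by congr (_ - _); ring.
  + rewrite ei model_x_gt addSn /=; apply: bop_l2_ext => f k.
    rewrite bopBv l2_subE bopZv l2_scaleE model_XXs_self model_XsX_self model_s; last exact: ltnW.
    rewrite !shift_coef_sq // -mulrBl mulrA; congr (_ * _).
    rewrite -rmorphB -rmorphM; congr (_%:C).
    rewrite qV_tailnS raiseE eqxx !tailE tailn_raise ltnn addn0.
    by rewrite mulnS exprD invfM; ring.
- apply: bop_l2_ext => f k; rewrite model_s // tailn_ge // muln0 expr0 invr1 rmorph1 mul1r.
  by rewrite bop1v.
Qed.

End ShiftRelations.

Section ShiftRepresentations.
Variables (R : realType) (q : R) (hq : 1 < `|q|).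
Local Notation C := R[i].
Local Notation I d := {ffun 'I_d -> nat}.
Local Notation l2 d := (l2 R (I d)).

Lemma l2_delta_neq0 d : l2_delta R ([ffun=> 0%N] : I d) != 0.
Proof.
apply/eqP => /(congr1 (fun f : l2 d => f [ffun=> 0%N])) /= /eqP.
by rewrite eqxx oner_eq0.
Qed.

Section Operators.
Variables (d : nat) (lambda : C).
Hypothesis hl : `|lambda| = 1.

Let hl' : `|Num.conj lambda| = 1. Proof. by rewrite norm_conjC. Qed.

Definition model_shift j : bop (l2_delta_neq0 d) :=
  weighted_bop (@shift_adjoint_weights R q d j) (@shift_star_adjoint_weights R q d j)
    (fun k => shift_coef_le1 hq _ _) (fun k => shift_coef_le1 hq _ _) (l2_delta_neq0 d).
Definition model_diag : bop (l2_delta_neq0 d) :=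
  weighted_bop (@diag_adjoint_weights R q d _ _ erefl) (@diag_adjoint_weights R q d _ _ (esym (Num.Theory.conjCK lambda)))
    (diag_coef_le1 hq hl) (diag_coef_le1 hq hl') (l2_delta_neq0 d).

Lemma model_diag_delta k :
  model_diag (l2_delta R k) = (lambda * (q ^- Defs.total k)%:C) *: l2_delta R k.
Proof.
apply: etrans (weighted_comp_delta (@diag_adjoint_weights R q d _ _ (esym (Num.Theory.conjCK lambda)))
  (@diag_adjoint_weights R q d _ _ erefl) (diag_coef_le1 hq hl) k) _.
congr (_ *: _); rewrite /diag_coef rmorphM; congr (_ * _); last exact: conjC_real.
exact: Num.Theory.conjCK.
Qed.

Lemma model_shift_delta j k :
  model_shift j (l2_delta R k) = shift_coef q k j *: l2_delta R (lower k j).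
Proof.
apply: etrans (weighted_comp_delta (@shift_star_adjoint_weights R q d j) (@shift_adjoint_weights R q d j)
  (fun k => shift_coef_le1 hq _ _) k) _.
congr (_ *: _); exact: conjC_real.
Qed.

Lemma model_shift_star_delta j k : (star (model_shift j) : bop _) (l2_delta R k) =
  shift_coef q (raise k j) j *: l2_delta R (raise k j).
Proof.
apply: etrans (weighted_comp_delta (@shift_adjoint_weights R q d j) (@shift_star_adjoint_weights R q d j)
  (fun k => shift_coef_le1 hq _ _) k) _.
congr (_ *: _); exact: conjC_real.
Qed.

Lemma model_eqs r : (r = 0%N -> Num.conj lambda = lambda) ->
  sphere_eqs q (model_x r model_diag model_shift) (r + d).
Proof. move=> hr; exact: (@model_sphere_eqs R q hq d r lambda hl hr _ _ model_diag model_shift). Qed.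

End Operators.

Lemma exists_psi_even n s : exists pi : starRep (even_sphere q n), is_psi_even s pi.
Proof.
pose lambda : C := ((-1) ^+ s)%:C.
have hl : `|lambda| = 1 by rewrite normc_def /= expr0n addr0 sqrr_sign sqrtr1.
have hr : 0%N = 0%N -> Num.conj lambda = lambda by move=> _; exact: conjC_real.
pose y := model_x 0 (@model_diag n _ hl) (@model_shift n).
have hy : sphere_eqs q y n := @model_eqs n _ hl 0 hr.
pose f (i : 'I_n.+1) := y i.
have fE i : (i <= n)%N -> Defs.eval f (even_term R n i) = y i by move=> iN; rewrite /= /f inordK.
pose phi := pres_lift (P := even_pres q n) ((sphere_eqsP q fE).2 hy).
have phiE i : (i <= n)%N -> phi (even_x q n i) = y i.
  move=> iN; rewrite /even_x pcl_eval.
  by rewrite (pres_lift_gen (P := even_pres q n) ((sphere_eqsP q fE).2 hy)) /f inordK.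
have ys j : y j.+1 = y (1 + j)%N by [].
exists (bop_rep phi (l2_separable _ _)); exists (@l2_delta R _); split.
- exact: l2_delta_basis.
- move=> k; rewrite -[LHS]/(phi (even_x q n 0) (l2_delta R k)) phiE // /y model_x_eq.
  by rewrite model_diag_delta rmorphM.
- move=> j k; rewrite -[LHS]/(phi (even_x q n j.+1) (l2_delta R k)) phiE //.
  by rewrite ys /y model_x_gt model_shift_delta.
- move=> j k; rewrite -[LHS]/(phi (star (even_x q n j.+1)) (l2_delta R k)) star_homP phiE //.
  rewrite ys /y model_x_gt model_shift_star_delta /shift_coef raiseE eqxx.
  by rewrite !tailE tailn_raise ltnn addn0.
Qed.

(** On an odd sphere [x_0 = 0], so the same model is used with [r = 1], where the reality condition
    on [lambda] is void. *)
Lemma exists_psi_odd m (lambda : circle R) :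
  exists pi : starRep (odd_sphere q m), is_psi_odd lambda pi.
Proof.
have hl : `|val lambda| = 1 by apply/eqP; exact: (valP lambda).
have hr : 1%N = 0%N -> Num.conj (val lambda) = val lambda by [].
pose y := model_x 1 (@model_diag m _ hl) (@model_shift m).
have hy : sphere_eqs q y m.+1 := @model_eqs m _ hl 1 hr.
pose f (i : 'I_m.+1) := y i.+1.
have fE i : (i <= m.+1)%N -> Defs.eval f (odd_term R m i) = y i.
  by case: i => [|i] iN; rewrite /= ?/f ?inordK // /y model_x_lt.
pose phi := pres_lift (P := odd_pres q m) ((sphere_eqsP q fE).2 hy).
have phiE i : (i <= m)%N -> phi (odd_x q m i.+1) = y i.+1.
  move=> iN; rewrite /odd_x pcl_eval.
  by rewrite (pres_lift_gen (P := odd_pres q m) ((sphere_eqsP q fE).2 hy)) /f inordK.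
exists (bop_rep phi (l2_separable _ _)); exists (@l2_delta R _); split.
- exact: l2_delta_basis.
- move=> k; rewrite -[LHS]/(phi (odd_x q m 1) (l2_delta R k)) phiE // /y model_x_eq.
  by rewrite model_diag_delta.
- move=> j k; rewrite -[LHS]/(phi (odd_x q m j.+2) (l2_delta R k)) phiE //.
  have -> : y j.+2 = model_shift j by exact: (model_x_gt 1).
  by rewrite model_shift_delta.
Qed.

End ShiftRepresentations.

(** * Commutation relations in the spheres *)

Section SphereAlgebra.
Variables (R : realType) (q : R) (B : starAlgType R) (x : nat -> B) (N : nat).
Hypotheses (q0 : q != 0) (hx : sphere_eqs q x N).
Local Notation C := R[i].
Local Notation s := (sphere_sv x).
Local Notation Q := (q%:C : C).
Local Notation Qi := (q^-1%:C : C).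
Local Notation c := (q ^- 2).

Let qC_qVC : Q * Qi = 1. Proof. by rewrite -rmorphM divff. Qed.
Let QiQ : Qi * Q = 1. Proof. by rewrite mulrC. Qed.
Lemma sphere_star_x0 : star (x 0) = x 0. Proof. by case: hx. Qed.
Lemma sphere_sv_top : s N = 1. Proof. by case: hx. Qed.

Lemma sphere_x_x i j : (i < j <= N)%N -> x i * x j = Q *: (x j * x i).
Proof. by case: hx => _ h _ _ _; exact: h. Qed.
Lemma sphere_x_x_rev i j : (i < j <= N)%N -> x j * x i = Qi *: (x i * x j).
Proof. by move=> /sphere_x_x ->; rewrite scalerA QiQ scale1r. Qed.
Lemma sphere_xstar_x i j : (i <= N)%N -> (j <= N)%N -> i != j -> star (x i) * x j = Q *: (x j * star (x i)).
Proof. by case: hx => _ _ h _ _; exact: h. Qed.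
Lemma sphere_x_xstar i j : (i <= N)%N -> (j <= N)%N -> i != j -> x i * star (x j) = Qi *: (star (x j) * x i).
Proof. by move=> ? ? ?; rewrite sphere_xstar_x ?(eq_sym j) // scalerA QiQ scale1r. Qed.
Lemma sphere_xstar_xstar i j : (i < j <= N)%N -> star (x i) * star (x j) = Qi *: (star (x j) * star (x i)).
Proof.
by move=> h; rewrite -!starM sphere_x_x_rev // starZ conjC_real.
Qed.

Lemma sphere_sv_star i : star (s i) = s i.
Proof.
elim: i => [|i IH] /=; first by rewrite starM sphere_star_x0.
by rewrite starD IH starM starK.
Qed.

Lemma sphere_sv_x_lt i j : (i < j <= N)%N -> s i * x j = (Q * Q) *: (x j * s i).
Proof.
move=> /andP[ij jN]; elim: i ij => [|i IH] ij.
  have h : (0 < j <= N)%N by rewrite ij.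
  by rewrite /= -mulrA (sphere_x_x h) -scalerAr [X in _ *: X = _]mulrA (sphere_x_x h) -scalerAl scalerA mulrA.
have iN : (i.+1 <= N)%N by exact: ltnW (leq_trans ij jN).
rewrite /= mulrDl IH ?(ltnW ij) // mulrDr scalerDr; congr (_ + _).
have h : (i.+1 < j <= N)%N by rewrite ij.
have nij : i.+1 != j by rewrite neq_ltn ij.
by rewrite -mulrA (sphere_x_x h) -scalerAr [X in _ *: X = _]mulrA (sphere_xstar_x iN jN nij) -scalerAl scalerA mulrA.
Qed.

Let xstar_x_comm j k : (j < k <= N)%N -> (star (x k) * x k) * x j = x j * (star (x k) * x k).
Proof.
move=> /andP[jk kN]; have jN := ltnW (leq_trans jk kN).
have h : (j < k <= N)%N by rewrite jk.
have nkj : k != j by rewrite neq_ltn jk orbT.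
rewrite -mulrA (sphere_x_x_rev h) -scalerAr [X in _ *: X = _]mulrA (sphere_xstar_x kN jN nkj).
by rewrite -scalerAl scalerA QiQ scale1r mulrA.
Qed.

(** Downward induction from [s N = 1]: each step subtracts [x_(i+1)^* x_(i+1)], which commutes with
    [x_j] for [j <= i] because the factors [q] and [q^-1] cancel. *)
Lemma sphere_sv_x_ge i j : (j <= i <= N)%N -> s i * x j = x j * s i.
Proof.
move=> /andP[ji iN].
have [m im] : exists m, (i + m)%N = N by exists (N - i)%N; rewrite subnKC.
elim: m i ji iN im => [|m IH] i ji iN im.
  by rewrite addn0 in im; rewrite im sphere_sv_top mul1r mulr1.
have iN' : (i.+1 <= N)%N by rewrite -im addnS ltnS leq_addr.
have -> : s i = s i.+1 - star (x i.+1) * x i.+1 by rewrite /= addrK.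
rewrite mulrBl mulrBr IH ?(leqW ji) // ?addSnnS //; congr (_ - _).
by apply: xstar_x_comm; rewrite ltnS ji.
Qed.

Lemma sphere_sv_xstar_ge i j : (j <= i <= N)%N -> s i * star (x j) = star (x j) * s i.
Proof. by move=> /sphere_sv_x_ge h; rewrite -(sphere_sv_star i) -!starM h. Qed.

Lemma sphere_sv_xstar_lt i j : (i < j <= N)%N -> s i * star (x j) = c%:C *: (star (x j) * s i).
Proof.
move=> /sphere_sv_x_lt /(congr1 star); rewrite starZ !starM sphere_sv_star => ->.
rewrite scalerA.
suff -> : c%:C * Num.conj (Q * Q) = 1 by rewrite scale1r.
by rewrite -rmorphM conjC_real -rmorphM -expr2 mulVf ?rmorph1 // expf_neq0.
Qed.

Lemma sphere_sv_comm i j : (j <= i <= N)%N -> s i * s j = s j * s i.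
Proof.
move=> /andP[ji iN]; elim: j ji => [|j IH] ji.
  by rewrite /= mulrA sphere_sv_x_ge ?iN // -mulrA sphere_sv_x_ge ?iN // mulrA.
rewrite /= mulrDl mulrDr IH 1?ltnW //; congr (_ + _).
by rewrite mulrA sphere_sv_xstar_ge ?ji // -mulrA sphere_sv_x_ge ?ji // mulrA.
Qed.

Lemma sphere_x_xstar_self i : (i < N)%N -> x i.+1 * star (x i.+1) = s i.+1 - c%:C *: s i.
Proof.
move=> iN; case: hx => _ _ _ /(_ i.+1) h _.
move/eqP: (h iN); rewrite subr_eq => /eqP -> /=.
rewrite rmorphB rmorph1 scalerBl scale1r.
by rewrite addrAC.
Qed.

Lemma sphere_xstar_x_self i : star (x i.+1) * x i.+1 = s i.+1 - s i.
Proof. by rewrite /= addrAC subrr add0r. Qed.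

End SphereAlgebra.

Lemma exp_small (R : realType) (c e : R) : 0 <= c < 1 -> 0 < e -> exists m, c ^+ m < e.
Proof.
move=> /andP[c0 c1] e0; have cn : `|c| < 1 by rewrite ger0_norm.
have /cvgrPdist_lt /(_ _ e0) [m _ h] := cvg_expr cn.
by exists m; have := h m (leqnn m); rewrite sub0r normrN; apply: le_lt_trans; exact: ler_norm.
Qed.

Section SphereRep.
Variables (R : realType) (q : R) (hq : 1 < `|q|) (A : starAlgType R) (x : nat -> A) (N : nat).
Hypothesis hx : sphere_eqs q x N.
Variable pi : starRep A.
Local Notation H := (rep_space pi).
Local Notation C := R[i].
Local Notation X i := (pi (x i)).
Local Notation Xs i := (pi (star (x i))).
Local Notation S i := (pi (sphere_sv x i)).
Local Notation c := (q ^- 2).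
Implicit Types (u v w : H).

Let q0 := q_neq0 hq.

Lemma qV2_itv : 0 < c < 1.
Proof.
by rewrite -[2%N]muln1 (qV2_gt0 hq) (qV2_lt1 hq).
Qed.

Lemma sphere_sv_ip0 v : rinner (S 0 v) v = rnorm (X 0 v) ^+ 2.
Proof. by rewrite /= rep_M rinner_star (sphere_star_x0 hx) rinnervv. Qed.

Lemma sphere_sv_ipS i v : rinner (S i.+1 v) v = rinner (S i v) v + rnorm (X i.+1 v) ^+ 2.
Proof. by rewrite /= repD rep_M rinnerDl rinner_starr rinnervv. Qed.

Lemma sphere_sv_ip_ge0 i v : 0 <= rinner (S i v) v.
Proof. by elim: i => [|i IH]; rewrite ?sphere_sv_ip0 ?sphere_sv_ipS ?addr_ge0 ?sqr_ge0. Qed.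

Lemma sphere_sv_ip_mono i j v : (i <= j)%N -> rinner (S i v) v <= rinner (S j v) v.
Proof.
move=> /subnK <-; elim: (j - i)%N => [|d IH] //.
by rewrite addSn sphere_sv_ipS; apply: le_trans IH _; rewrite lerDl sqr_ge0.
Qed.

Lemma sphere_sv_ip_le i v : (i <= N)%N -> rinner (S i v) v <= rnorm v ^+ 2.
Proof.
move=> iN; apply: le_trans (sphere_sv_ip_mono v iN) _.
by rewrite (sphere_sv_top hx) rep_1 rinnervv.
Qed.

Lemma x_ip_le i v : rnorm (X i v) ^+ 2 <= rinner (S i v) v.
Proof. by case: i => [|i]; rewrite ?sphere_sv_ip0 ?sphere_sv_ipS // lerDr sphere_sv_ip_ge0. Qed.

Lemma sphere_sv_sa i v w : rinner (S i v) w = rinner v (S i w).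
Proof. by rewrite rinner_star (sphere_sv_star hx). Qed.

Lemma rnorm_le v w : rnorm v ^+ 2 <= rnorm w ^+ 2 -> rnorm v <= rnorm w.
Proof. by rewrite ler_sqr ?nnegrE ?rnorm_ge0. Qed.

(** From [0 <= s <= 1]: expand [<s (v - s v), v - s v> >= 0] and bound [<s (s v), s v>] by
    [|s v|^2]. *)
Lemma sphere_sv_sq_le i v : (i <= N)%N -> rnorm (S i v) ^+ 2 <= rinner (S i v) v.
Proof.
move=> iN; have h1 := sphere_sv_ip_ge0 i (v - S i v); have h2 := sphere_sv_ip_le (S i v) iN.
move: h1; rewrite rep_vB rinnerBl !rinnerBr (sphere_sv_sa i (S i v) v) -!rinnervv in h2 *.
by lra.
Qed.

Lemma sphere_sv_nm i v : (i <= N)%N -> rnorm (S i v) <= rnorm v.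
Proof. by move=> iN; apply: rnorm_le; apply: le_trans (sphere_sv_sq_le v iN) (sphere_sv_ip_le v iN). Qed.

Lemma x_nm i v : (i <= N)%N -> rnorm (X i v) <= rnorm v.
Proof. by move=> iN; apply: rnorm_le; apply: le_trans (x_ip_le i v) (sphere_sv_ip_le v iN). Qed.

Lemma xstar_nm i v : (i <= N)%N -> rnorm (Xs i v) <= rnorm v.
Proof.
move=> iN; have [->|n0] := eqVneq (rnorm (Xs i v)) 0; first exact: rnorm_ge0.
have p : 0 < rnorm (Xs i v) by rewrite lt_def n0 rnorm_ge0.
rewrite -(ler_pM2r p) -expr2 -rinnervv rinner_starr; apply: le_trans (rinner_le _ _) _.
by rewrite ler_wpM2l ?rnorm_ge0 ?x_nm.
Qed.

(** * Descent from the eigenspace [s_(j+1) = 1] to [s_j = 1] *)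

Section VacuumStep.
Variable j : nat.
Hypotheses (jN : (j < N)%N) (Sinj : forall v, S j v = 0 -> v = 0).
Local Notation Hi v := (S j.+1 v = v).
Local Notation a := (X j.+1).
Local Notation a' := (Xs j.+1).
Local Notation s := (S j).

Let HiL (z : C) u v : Hi u -> Hi v -> Hi (z *: u + v).
Proof. by move=> hu hv; rewrite rep_vD rep_vZ hu hv. Qed.
Let Hi_a v : Hi v -> Hi (a v).
Proof. by move=> hv; rewrite -rep_M (sphere_sv_x_ge q0 hx) ?leqnn // rep_M hv. Qed.
Let Hi_s v : Hi v -> Hi (s v).
Proof. by move=> hv; rewrite -rep_M (sphere_sv_comm q0 hx) ?leqnSn // rep_M hv. Qed.
Let Hi_iter n v : Hi v -> Hi (iter n s v).
Proof. by move=> hv; elim: n => //= n IH; exact: Hi_s. Qed.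

(** On the eigenspace [a], [a'] and [s] satisfy the relations of a q-oscillator, with vacuum at
    [s = 1] and with [s] scaled by [c] under each creation [a']. *)
Let a'a v : Hi v -> a' (a v) = v - s v.
Proof. by move=> hv; rewrite -rep_M sphere_xstar_x_self repB hv. Qed.
Let aa' v : Hi v -> a (a' v) = v - c%:C *: s v.
Proof. by move=> hv; rewrite -rep_M (sphere_x_xstar_self hx) // repB hv repZ. Qed.
Let sa' v : s (a' v) = c%:C *: a' (s v).
Proof. by rewrite -!rep_M (sphere_sv_xstar_lt q0 hx) ?leqnn // repZ. Qed.
Let iter_sa' n v : iter n s (a' v) = (c ^+ n)%:C *: a' (iter n s v).
Proof.
elim: n => [|n IH]; first by rewrite expr0 rmorph1 scale1r.
by rewrite iterS IH rep_vZ sa' scalerA -rmorphM -exprSr.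
Qed.

Let iterB n u v : iter n s (u - v) = iter n s u - iter n s v.
Proof. by elim: n => //= n ->; rewrite rep_vB. Qed.

Let iter_nm n v : rnorm (iter n s v) <= rnorm v.
Proof. by elim: n => //= n IH; apply: le_trans IH; apply: sphere_sv_nm; exact: ltnW. Qed.

(** [v - s v = a' (a v)], and each [s] moved past [a'] costs a factor [c]; this is what makes the
    increments geometric. *)
Let step v n : Hi v -> iter n s v - iter n.+1 s v = (c ^+ n)%:C *: a' (iter n s (a v)).
Proof. by move=> hv; rewrite iterSr -iterB -a'a // iter_sa'. Qed.

Let step_nm v n : Hi v -> rnorm (iter n s v - iter n.+1 s v) <= c ^+ n * rnorm v.
Proof.
move=> hv; have /andP[c0 c1] := qV2_itv.
rewrite step // rnormZr ger0_norm ?exprn_ge0 ?(ltW c0) // ler_wpM2l ?exprn_ge0 ?(ltW c0) //.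
by apply: le_trans (xstar_nm _ jN) _; apply: le_trans (iter_nm _ _) _; exact: x_nm.
Qed.

Let limit_ex v : Hi v -> exists p, seq_cvg (fun n => iter n s v) p /\ s p = p.
Proof.
move=> hv; have /andP[c0 c1] := qV2_itv.
have d0 : 0 < 1 - c by rewrite subr_gt0.
(* Telescoping the increments gives the geometric sum [c^n + ... + c^(m-1)]. *)
have hd m n : (n <= m)%N ->
    rnorm (iter m s v - iter n s v) <= (c ^+ n - c ^+ m) / (1 - c) * rnorm v.
  move=> /subnK <-; elim: (m - n)%N => [|k IH]; first by rewrite !subrr rnorm0 !mul0r.
  rewrite addSn; set D := (k + n)%N in IH *.
  rewrite -(subrKA (iter D s v)); apply: le_trans (rnormD _ _) _.
  rewrite (rnormC (iter D.+1 s v)).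
  have -> : (c ^+ n - c ^+ D.+1) / (1 - c) * rnorm v =
    c ^+ D * rnorm v + (c ^+ n - c ^+ D) / (1 - c) * rnorm v.
    have gen (z y b t : R) : 1 - z != 0 ->
        (y - z * b) / (1 - z) * t = b * t + (y - b) / (1 - z) * t by move=> ?; field.
    by rewrite [c ^+ D.+1]exprS gen // gt_eqF.
  by rewrite lerD // step_nm.
have [p hp] : exists p, seq_cvg (fun n => iter n s v) p.
  apply: (@cauchy_cvs _ _ _ (fun n => c ^+ n / (1 - c) * rnorm v)).
    move=> m n nm_; apply: le_trans (hd _ _ nm_) _.
    rewrite ler_wpM2r ?rnorm_ge0 // ler_pM2r ?invr_gt0 // gerDl oppr_le0.
    by rewrite exprn_ge0 // ltW.
  move=> e e0; have v1 : 0 < rnorm v + 1 by rewrite ltr_wpDl ?rnorm_ge0.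
  have e1 : 0 < e * (1 - c) / (rnorm v + 1) by rewrite divr_gt0 // mulr_gt0.
  have [|m hm] := @exp_small R c _ _ e1; first by rewrite (ltW c0).
  exists m; move: hm; rewrite ltr_pdivlMr // -ltr_pdivrMr // mulrAC.
  apply: le_lt_trans; rewrite ler_wpM2l ?lerDl //.
  by rewrite divr_ge0 ?exprn_ge0 // ltW.
exists p; split=> //.
exact: seq_cvg_uniq (rep_cvs _ hp) (seq_cvg_shift hp).
Qed.

Lemma vacuum_step : (exists v, Hi v /\ v != 0) -> exists p, s p = p /\ p != 0.
Proof.
move=> [v0 [hv0 v00]]; apply: contrapT => nex.
have np p : s p = p -> p = 0.
  by move=> hp; apply/eqP; apply: contraT => p0; case: nex; exists p.
have /andP[c0 c1] := qV2_itv.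
have lim0 v : Hi v -> seq_cvg (fun n => iter n s v) 0.
  by move=> /limit_ex [p [hp /np <-]].
(* [v] is approximated by [v - s^n v], which telescopes into the image under [a'] of a vector of the
   eigenspace. *)
have dense_a' v (e : R) : Hi v -> 0 < e -> exists g, Hi g /\ rnorm (v - a' g) < e.
  move=> hv e0; have [n hn] := lim0 v hv e e0.
  have [g [hg eg]] : exists g, Hi g /\ v - iter n s v = a' g.
    elim: (n) => [|m [g [hg eg]]].
      exists 0; split; first by rewrite rep_v0.
      by rewrite subrr rep_v0.
    exists ((c ^+ m)%:C *: iter m s (a v) + g); split.
      by apply: HiL => //; exact/Hi_iter/Hi_a.
    by rewrite rep_vD rep_vZ -step // -eg [RHS]addrC subrKA.
  exists g; split=> //; rewrite -eg subKr.
  by have := hn n (leqnn n); rewrite subr0.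
(* If s <= rho on the eigenspace, then rho^2 (1 - c s) - (1 - c s) s^2 =
   (1 - c rho) (rho^2 - s^2) + c (rho - s)^2 (rho + s) >= 0, so s <= c rho on the dense
   range of a'; iterating gives s = 0. *)
have decay m : forall v, Hi v -> rnorm (s v) <= c ^+ m * rnorm v.
  elim: m => [|m IH] v hv; first by rewrite expr0 mul1r sphere_sv_nm // ltnW.
  set rho := c ^+ m in IH *.
  have rho0 : 0 <= rho by rewrite exprn_ge0 // ltW.
  have rho1 : rho <= 1 by rewrite exprn_ile1 // ltW.
  have key u : Hi u -> rnorm (s (a' u)) <= c * rho * rnorm (a' u).
    move=> hu; rewrite sa' rnormZr gtr0_norm // -mulrA ler_pM2l //.
    rewrite -ler_sqr ?nnegrE ?mulr_ge0 ?rnorm_ge0 // exprMn.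
    rewrite -!rinnervv !rinner_starr !aa' //; last exact: Hi_s.
    rewrite !rinnerBr !rinnerZr !rinnervv.
    have h1 := sphere_sv_ip_ge0 j (rho%:C *: u - s u).
    have h2 : rnorm (s u) ^+ 2 <= rho ^+ 2 * rnorm u ^+ 2.
      by rewrite -exprMn ler_sqr ?nnegrE ?mulr_ge0 ?rnorm_ge0 // IH.
    have h3 := rnorm_sqB (rho%:C *: u) (s u).
    have h4 := sqr_ge0 (rnorm (rho%:C *: u - s u)).
    move: h1 h3 h4; rewrite rep_vB rep_vZ rinnerBl !rinnerBr !rinnerZl !rinnerZr rnormZr ger0_norm //.
    rewrite (sphere_sv_sa j (s u) u) !rinnervv exprMn (rinnerC (s (s u))) (rinnerC (s u) u).
    move=> h1 h3 h4.
    set b := rinner u (s u) in h1 h3 *; set e := rinner (s u) (s (s u)) in h1 *.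
    set C0 := rnorm (s u) ^+ 2 in h1 h2 h3 *; set A0 := rnorm u ^+ 2 in h1 h2 h3 *.
    rewrite h3 in h4.
    (* [p1] and [p2] are the two summands of the identity above, evaluated at [u]. They add up to
       [rho^2 |a' u|^2 - |a' (s u)|^2], where [|a' u|^2 = A0 - c b] and
       [|a' (s u)|^2 = C0 - c e]. *)
    have p1 : 0 <= (1 - c * rho) * (rho ^+ 2 * A0 - C0).
      rewrite mulr_ge0 ?subr_ge0 //; apply: le_trans rho1.
      by rewrite ler_piMl // ltW.
    have p2 : 0 <= c * (rho * (rho ^+ 2 * A0 - 2 * (rho * b) + C0) +
       (rho * (rho * b) - rho * C0 - (rho * C0 - e))).
      rewrite mulr_ge0 ?(ltW c0) // addr_ge0 // ?mulr_ge0 //.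
    by move: p1 p2; lra.
  (* The bound passes from the range of [a'] to [v] by density: half of [e] pays for [s (v - a' g)],
     half for the excess of [|a' g|] over [|v|]. *)
  apply/ler_addgt0Pr => e e0.
  have e2 : 0 < e / 2 by rewrite divr_gt0.
  have [g [hg lt]] := dense_a' v _ hv e2.
  have := rnormD (s (v - a' g)) (s (a' g)); rewrite -rep_vD subrK.
  have h1 := sphere_sv_nm (v - a' g) (ltnW jN); have h2 := key g hg.
  have h3 : rnorm (a' g) <= rnorm v + e / 2.
    have := rnormD v (- (v - a' g)); rewrite rnormN opprB addrC subrK; lra.
  have h4 : c * rho * rnorm (a' g) <= c * rho * rnorm v + e / 2.
    apply: (@le_trans _ _ (c * rho * (rnorm v + e / 2))).
      by rewrite ler_wpM2l // mulr_ge0 // ltW.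
    rewrite mulrDr lerD2l ler_piMl ?(ltW e2) //.
    by apply: mulr_ile1 => //; exact: ltW.
  by rewrite [c ^+ m.+1]exprS -/rho; lra.
have s0 v : Hi v -> s v = 0.
  move=> hv; apply/eqP; rewrite -rnorm_eq0; apply/eqP/le_anti; rewrite rnorm_ge0 andbT.
  apply/ler_addgt0Pr => e e0; rewrite add0r.
  have v1 : 0 < rnorm v + 1 by rewrite ltr_wpDl ?rnorm_ge0.
  have [|m hm] := @exp_small R c _ _ (divr_gt0 e0 v1); first by rewrite (ltW c0).
  apply: le_trans (decay m v hv) _; move: hm; rewrite ltr_pdivlMr // => /ltW; apply: le_trans.
  by rewrite ler_wpM2l ?lerDl // exprn_ge0 // ltW.
by move: v00; rewrite (Sinj (s0 _ hv0)) eqxx.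
Qed.

End VacuumStep.
End SphereRep.

(** * Irreducible representations *)

Section EvenSphereGeneration.
Variables (R : realType) (q : R) (n : nat).
Local Notation A := (even_sphere q n).
Local Notation x := (even_x q n).

(** The induction carries [K] for a term and for its star at once, so that closure under star is
    asked of the generators only. *)
Lemma even_sphere_ind (K : A -> Prop) :
  K 0 -> K 1 -> (forall (c : R[i]) a, K a -> K (c *: a)) ->
  (forall a b, K a -> K b -> K (a + b)) -> (forall a b, K a -> K b -> K (a * b)) ->
  (forall i, (i <= n)%N -> K (x i) /\ K (star (x i))) -> forall a, K a.
Proof.
move=> K0 K1 KZ KD KM Kx.
have h (t : starTerm R (pres_gens (even_pres q n))) :
    K (Defs.eval (@pgen R (even_pres q n)) t) /\
    K (star (Defs.eval (@pgen R (even_pres q n)) t)).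
  elim: t => [i|||s [h1 h2] t [h3 h4]|s [h1 h2] t [h3 h4]|c t [h1 h2]|t [h1 h2]] /=.
  - have -> : pgen (P := even_pres q n) i = x i by rewrite /even_x /even_term inord_val.
    by apply: Kx; rewrite -ltnS.
  - by rewrite star0.
  - by rewrite star1.
  - by rewrite starD; split; apply: KD.
  - by rewrite starM; split; apply: KM.
  - by rewrite starZ; split; apply: KZ.
  - by rewrite starK.
elim/pclW => t; rewrite pcl_eval.
by have [] := h t.
Qed.

Lemma even_rep_stable (pi : starRep A) (V : set (rep_space pi)) : V 0 ->
  (forall (c : R[i]) u v, V u -> V v -> V (c *: u + v)) ->
  (forall i v, (i <= n)%N -> V v -> V (pi (x i) v) /\ V (pi (star (x i)) v)) ->
  forall a v, V v -> V (pi a v).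
Proof.
move=> V0 VL Vx; apply: even_sphere_ind.
- by move=> v _; rewrite rep0.
- by move=> v; rewrite rep_1.
- by move=> c a ha v hv; rewrite repZ -[_ *: _]addr0; apply: VL => //; exact: ha.
- move=> a b ha hb v hv; rewrite repD -[pi a v]scale1r; apply: VL; [exact: ha|exact: hb].
- by move=> a b ha hb v hv; rewrite rep_M; apply/ha/hb.
- by move=> i iN; split=> v hv; have [] := Vx i v iN hv.
Qed.

End EvenSphereGeneration.

Section VacuumSpace.
Variables (R : realType) (q : R) (hq : 1 < `|q|) (n : nat).
Local Notation A := (even_sphere q n).
Local Notation x := (even_x q n).
Variables (pi : starRep A) (irr : irreducible pi).
Local Notation H := (rep_space pi).
Local Notation C := R[i].
Local Notation X i := (pi (x i)).
Local Notation Xs i := (pi (star (x i))).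
Local Notation S i := (pi (sphere_sv x i)).
Local Notation c := (q ^- 2).
Implicit Types u v w : H.

Let q0 := q_neq0 hq.
Let hx : sphere_eqs q x n := even_sphere_eqs q n.

(** If all [x_i] acted by zero, so would the quadratic form of [s_n]; but [s_n = 1]. *)
Lemma first_nonzero : exists r, [/\ (r <= n)%N, forall i v, (i < r)%N -> X i v = 0 &
  exists v, X r v != 0].
Proof.
have [v0 v00] := irr.1.
have ex : exists r, `[< exists v, X r v != 0 >] && (r <= n)%N.
  apply: contrapT => nex; move: v00; rewrite -rnorm_eq0 -sqrf_eq0.
  have hX i v : (i <= n)%N -> X i v = 0.
    move=> iN; apply/eqP; apply: contraT => Xv; case: nex; exists i.
    by rewrite iN andbT; apply/asboolP; exists v.
  have hS i : (i <= n)%N -> rinner (S i v0) v0 = 0.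
    elim: i => [|i IH] iN; first by rewrite (sphere_sv_ip0 hx) hX // rnorm0 expr0n.
    by rewrite sphere_sv_ipS IH ?(ltnW iN) // hX // rnorm0 expr0n addr0.
  by rewrite -rinnervv -[Y in rinner Y _](rep_1 (s := pi)) -(sphere_sv_top hx) hS // eqxx.
case: (ex_minnP ex) => r /andP[/asboolP hr rN] hmin; exists r; split=> // i v ir.
apply/eqP; apply: contraT => Xv.
have hi : `[< exists v, X i v != 0 >] by apply/asboolP; exists v.
by have := hmin i; rewrite hi (leq_trans (ltnW ir) rN) => /(_ isT); rewrite leqNgt ir.
Qed.

Variable r : nat.
Hypotheses (rn : (r <= n)%N) (hlt : forall i v, (i < r)%N -> X i v = 0).
Hypothesis (hr : exists v, X r v != 0).

Lemma Xs_lt i v : (i < r)%N -> Xs i v = 0.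
Proof.
move=> ir; apply: inner_eq0_all => w; rewrite rep_starr.
by rewrite hlt // inner0r.
Qed.

Lemma sphere_sv_inj i v : (r <= i <= n)%N -> S i v = 0 -> v = 0.
Proof.
suff h w : S r w = 0 -> w = 0.
  (* The kernel of [S i] lies in that of [S r], because [|S r v|^2 <= <S r v, v> <= <S i v, v>]. *)
  move=> /andP[ri iN] e; apply: h; apply/eqP; rewrite -rnorm_eq0 -sqrf_eq0.
  rewrite eq_le sqr_ge0 andbT; apply: le_trans (sphere_sv_sq_le hx v rn) _.
  by apply: le_trans (sphere_sv_ip_mono x v ri) _; rewrite e rinner0l.
have [||||V0|VT] := irr.2 [set w | S r w = 0].
- have -> : [set w | S r w = 0] = [set w | S r w = pi 0 w].
    by apply/funext => y; rewrite /= rep0.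
  exact: closed_rep_eq.
- exact: rep_v0.
- by move=> z u y /= hu hy; rewrite rep_vD rep_vZ hu hy scaler0 addr0.
- apply: even_rep_stable => [|z u y /= hu hy|i1 y iN /= hy]; first exact: rep_v0.
    by rewrite rep_vD rep_vZ hu hy scaler0 addr0.
  rewrite -!rep_M; have [ir|ir] := leqP i1 r.
    by rewrite (sphere_sv_x_ge q0 hx) ?ir // (sphere_sv_xstar_ge q0 hx) ?ir // !rep_M hy !rep_v0.
  rewrite (sphere_sv_x_lt hx) ?ir // (sphere_sv_xstar_lt q0 hx) ?ir // !repZ !rep_M hy !rep_v0.
  by rewrite !scaler0.
- by move=> hw; have : [set w | S r w = 0] w by []; rewrite V0.
(* The kernel is not the whole space, since [|X r v0|^2 <= <S r v0, v0>] and [X r v0] is nonzero. *)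
have [v0] := hr; rewrite -rnorm_eq0 -sqrf_eq0 => /negP[]; rewrite eq_le sqr_ge0 andbT.
apply: le_trans (x_ip_le hx r v0) _.
have : [set w | S r w = 0] v0 by rewrite VT.
by move=> /= ->; rewrite rinner0l.
Qed.

Local Notation vac v := (S r v = v).

Lemma vacuum_exists : exists v, vac v /\ v != 0.
Proof.
have h m i : (r <= i)%N -> (i + m)%N = n -> exists v, S i v = v /\ v != 0.
  elim: m i => [|m IH] i ri.
    rewrite addn0 => ->; have [v v0] := irr.1; exists v.
    by rewrite (sphere_sv_top hx) rep_1.
  move=> im; have iN : (i < n)%N by rewrite -im addnS ltnS leq_addr.
  apply: (vacuum_step hq hx iN).
    by move=> v; apply: sphere_sv_inj; rewrite ri ltnW.
  by apply: IH; rewrite ?addSnnS // leqW.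
by apply: (h (n - r)%N); rewrite ?subnKC.
Qed.

(** As quadratic forms [S r <= S i <= 1], so [<S i v, v> = |v|^2] for a vacuum vector; with
    [|S i v|^2 <= <S i v, v>] this forces [|S i v - v|^2 <= 0]. *)
Lemma vac_S i v : vac v -> (r <= i <= n)%N -> S i v = v.
Proof.
move=> hv /andP[ri iN].
apply/eqP; rewrite -subr_eq0 -rnorm_eq0 -sqrf_eq0 eq_le sqr_ge0 andbT.
have h1 := sphere_sv_sq_le hx v iN; have h2 := sphere_sv_ip_mono x v ri; have h3 := sphere_sv_ip_le hx v iN.
rewrite rnorm_sqB; move: h2; rewrite hv rinnervv => h2.
by move: h1 h2 h3; rewrite -[rinner (S i v) v]rinnerC; lra.
Qed.

(** [|X i v|^2] is the difference of the forms of [s_i] and [s_(i-1)], both equal to [|v|^2] on the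
    vacuum. *)
Lemma vac_X i v : vac v -> (r < i <= n)%N -> X i v = 0.
Proof.
case: i => // i hv /andP[ri iN].
apply/eqP; rewrite -rnorm_eq0 -sqrf_eq0; apply/eqP.
have e1 : S i.+1 v = v by apply: vac_S; rewrite // (ltnW ri) iN.
have e2 : S i v = v by apply: vac_S; rewrite // (ltnW iN) andbT.
by have := sphere_sv_ipS x i v; rewrite e1 e2; lra.
Qed.

Lemma sphere_sv_XsX v : S r v = Xs r (X r v).
Proof.
have S0 i : (i < r)%N -> S i v = 0.
  elim: i => [|i IH] ir; first by rewrite rep_M hlt // rep_v0.
  by rewrite repD IH ?(ltnW ir) // rep_M hlt // rep_v0 addr0.
case er : r => [|r']; first by rewrite rep_M (sphere_star_x0 hx).
by rewrite repD S0 ?er // add0r rep_M.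
Qed.

(** For [r > 0] the commutator relation gives [s_r - q^-2 s_(r-1)], whose second term acts by zero;
    for [r = 0] the generator is self-adjoint. With [sphere_sv_XsX] this makes [x_r] normal on the
    whole space. *)
Lemma sphere_sv_XXs v : S r v = X r (Xs r v).
Proof.
have S0 i : (i < r)%N -> S i v = 0.
  elim: i => [|i IH] ir; first by rewrite rep_M hlt // rep_v0.
  by rewrite repD IH ?(ltnW ir) // rep_M hlt // rep_v0 addr0.
case er : r => [|r']; first by rewrite rep_M (sphere_star_x0 hx).
have e0 : S r' v = 0 by apply: S0; rewrite er.
by rewrite -rep_M (sphere_x_xstar_self hx) -?er // repB repZ e0 scaler0 subr0.
Qed.

Lemma sphere_sv_X v : S r (X r v) = X r (S r v).
Proof. by rewrite -!rep_M (sphere_sv_x_ge q0 hx) ?leqnn. Qed.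
Lemma sphere_sv_Xs v : S r (Xs r v) = Xs r (S r v).
Proof. by rewrite -!rep_M (sphere_sv_xstar_ge q0 hx) ?leqnn. Qed.

Lemma X_r_normal v : X r (Xs r v) = Xs r (X r v).
Proof. by rewrite -sphere_sv_XXs sphere_sv_XsX. Qed.

(** * Words in the creation operators, applied to vacuum vectors *)

Section Words.
Variable d : nat.
Hypothesis rd : (r + d)%N = n.
Local Notation I := {ffun 'I_d -> nat}.
Implicit Types (k l : I) (j : 'I_d).

Local Notation Xj j := (X (r.+1 + nat_of_ord j)).
Local Notation Xsj j := (Xs (r.+1 + nat_of_ord j)).

Let jn j : (r.+1 + j <= n)%N.
Proof. by rewrite -rd addSn -addnS leq_add2l. Qed.
Let rj j : (r < r.+1 + j)%N.
Proof. by rewrite addSn ltnS leq_addr. Qed.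

(* The operators with small index act first: moving x_(r+1+j)^* inwards to its place then
   produces exactly the factor q^-(tail k j). *)
Definition word_on (s : seq 'I_d) k u := foldl (fun u j => iter (k j) (Xsj j) u) u s.
Definition word k u := word_on (enum 'I_d) k u.

Lemma iter_Xs_linear m j (z : C) u v :
  iter m (Xsj j) (z *: u + v) = z *: iter m (Xsj j) u + iter m (Xsj j) v.
Proof. by elim: m => //= m ->; rewrite rep_vD rep_vZ. Qed.

Lemma word_on_linear s k (z : C) u v :
  word_on s k (z *: u + v) = z *: word_on s k u + word_on s k v.
Proof. by elim: s u v => //= j s IH u v; rewrite iter_Xs_linear IH. Qed.

Lemma word_on0 s k : word_on s k 0 = 0.
Proof.
by have := word_on_linear s k (-1) 0 0; rewrite scaler0 addr0 scaleN1r addNr.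
Qed.
Lemma word_onZ s k (z : C) u : word_on s k (z *: u) = z *: word_on s k u.
Proof. by have := word_on_linear s k z u 0; rewrite word_on0 !addr0. Qed.
Lemma wordZ k (z : C) u : word k (z *: u) = z *: word k u.
Proof. exact: word_onZ. Qed.

Lemma word_zero u : word [ffun=> 0%N] u = u.
Proof. by rewrite /word; elim: (enum _) u => //= j s IH u; rewrite ffunE. Qed.

Lemma word_comm (a : A) (z : 'I_d -> C) s k u :
  (forall j w, j \in s -> pi a (Xsj j w) = z j *: Xsj j (pi a w)) ->
  pi a (word_on s k u) = (\prod_(j <- s) z j ^+ k j) *: word_on s k (pi a u).
Proof.
elim: s u => [|j s IH] u h; first by rewrite big_nil scale1r.
rewrite big_cons /= IH => [|i w si]; last by apply: h; rewrite inE si orbT.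
have -> : pi a (iter (k j) (Xsj j) u) = z j ^+ k j *: iter (k j) (Xsj j) (pi a u).
  elim: (k j) => [|m IHm] /=; first by rewrite scale1r.
  by rewrite h ?mem_head // IHm rep_vZ scalerA -exprS.
by rewrite word_onZ scalerA mulrC.
Qed.

Lemma prod_cexp s k (z : C) (P : pred 'I_d) :
  \prod_(j <- s) (if P j then z else 1) ^+ k j = z ^+ (\sum_(j <- s | P j) k j)%N.
Proof.
elim: s => [|j s IH]; first by rewrite !big_nil.
by rewrite !big_cons IH; case: (P j); rewrite ?exprD // expr1n mul1r.
Qed.

Lemma word_comm_if (a : A) (z : C) (P : pred 'I_d) s k u :
  (forall j w, j \in s -> pi a (Xsj j w) = (if P j then z else 1) *: Xsj j (pi a w)) ->
  pi a (word_on s k u) = z ^+ (\sum_(j <- s | P j) k j)%N *: word_on s k (pi a u).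
Proof. by move=> h; rewrite (word_comm k u h); congr (_ *: _); exact: prod_cexp. Qed.

Let QiV m : (q^-1%:C : C) ^+ m = (q ^- m)%:C.
Proof. by rewrite -rmorphXn exprVn. Qed.

Lemma word_on_Xs s k j u : all (fun l : 'I_d => (j < l)%N) s ->
  Xsj j (word_on s k u) = (q ^- (\sum_(l <- s) k l)%N)%:C *: word_on s k (Xsj j u).
Proof.
move=> /allP h; rewrite (@word_comm_if _ q^-1%:C xpredT) ?QiV //.
move=> l w /h jl; rewrite -!rep_M (sphere_xstar_xstar q0 hx) ?repZ //.
by rewrite ltn_add2l jl jn.
Qed.

Lemma word_on_raise_notin s k j u : j \notin s -> word_on s (raise k j) u = word_on s k u.
Proof.
elim: s u => //= l s IH u; rewrite inE negb_or => /andP[jl js].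
by rewrite raiseE eq_sym (negbTE jl) IH.
Qed.

Lemma word_on_raise s k j u : sorted (fun i l : 'I_d => (i < l)%N) s -> j \in s ->
  Xsj j (word_on s k u) =
    (q ^- (\sum_(l <- s | (j < l)%N) k l)%N)%:C *: word_on s (raise k j) u.
Proof.
elim: s u => // l s IH u /= hp.
have tr : transitive (fun i l : 'I_d => (i < l)%N) by move=> a b e; exact: ltn_trans.
have hall : all (fun i : 'I_d => (l < i)%N) s by exact: order_path_min hp.
rewrite inE big_cons; case: eqVneq => [->|jl] /= js.
  rewrite ltnn word_on_Xs // raiseE eqxx -iterS word_on_raise_notin; last first.
    by apply/negP => /(allP hall); rewrite ltnn.
  congr ((q ^- _)%:C *: _); rewrite big_seq [RHS]big_seq_cond.
  apply: eq_bigl => i; case si : (i \in s) => //=.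
  by rewrite (allP hall).
have lj : (l < j)%N by exact: (allP hall).
rewrite ltnNge (ltnW lj) /= IH //; last exact: path_sorted hp.
by rewrite raiseE eq_sym (negbTE jl).
Qed.

Lemma word_raise k j u :
  Xsj j (word k u) = (q ^- tail k j)%:C *: word (raise k j) u.
Proof.
rewrite /word word_on_raise ?mem_enum //; last first.
  have := iota_ltn_sorted 0 d; rewrite -val_enum_ord.
  by rewrite sorted_map.
by rewrite big_enum_cond.
Qed.

Lemma word_raise' k j u :
  word (raise k j) u = (q ^+ tail k j)%:C *: Xsj j (word k u).
Proof.
rewrite word_raise scalerA -rmorphM divff ?scale1r //.
by rewrite expf_neq0.
Qed.

(** Each letter with [j >= m] contributes a factor [q^-2] and the other letters commute with
    [s_(r+m)]. The joint eigenvalues separate the multi-indices, whence the orthogonality of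
    words. *)
Lemma word_S m k v : vac v -> (m <= d)%N ->
  S (r + m) (word k v) = (q ^- (2 * tailn k m))%:C *: word k v.
Proof.
move=> hv md; have rmn : (r + m <= n)%N by rewrite -rd leq_add2l.
rewrite (@word_comm_if _ c%:C (fun j => m <= j)%N) => [|j w _].
  rewrite vac_S ?leq_addr ?rmn // big_enum_cond /= -rmorphXn /=.
  by rewrite -/(tailn k m) exprVn -exprM.
rewrite -!rep_M; case: leqP => mj.
  by rewrite (sphere_sv_xstar_lt q0 hx) ?repZ // addSn ltnS leq_add2l mj -addSn jn.
by rewrite scale1r (sphere_sv_xstar_ge q0 hx) // addSn -addnS leq_add2l mj rmn.
Qed.

Lemma word_X_r k u : X r (word k u) = (q ^- Defs.total k)%:C *: word k (X r u).
Proof.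
rewrite (@word_comm_if _ q^-1%:C xpredT) => [|j w _]; first by rewrite QiV big_enum.
by rewrite -!rep_M (sphere_x_xstar q0 hx) ?repZ ?rn ?jn // neq_ltn rj.
Qed.

Lemma word_Xs_r k u : Xs r (word k u) = (q ^- Defs.total k)%:C *: word k (Xs r u).
Proof.
rewrite (@word_comm_if _ q^-1%:C xpredT) => [|j w _]; first by rewrite QiV big_enum.
by rewrite -!rep_M (sphere_xstar_xstar q0 hx) ?repZ ?rj ?jn.
Qed.

(** The squared norm is the difference of the forms of [s_(r+j+1)] and [s_(r+j)] on the word, and
    for [k j = 0] the two eigenvalues agree. *)
Lemma word_X_zero k j v : vac v -> k j = 0%N -> Xj j (word k v) = 0.
Proof.
move=> hv kj; apply/eqP; rewrite -rnorm_eq0 -sqrf_eq0; apply/eqP.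
have e1 := word_S k (m := j) hv (ltnW (ltn_ord j)).
have e2 := word_S k (m := j.+1) hv (ltn_ord j).
have := sphere_sv_ipS x (r + j) (word k v).
rewrite addnS in e2; rewrite e1 e2 tailnS kj add0n addSn.
by lra.
Qed.

Lemma word_X_raise k j v : vac v ->
  Xj j (word (raise k j) v) = (q ^- tail k j * (1 - q ^- (2 * (k j).+1)))%:C *: word k v.
Proof.
move=> hv; rewrite word_raise' rep_vZ -rep_M.
(* The product is a combination of two of the [s_i], of which the word is an eigenvector, so it acts
   by a scalar. *)
have -> : x (r.+1 + j) * star (x (r.+1 + j)) =
    sphere_sv x (r + j.+1) - c%:C *: sphere_sv x (r + j).
  by rewrite addSn addnS (sphere_x_xstar_self hx) // -rd ltn_add2l.
have e1 := word_S k (m := j) hv (ltnW (ltn_ord j)).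
have e2 := word_S k (m := j.+1) hv (ltn_ord j).
rewrite repB repZ e1 e2 scalerA -scalerBl scalerA.
congr (_ *: _); rewrite -rmorphM -rmorphB -rmorphM; congr (_%:C).
rewrite tailnS -tailE (qV2D q (k j)) (qV2D q 1 (k j)) (qV2 q (tail k j)).
have tq : q ^+ tail k j * q ^- tail k j = 1 by rewrite divff // expf_neq0.
rewrite expr2; set t := q ^- tail k j in tq *; set T := q ^+ tail k j in tq *.
have -> : T * (t * t - c * (q ^- (2 * k j) * (t * t))) =
  (T * t) * (t * (1 - c * q ^- (2 * k j))) by ring.
by rewrite tq mul1r.
Qed.

Lemma word_inner_raise k j u v : vac u -> vac v ->
  inner (word (raise k j) u) (word (raise k j) v) =
    (1 - q ^- (2 * (k j).+1))%:C * inner (word k u) (word k v).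
Proof.
move=> hu hv; rewrite {1}word_raise' innerZl rep_starr word_X_raise // innerZr.
rewrite mulrA; congr (_ * _); rewrite conjC_real -rmorphM; congr (_%:C).
by rewrite mulrA divff ?mul1r // expf_neq0.
Qed.

Lemma word_orthogonal k l u v : vac u -> vac v -> k != l -> inner (word k u) (word l v) = 0.
Proof.
move=> hu hv kl.
(* A multi-index is recovered from its tails as their successive differences, so some tail must
   differ. *)
have [m [md hm]] : exists m, (m <= d)%N /\ tailn k m != tailn l m.
  apply: contrapT => nex; move: kl; apply/negP/negPn/eqP/ffunP => j.
  have h m : (m <= d)%N -> tailn k m = tailn l m.
    by move=> md; apply/eqP; apply: contraT => e; case: nex; exists m.
  have := h j (ltnW (ltn_ord j)); rewrite !tailnS (h j.+1) // => /eqP.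
  by rewrite eqn_add2r => /eqP.
have e : inner (S (r + m) (word k u)) (word l v) = inner (word k u) (S (r + m) (word l v)).
  by rewrite rep_star (sphere_sv_star hx).
move: e; rewrite (word_S k hu md) (word_S l hv md) innerZl innerZr conjC_real => /eqP.
rewrite -subr_eq0 -mulrBl mulf_eq0 => /orP[|/eqP //].
rewrite -rmorphB => /eqP/complexI/eqP; rewrite subr_eq0 => /eqP/invr_inj e.
exfalso; move: hm; rewrite neq_ltn => /orP[] lt.
- have : `|q ^+ (2 * tailn k m)| < `|q ^+ (2 * tailn l m)|.
    by rewrite !normrX ltr_eXn2l // ltn_pmul2l.
  by rewrite e ltxx.
- have : `|q ^+ (2 * tailn l m)| < `|q ^+ (2 * tailn k m)|.
    by rewrite !normrX ltr_eXn2l // ltn_pmul2l.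
  by rewrite e ltxx.
Qed.

(** The outermost creation operator of a nonempty word moves to [v] as an annihilation operator and
    kills it. Orthogonality inside the vacuum space thus propagates to the invariant subspace
    generated by [u]. *)
Lemma word_vacuum_orthogonal k u v : vac v -> inner u v = 0 -> inner (word k u) v = 0.
Proof.
move=> hv uv; elim/multi_ind: k => [|k j _]; first by rewrite word_zero.
by rewrite word_raise' innerZl rep_starr vac_X ?rj ?jn // inner0r mulr0.
Qed.

Lemma word_nm_raise k j v : vac v ->
  rnorm (word (raise k j) v) = Num.sqrt (1 - q ^- (2 * (k j).+1)) * rnorm (word k v).
Proof.
move=> hv; apply/eqP; rewrite -(@eqrXn2 _ 2) ?mulr_ge0 ?rnorm_ge0 ?sqrtr_ge0 //; apply/eqP.
rewrite exprMn sqrt_1q2 // -!rinnervv.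
by rewrite /rinner word_inner_raise // ReZ.
Qed.

Lemma word_neq0 k v : vac v -> v != 0 -> 0 < rnorm (word k v).
Proof.
move=> hv v0; elim/multi_ind: k => [|k j IH].
  by rewrite word_zero lt_def rnorm_eq0 v0 rnorm_ge0.
by rewrite word_nm_raise // mulr_gt0 // sqrtr_gt0 subr_gt0 qV2_lt1.
Qed.

(** Under the hypotheses of [WordSpan] this is the invariant subspace generated by [F], before
    taking the closure. *)
Definition word_span (F : set H) : set H := [set w | exists s : seq (I * H),
  (forall p, p \in s -> F p.2) /\ w = \sum_(p <- s) word p.1 p.2].

Section WordSpan.
Variable F : set H.
Hypotheses (F0 : F 0) (FL : forall (z : C) u v, F u -> F v -> F (z *: u + v)).
Hypothesis FX : forall v, F v -> F (X r v) /\ F (Xs r v).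
Hypothesis Fvac : forall v, F v -> vac v.

Lemma word_span_word k v : F v -> word_span F (word k v).
Proof.
move=> Fv; exists [:: (k, v)]; split; last by rewrite big_seq1.
by move=> p; rewrite inE => /eqP ->.
Qed.

Lemma word_span0 : word_span F 0.
Proof. by exists [::]; split=> //; rewrite big_nil. Qed.

Lemma word_span_linear (z : C) u v : word_span F u -> word_span F v -> word_span F (z *: u + v).
Proof.
move=> [s [Fs ->]] [t [Ft ->]].
exists (map (fun p => (p.1, z *: p.2)) s ++ t); split.
  move=> p; rewrite mem_cat => /orP[/mapP[p' /Fs Fp ->] /=|/Ft //].
  by rewrite -[_ *: _]addr0; exact: FL.
rewrite big_cat big_map scaler_sumr; congr (_ + _).
by apply: eq_bigr => p _ /=; rewrite wordZ.
Qed.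

Lemma word_span_op (a : A) : (forall k v, F v -> word_span F (pi a (word k v))) ->
  forall w, word_span F w -> word_span F (pi a w).
Proof.
move=> ha _ [s [Fs ->]]; elim: s Fs => [|p s IH] Fs.
  by rewrite big_nil rep_v0; exact: word_span0.
rewrite big_cons rep_vD -[pi a (word _ _)]scale1r; apply: word_span_linear.
  by apply/ha/Fs; exact: mem_head.
by apply: IH => t ts; apply: Fs; rewrite inE ts orbT.
Qed.

(** Up to scalars, [x_(r+1+j)] lowers a word and its adjoint raises it, while [x_r] and its adjoint
    pass through to the vacuum vector; hence the stability required of [F]. *)
Lemma word_span_stable a w : word_span F w -> word_span F (pi a w).
Proof.
have Z (z : C) k v : F v -> word_span F (z *: word k v).
  by move=> Fv; rewrite -wordZ; apply: word_span_word; rewrite -[_ *: _]addr0; exact: FL.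
move: a w; apply: even_rep_stable; first exact: word_span0.
  exact: word_span_linear.
move=> i v iN hv; case: (ltngtP i r) => ir.
- by rewrite hlt // Xs_lt //; split; exact: word_span0.
- have [j ->] : exists j : 'I_d, i = (r.+1 + j)%N.
    have jd : (i - r.+1 < d)%N by rewrite ltn_subLR // addSn rd ltnS.
    by exists (Ordinal jd); rewrite /= subnKC.
  split; apply: word_span_op hv => k u Fu.
    have [kj|kj] := posnP (k j).
      by rewrite word_X_zero //; [exact: word_span0|exact: Fvac].
    by rewrite -(raise_lower kj) word_X_raise; [exact: Z|exact: Fvac].
  by rewrite word_raise; exact: Z.
- rewrite ir; split; apply: word_span_op hv => k u Fu.
    by rewrite word_X_r; apply: Z; have [] := FX Fu.
  by rewrite word_Xs_r; apply: Z; have [] := FX Fu.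
Qed.

Lemma word_span_dense : (exists v, F v /\ v != 0) -> closure (word_span F) = setT.
Proof.
move=> [v [Fv v0]]; apply: irreducible_closure => //.
- exact: word_span0.
- exact: word_span_linear.
- by move=> a w; exact: word_span_stable.
- by exists v; split=> //; rewrite -(word_zero v); exact: word_span_word.
Qed.

End WordSpan.
End Words.
End VacuumSpace.

Section VacuumScalar.
Variables (R : realType) (q : R) (hq : 1 < `|q|) (n : nat).
Local Notation A := (even_sphere q n).
Local Notation x := (even_x q n).
Variables (pi : starRep A) (irr : irreducible pi).
Local Notation H := (rep_space pi).
Local Notation C := R[i].
Variables (r d : nat).
Local Notation X i := (pi (x i)).
Local Notation Xs i := (pi (star (x i))).
Local Notation S i := (pi (sphere_sv x i)).
Local Notation vac v := (S r v = v).
Implicit Types u v w : H.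
Hypotheses (rd : (r + d)%N = n) (hlt : forall i v, (i < r)%N -> X i v = 0).

Let hx : sphere_eqs q x n := even_sphere_eqs q n.
Let rn : (r <= n)%N. Proof. by rewrite -rd leq_addr. Qed.

Section Dichotomy.
Variable h : A.
Hypotheses (sh : star h = h) (nh : forall v, rnorm (pi h v) <= rnorm v).
Hypothesis hX : forall v, X r (pi h v) = pi h (X r v).
Hypothesis hXs : forall v, Xs r (pi h v) = pi h (Xs r v).

Let hS v : S r (pi h v) = pi h (S r v).
Proof. by rewrite !(sphere_sv_XsX hlt) hX hXs. Qed.

(* With |h| the absolute value of h, the vectors (|h| + h) v and (|h| - h) v are
   orthogonal for v in the vacuum space, and the invariant subspaces they generate
   remain orthogonal, so that by irreducibility one of the two families vanishes. *)
Lemma vacuum_dichotomy : (forall v, vac v -> 0 <= rinner (pi h v) v) \/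
  (forall v, vac v -> rinner (pi h v) v <= 0).
Proof.
have [T [TL TT Tpos Tsa Tc]] := rep_abs sh nh.
have Th v : T (pi h v) = pi h (T v) by rewrite -Tc.
have hsa u v : inner (pi h u) v = inner u (pi h v) by rewrite rep_star sh.
pose f v := T v + pi h v; pose g v := T v - pi h v.
have TD u v : T (u + v) = T u + T v by have := TL 1 u v; rewrite !scale1r.
(* [(|h| + h) (|h| - h) = |h|^2 - h^2 = 0], as [|h|] commutes with [h]. *)
have fg v : f (g v) = 0.
  have TB u w : T (u - w) = T u - T w.
    by rewrite addrC -scaleN1r TL scaleN1r addrC.
  by rewrite /f /g TB rep_vB Th TT addrC subrKA subrr.
have fvac v : vac v -> vac (f v).
  by move=> hv; rewrite rep_vD hS hv Tc ?hv // => w; exact: hS.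
have gvac v : vac v -> vac (g v).
  by move=> hv; rewrite rep_vB hS hv Tc ?hv // => w; exact: hS.
have [[v0 [hv0 f0]]|nf] := pselect (exists v, vac v /\ f v != 0); last first.
  right=> v hv; have -> : pi h v = - T v.
    apply/eqP; rewrite -addr_eq0 addrC; apply: contraT => fv; case: nf.
    by exists v.
  by rewrite rinnerNl oppr_le0.
left=> v hv; suff gv : g v = 0.
  by have -> : pi h v = T v by apply/esym/eqP; rewrite -subr_eq0 -/(g v) gv.
pose F := [set w | exists u, vac u /\ w = f u].
have dF : closure (word_span r d F) = setT.
  apply: (word_span_dense hq irr rn hlt rd).
  - exists 0; rewrite !rep_v0; split=> //; rewrite /f rep_v0 addr0.
    by have := TL (-1) 0 0; rewrite scaler0 addr0 scaleN1r addNr.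
  - move=> z _ _ [u1 [h1 ->]] [u2 [h2 ->]]; exists (z *: u1 + u2).
    by rewrite rep_vD rep_vZ h1 h2 /f TL rep_vD rep_vZ scalerDr addrACA.
  - move=> _ [u [hu ->]]; split.
      exists (X r u); split; first by rewrite (sphere_sv_X hq rn) hu.
      by rewrite /f rep_vD Tc // hX.
    exists (Xs r u); split; first by rewrite (sphere_sv_Xs hq rn) hu.
    by rewrite /f rep_vD Tc // hXs.
  - by move=> _ [u [hu ->]]; exact: fvac.
  - by exists (f v0); split=> //; exists v0.
apply: inner_eq0_all => w.
have : closure (word_span r d F) `<=` [set w | inner (g v) w = 0].
  apply: (subset_trans _ (@closed_ortho _ _ (g v))).
  apply: closure_subset => _ [s [Fs ->]] /=.
  elim: s Fs => [|p s IH] Fs; first by rewrite big_nil inner0r.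
  rewrite big_cons innerDr IH ?addr0; last by move=> t ts; apply: Fs; rewrite inE ts orbT.
  have [u [hu ->]] := Fs p (mem_head _ _).
  rewrite innerC (word_vacuum_orthogonal hq rd) ?rmorph0 //; first exact: gvac.
  by rewrite /f innerDl Tsa hsa -innerDr -/(f (g v)) fg inner0r.
by rewrite dF => /(_ w); apply.
Qed.

End Dichotomy.

(** The dichotomy for [h - t], with [t] any real, makes [t] a lower or an upper bound of the form of
    [h] on unit vacuum vectors; so the supremum of the lower bounds is also an upper bound. A
    self-adjoint operator whose form vanishes is zero. *)
Lemma vacuum_scalar (h : A) : star h = h -> (forall v, rnorm (pi h v) <= rnorm v) ->
  (forall v, X r (pi h v) = pi h (X r v)) ->
  (forall v, Xs r (pi h v) = pi h (Xs r v)) ->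
  (exists v, vac v /\ v != 0) ->
  exists c : R, forall v, vac v -> pi h v = c%:C *: v.
Proof.
move=> sh nh hX hXs [v0 [hv0 v00]].
have hS v : S r (pi h v) = pi h (S r v) by rewrite !(sphere_sv_XsX hlt) hX hXs.
have alt (t : R) : (forall v, vac v -> t * rnorm v ^+ 2 <= rinner (pi h v) v) \/
    (forall v, vac v -> rinner (pi h v) v <= t * rnorm v ^+ 2).
  have t1 : 0 < 1 + `|t| by rewrite ltr_pwDl.
  (* Division by [1 + |t|] restores contractivity, which [vacuum_dichotomy] requires, and keeps
     signs. *)
  pose ht : A := ((1 + `|t|)^-1)%:C *: (h - t%:C *: 1).
  have hE v : pi ht v = ((1 + `|t|)^-1)%:C *: (pi h v - t%:C *: v).
    by rewrite repZ repB repZ rep_1.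
  have ipE v : rinner (pi ht v) v = (1 + `|t|)^-1 * (rinner (pi h v) v - t * rnorm v ^+ 2).
    by rewrite hE rinnerZl rinnerBl rinnerZl rinnervv.
  have [|v|v|v|hp|hp] := @vacuum_dichotomy ht.
  - by rewrite starZ conjC_real -scaleN1r starD sh !starZ star1 conjC_real rmorphN rmorph1.
  - rewrite hE rnormZr gtr0_norm ?invr_gt0 // mulrC ler_pdivrMr //.
    apply: le_trans (rnormD _ _) _; rewrite rnormN rnormZr mulrDr mulr1 [rnorm v * _]mulrC.
    by rewrite lerD.
  - by rewrite !hE !(rep_vZ, rep_vB) hX.
  - by rewrite !hE !(rep_vZ, rep_vB) hXs.
  - left=> v hv; rewrite -subr_ge0; have := hp v hv; by rewrite ipE pmulr_rge0 // invr_gt0.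
  - right=> v hv; rewrite -subr_le0; have := hp v hv; by rewrite ipE pmulr_rle0 // invr_gt0.
have habs v : `|rinner (pi h v) v| <= rnorm v ^+ 2.
  rewrite ler_norml; apply/andP; split.
    have := rinner_le (- pi h v) v; rewrite rnormN rinnerNl => le.
    have : rnorm (pi h v) * rnorm v <= rnorm v ^+ 2 by rewrite expr2 ler_wpM2r ?rnorm_ge0.
    by lra.
  by apply: le_trans (rinner_le _ _) _; rewrite expr2 ler_wpM2r ?rnorm_ge0.
(* Contractivity puts -1 in [E], and the nonzero vacuum vector [v0] bounds [E] by 1; without such a
   vector [E] would be all of [R]. *)
pose E := [set t : R | forall v, vac v -> t * rnorm v ^+ 2 <= rinner (pi h v) v].
have pos v : v != 0 -> 0 < rnorm v ^+ 2.
  by move=> vn; rewrite exprn_gt0 // lt_def rnorm_eq0 vn rnorm_ge0.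
have Es : has_sup E.
  split; first by exists (-1) => v hv; have := habs v; rewrite ler_norml => /andP[]; lra.
  exists 1 => t /(_ v0 hv0) le; have := habs v0; rewrite ler_norml => /andP[_ le2].
  by rewrite -(ler_pM2r (pos _ v00)) mul1r; apply: le_trans le le2.
pose cc := sup E; exists cc.
have lo v : vac v -> cc * rnorm v ^+ 2 <= rinner (pi h v) v.
  move=> hv; have [->|vn] := eqVneq v 0; first by rewrite rnorm0 expr0n mulr0 rep_v0 rinner0l.
  rewrite -ler_pdivlMr ?pos //; apply: ge_sup; first by case: Es.
  by move=> t /(_ v hv); rewrite -ler_pdivlMr ?pos.
have hi v : vac v -> rinner (pi h v) v <= cc * rnorm v ^+ 2.
  move=> hv; have [->|vn] := eqVneq v 0; first by rewrite rnorm0 expr0n mulr0 rep_v0 rinner0l.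
  rewrite -ler_pdivrMr ?pos //; apply/ler_addgt0Pr => e e0.
  case: (alt (cc + e)) => [hE|hE]; last by rewrite ler_pdivrMr ?pos // hE.
  have : cc + e <= cc by apply: sup_upper_bound.
  by lra.
have [D DE] : exists D : H -> H, forall v, D v = pi h v - cc%:C *: v.
  by exists (fun v => pi h v - cc%:C *: v).
have Dvac v : vac v -> vac (D v) by move=> hv; rewrite DE rep_vB rep_vZ hS hv.
have D0 v : vac v -> rinner (D v) v = 0.
  move=> hv; rewrite DE rinnerBl rinnerZl rinnervv; apply/eqP; rewrite subr_eq0 eq_le lo // andbT.
  exact: hi.
have DD u v : D (u + v) = D u + D v.
  by rewrite !DE rep_vD scalerDr opprD addrACA.
have Dsa u v : rinner (D u) v = rinner u (D v).
  by rewrite !DE rinnerBl rinnerBr rinner_star sh rinnerZl rinnerZr.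
move=> v hv; apply/eqP; rewrite -subr_eq0 -DE -rnorm_eq0 -sqrf_eq0 -rinnervv.
have hDv := Dvac v hv.
(* Evaluated at [v + D v], the vanishing form leaves only the cross terms, which are [2 |D v|^2]. *)
have hvv : vac (v + D v) by rewrite rep_vD hv hDv.
have := D0 _ hvv; rewrite DD rinnerDl !rinnerDr (Dsa (D v) v) (D0 v hv) (D0 _ hDv) => e.
by apply/eqP; lra.
Qed.

(** [x_r] is normal, so its real and imaginary parts commute with it and are scalars on the vacuum.
    The modulus is 1 because [x_r^* x_r = s_r] is the identity there; at [r = 0] self-adjointness
    makes [lambda] real. *)
Lemma vacuum_eigenvalue : (exists v, X r v != 0) -> exists lambda : C,
  [/\ `|lambda| = 1, r = 0%N -> Num.conj lambda = lambda &
      forall v, vac v -> X r v = lambda *: v].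
Proof.
move=> hr; have vex := vacuum_exists hq irr rn hr.
have nX v : rnorm (X r v) <= rnorm v by exact: (x_nm hx v rn).
have nXs v : rnorm (Xs r v) <= rnorm v by exact: (xstar_nm hx v rn).
have XXs v : X r (Xs r v) = Xs r (X r v) by exact: (X_r_normal rn hlt).
pose half : C := (2^-1)%:C.
pose hre : A := half *: (x r + star (x r)).
(* The factor is [1 / (2 i)], so that [x r = hre + 'i *: him]. *)
pose him : A := (half * - 'i) *: (x r - star (x r)).
have reE v : pi hre v = half *: (X r v + Xs r v) by rewrite repZ repD.
have imE v : pi him v = (half * - 'i) *: (X r v - Xs r v) by rewrite repZ repB.
have n1 : `|half * - 'i| = half.
  rewrite normrM normrN [`|'i|]normc_def /= expr0n expr1n add0r sqrtr1 mulr1.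
  by rewrite ger0_norm // ler0c invr_ge0.
have [|v|v|v||c1 h1] := @vacuum_scalar hre.
- by rewrite starZ conjC_real starD starK addrC.
- rewrite reE rnormZr ger0_norm ?invr_ge0 // mulrC ler_pdivrMr //.
  by apply: le_trans (rnormD _ _) _; have := nX v; have := nXs v; lra.
- by rewrite !reE rep_vZ rep_vD XXs.
- by rewrite !reE rep_vZ rep_vD XXs.
- exact: vex.
have [|v|v|v||c2 h2] := @vacuum_scalar him.
- rewrite starZ -[x r - _]addrC starD -scaleN1r starZ starK rmorphN rmorph1 scaleN1r.
  have -> : Num.conj (half * - 'i) = - (half * - 'i).
    rewrite rmorphM -mulrN; congr (_ * _); first exact: conjC_real.
    by apply/eqP; rewrite eq_complex /= !oppr0 opprK !eqxx.
  by rewrite scaleNr -scalerN opprD opprK.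
- rewrite imE rnormZ n1 /= mulrC ler_pdivrMr //.
  by apply: le_trans (rnormD _ _) _; rewrite rnormN; have := nX v; have := nXs v; lra.
- by rewrite !imE rep_vZ rep_vB XXs.
- by rewrite !imE rep_vZ rep_vB XXs.
- exact: vex.
pose lambda : C := c1%:C + 'i * c2%:C.
have hl v : vac v -> X r v = lambda *: v.
  move=> hv; rewrite scalerDl -(h1 v hv) -scalerA -(h2 v hv) reE imE scalerA.
  have -> : 'i * (half * - 'i) = half :> C.
    have := sqr_i R => ii; transitivity (- ('i ^+ 2) * half); first by ring.
    by rewrite ii opprK mul1r.
  rewrite -scalerDr addrACA subrr addr0 scalerDr -scalerDl.
  have -> : half + half = 1 by rewrite -rmorphD (_ : 2^-1 + 2^-1 = 1 :> R) ?rmorph1 //; field.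
  by rewrite scale1r.
have [v0 [hv0 v00]] := vex.
have p0 : rnorm v0 != 0 by rewrite rnorm_eq0.
exists lambda; split=> //.
- have e : rnorm (X r v0) ^+ 2 = rnorm v0 ^+ 2.
    by rewrite -rinnervv -rinner_starr -(sphere_sv_XsX hlt) hv0 rinnervv.
  have {}e : rnorm (X r v0) = rnorm v0 by apply/eqP; rewrite -(@eqrXn2 _ 2) ?rnorm_ge0 ?e.
  move: e; rewrite hl // rnormZ -[Y in _ = Y]mul1r => /(mulIf p0) e.
  by rewrite -[LHS]RRe_real ?normr_real // e.
- move=> r0; have e : inner (X r v0) v0 = inner v0 (X r v0).
    by rewrite rep_star r0 (sphere_star_x0 hx).
  move: e; rewrite !hl // innerZl innerZr => /esym/mulIf; apply.
  by rewrite innervv; apply/eqP => /complexI/eqP; rewrite sqrf_eq0 (negbTE p0).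
Qed.

End VacuumScalar.

(** In [orthonormal_basis] a coefficient is a function of the index, so repeated indices with
    different coefficients have to be merged. *)
Lemma sum_pairs_span (R : nzRingType) (V : lmodType R) (I : eqType) (e : I -> V)
    (t : seq (I * R)) :
  exists s (c : I -> R), \sum_(p <- t) p.2 *: e p.1 = \sum_(k <- s) c k *: e k.
Proof.
pose K := undup (map fst t).
exists K, (fun k => \sum_(p <- t | p.1 == k) p.2).
under [RHS]eq_bigr => k _ do rewrite scaler_suml.
rewrite (exchange_big_dep xpredT) //= big_seq [RHS]big_seq; apply: eq_bigr => p pt.
have pK : p.1 \in K by rewrite mem_undup map_f.
rewrite (big_rem p.1) //= eqxx big_seq_cond big1 ?addr0 // => k.
by rewrite mem_rem_uniq ?undup_uniq // !inE => /andP[/andP[/negbTE kp _]]; rewrite eq_sym kp.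
Qed.

Section ShiftForm.
Variables (R : realType) (q : R) (n : nat).
Local Notation A := (even_sphere q n).
Local Notation x := (even_x q n).
Local Notation C := R[i].

(* The common shape of all the representations of the classification: x_i acts by 0
   for i < r, x_r is diagonal, and x_(r+1), ..., x_n are weighted shifts. *)
Definition shift_form (pi : starRep A) r d (lambda : C)
    (e : {ffun 'I_d -> nat} -> rep_space pi) : Prop :=
  [/\ orthonormal_basis e,
      forall i v, (i < r)%N -> pi (x i) v = 0,
      forall k, pi (x r) (e k) = (lambda * (q ^- Defs.total k)%:C) *: e k &
      forall (j : 'I_d) k,
        pi (x (r.+1 + j)) (e k) = shift_coef q k j *: e (lower k j)].

(** One vacuum vector [v] suffices: [x_r] and its adjoint act on it by scalars, so the words over
    the line through [v] span an invariant, hence dense, subspace. Normalising them gives the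
    basis. *)
Lemma irreducible_shift_form (hq : 1 < `|q|) (pi : starRep A) : irreducible pi ->
  exists r d (lambda : C) (e : {ffun 'I_d -> nat} -> rep_space pi),
    [/\ (r + d)%N = n, `|lambda| = 1, r = 0%N -> Num.conj lambda = lambda &
        shift_form r lambda e].
Proof.
move=> irr; have [r [rn hlt hr]] := first_nonzero irr.
have [lambda [l1 l0 hl]] := vacuum_eigenvalue hq irr (subnKC rn) hlt hr.
have [v [hv v0]] := vacuum_exists hq irr rn hr.
set d := (n - r)%N in hl *; have rd : (r + d)%N = n by rewrite subnKC.
pose w (k : {ffun 'I_d -> nat}) := word r (pi := pi) k v.
have wpos k : 0 < rnorm (w k) by exact: (word_neq0 hq rd).
pose e k := ((rnorm (w k))^-1)%:C *: w k.
have eE k : w k = (rnorm (w k))%:C *: e k.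
  by rewrite scalerA -rmorphM divff ?gt_eqF // rmorph1 scale1r.
exists r, d, lambda, e; split=> //; split=> // [|k|j k].
- have hon k l : inner (e k) (e l) = (k == l)%:R.
    rewrite innerZl innerZr conjC_real; case: eqVneq => [->|kl].
      rewrite innervv -!rmorphM; move: (rnorm _) (negbT (gt_eqF (wpos l))) => N N0.
      by rewrite (_ : N^-1 * (N^-1 * N ^+ 2) = 1) ?rmorph1 //; field.
    by rewrite (word_orthogonal hq rd hv hv kl) !mulr0.
  split=> //.
  pose F := [set u | exists z : C, u = z *: v].
  have FX : forall u, F u -> F (pi (x r) u) /\ F (pi (star (x r)) u).
    move=> _ [z ->]; rewrite !rep_vZ hl //; split; first by exists (z * lambda); rewrite scalerA.
    have -> : pi (star (x r)) v = lambda^-1 *: v.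
      have l00 : lambda != 0 by rewrite -normr_eq0 l1 oner_eq0.
      have : lambda *: pi (star (x r)) v = v by rewrite -rep_vZ -hl // -(sphere_sv_XsX hlt).
      by move=> {2}<-; rewrite scalerA mulVf // scale1r.
    by exists (z * lambda^-1); rewrite scalerA.
  rewrite -(@word_span_dense _ _ hq _ _ irr r rn hlt _ rd F) //.
  + apply/seteqP; split.
      apply: closure_subset => _ [s [c ->]].
      exists [seq (k, (c k * ((rnorm (w k))^-1)%:C) *: v) | k <- s]; split.
        by move=> p /mapP[k _ ->]; eexists.
      rewrite big_map; apply: eq_bigr => k _ /=.
      by rewrite (wordZ _ k) /e scalerA.
    apply: closure_subset => _ [s [Fs ->]].
    have [t et] : exists t : seq ({ffun 'I_d -> nat} * C),
        \sum_(p <- s) word r p.1 p.2 = \sum_(p <- t) p.2 *: e p.1.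
      elim: s Fs => [|p s IH] Fs; first by exists [::]; rewrite !big_nil.
      have [|t et] := IH; first by move=> y ys; apply: Fs; rewrite inE ys orbT.
      have [z pz] := Fs p (mem_head _ _).
      exists ((p.1, z * (rnorm (w p.1))%:C) :: t); rewrite !big_cons -et /= pz (wordZ _ p.1).
      by congr (_ + _); rewrite -scalerA -eE.
    have [s' [c ec]] := sum_pairs_span e t.
    by exists s', c; rewrite et.
  + by exists 0; rewrite scale0r.
  + by move=> z _ _ [a ->] [b ->]; exists (z * a + b); rewrite scalerA -scalerDl.
  + by move=> _ [z ->]; rewrite rep_vZ hv.
  + by exists v; split=> //; exists 1; rewrite scale1r.
- rewrite rep_vZ (word_X_r hq rn rd) hl // (wordZ _ k) scalerA scalerA scalerA; congr (_ *: _).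
  by ring.
- have [kj|kj] := posnP (k j).
    by rewrite shift_coef0 // scale0r rep_vZ (word_X_zero hq rd) // scaler0.
  rewrite -{1 2}(raise_lower kj) rep_vZ; set k' := lower k j.
  have jE : Num.sqrt (1 - q ^- (2 * (k' j).+1)) != 0.
    by rewrite gt_eqF // sqrtr_gt0 subr_gt0 qV2_lt1.
  rewrite (word_X_raise hq rd) // scalerA /e scalerA /w -/k' raise_lower //.
  congr (_ *: _); rewrite /shift_coef -!rmorphM; congr (_%:C).
  rewrite -(raise_lower kj) -/k' (word_nm_raise hq rd) // raiseE eqxx.
  rewrite [tail (raise _ _) _]tailE tailn_raise ltnn addn0 -tailE.
  (* Unnormalised, the lowering weight contains [b = 1 - q ^- (2 * (k' j).+1)], while the norms of
     the two words have ratio [a = sqrt b]; normalising replaces [b] by [a]. *)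
  have key (b a T N : R) : a != 0 -> N != 0 -> a ^+ 2 = b ->
      (a * N)^-1 * (T * b) = a * T / N.
    by move=> a0 N0 <-; field; rewrite ?a0 ?N0.
  by apply: key => //; [rewrite gt_eqF // wpos|rewrite sqrt_1q2].
Qed.

End ShiftForm.

(** * Representations in shift form *)

Section ShiftFormTheory.
Variables (R : realType) (q : R) (hq : 1 < `|q|) (n r d : nat) (lambda : R[i]).
Hypothesis hl : `|lambda| = 1.
Local Notation A := (even_sphere q n).
Local Notation x := (even_x q n).
Local Notation C := R[i].
Local Notation I := {ffun 'I_d -> nat}.
Local Notation sc := (shift_coef q).
Variables (pi : starRep A) (e : I -> rep_space pi).
Hypothesis hform : shift_form r lambda e.
Local Notation H := (rep_space pi).
Implicit Types (k l : I) (j : 'I_d) (u v w : H).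

Lemma shift_form_onb : orthonormal_basis e. Proof. by case: hform. Qed.
Let he := shift_form_onb.

Lemma shift_form_lt i v : (i < r)%N -> pi (x i) v = 0.
Proof. by case: hform => _ h _ _; exact: h. Qed.
Lemma shift_form_diag k : pi (x r) (e k) = (lambda * (q ^- Defs.total k)%:C) *: e k.
Proof. by case: hform. Qed.
Lemma shift_form_shift j k : pi (x (r.+1 + j)) (e k) = sc k j *: e (lower k j).
Proof. by case: hform. Qed.

Lemma conj_shift_coef k j : Num.conj (sc k j) = sc k j.
Proof. exact: conjC_real. Qed.

Lemma shift_form_star_lt i v : (i < r)%N -> pi (star (x i)) v = 0.
Proof.
by move=> ir; apply: inner_eq0_all => w; rewrite rep_starr shift_form_lt // inner0r.
Qed.

Lemma shift_form_star_diag k :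
  pi (star (x r)) (e k) = (Num.conj lambda * (q ^- Defs.total k)%:C) *: e k.
Proof.
apply: (onb_inj he) => l; rewrite rep_starr shift_form_diag innerZl innerZr (onb_inner he).
case: eqVneq => [->|_]; last by rewrite !mulr0.
by rewrite !mulr1 rmorphM; congr (_ * _); exact: conjC_real.
Qed.

Lemma shift_form_star_shift j k :
  pi (star (x (r.+1 + j))) (e k) = sc (raise k j) j *: e (raise k j).
Proof.
apply: (onb_inj he) => l; rewrite rep_starr shift_form_shift innerZl innerZr !(onb_inner he).
rewrite conj_shift_coef; have [lj|lj] := posnP (l j).
  rewrite shift_coef0 // mul0r; case: eqP => [kl|_]; last by rewrite mulr0.
  by move: lj; rewrite -kl raiseE eqxx.
case: eqVneq => [->|kl]; first by rewrite raise_lower // eqxx.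
case: eqVneq => [rl|_]; last by rewrite !mulr0.
by move: kl; rewrite -rl lower_raise eqxx.
Qed.

Lemma shift_coef_raise_neq0 k j : sc (raise k j) j != 0.
Proof.
apply/eqP => /complexI/eqP; rewrite mulf_eq0 raiseE eqxx.
rewrite gt_eqF; last by rewrite sqrtr_gt0 subr_gt0 qV2_lt1.
by rewrite /= invr_eq0 expf_eq0 (negbTE (q_neq0 hq)) andbF.
Qed.

Local Notation k0 := ([ffun=> 0%N] : I).

Lemma total_zero : Defs.total k0 = 0%N.
Proof. by rewrite /Defs.total big1 // => j _; rewrite ffunE. Qed.

Lemma shift_form_neq0 k : e k != 0.
Proof.
apply/eqP => ek; have := onb_inner he k k; rewrite ek inner0l eqxx => /esym/eqP.
by rewrite oner_eq0.
Qed.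

Lemma total_gt0 k : k != k0 -> (0 < Defs.total k)%N.
Proof.
move=> kn; rewrite lt0n; apply: contra kn; rewrite /Defs.total sum_nat_eq0.
move=> /forallP h; apply/eqP/ffunP => j; rewrite ffunE.
by have /implyP/(_ isT)/eqP := h j.
Qed.

Section Invariant.
Variable V : set H.
Hypotheses (cV : closed V) (V0 : V 0).
Hypothesis VL : forall (c : C) u v, V u -> V v -> V (c *: u + v).
Hypothesis VA : forall a v, V v -> V (pi a v).

Let VZ (c : C) v : V v -> V (c *: v).
Proof. by move=> hv; rewrite -[_ *: _]addr0; exact: VL. Qed.

(** The coefficient of [x_(r+1+j) v] at [k] is a nonzero multiple of that of [v] at [raise k j], so
    annihilation brings a nonzero coefficient down to [k0]. *)
Let lower_to_vacuum k v : V v -> inner v (e k) != 0 ->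
  exists w, V w /\ inner w (e k0) != 0.
Proof.
elim/multi_ind: k v => [|k j IH] v Vv vk; first by exists v.
apply: (IH (pi (x (r.+1 + j)) v)); first exact: VA.
rewrite rep_star shift_form_star_shift innerZr mulf_neq0 // conj_shift_coef.
exact: shift_coef_raise_neq0.
Qed.

Let T : A := star (x r) * x r.
Let ll : lambda * Num.conj lambda = 1.
Proof. by rewrite -normCK hl expr1n. Qed.

Let Te k : pi T (e k) = (q ^- (2 * Defs.total k))%:C *: e k.
Proof.
rewrite rep_M shift_form_diag rep_vZ shift_form_star_diag scalerA; congr (_ *: _).
by rewrite qV2 expr2 rmorphM /= -[RHS]mul1r -ll; ring.
Qed.

Let iterT v m k : inner (iter m (pi T) v) (e k) =
  ((q ^- (2 * Defs.total k)) ^+ m)%:C * inner v (e k).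
Proof.
elim: m => [|m IH] /=; first by rewrite expr0 rmorph1 mul1r.
have sT : star T = T by rewrite /T starM starK.
by rewrite rep_star sT Te innerZr conjC_real IH mulrA -rmorphM -exprS.
Qed.

(** [T] has eigenvalue 1 at [k0] and at most [q^-2] at every other basis vector, so its powers
    converge strongly to the projection onto [e k0]; the limit stays in the closed set [V]. *)
Let vacuum_in v : V v -> inner v (e k0) != 0 -> V (e k0).
Proof.
move=> Vv vn; set z := inner v (e k0) in vn.
suff h : V (z *: e k0) by rewrite -(scale1r (e k0)) -(mulVf vn) -scalerA; exact: VZ.
apply: (@closed_cvs _ _ _ (fun m => iter m (pi T) v)) cV _ _.
  by elim=> //= m IH; exact: VA.
have /andP[c0 c1] := qV2_itv hq; set c := q ^- 2 in c0 c1.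
have bound m : rnorm (iter m (pi T) v - z *: e k0) <= c ^+ m * rnorm v.
  have cm : 0 <= c ^+ m by rewrite exprn_ge0 // ltW.
  rewrite -ler_sqr ?nnegrE ?mulr_ge0 ?rnorm_ge0 // exprMn (parseval he).
  apply: csum_le => [k|s us]; first exact: sqnorm_ge0.
  apply: (@le_trans _ _ (\sum_(k <- s) (c ^+ m) ^+ 2 * sqnorm (inner v (e k)))); last first.
    by rewrite -mulr_sumr ler_wpM2l ?sqr_ge0 //; apply: (bessel he).
  apply: ler_sum => k _; rewrite innerBl iterT innerZl (onb_inner he).
  case: eqVneq => [<-|kn].
    rewrite total_zero muln0 expr0 invr1 expr1n mulr1 mul1r subrr /sqnorm /= expr0n addr0.
    by rewrite mulr_ge0 ?sqr_ge0 ?sqnorm_ge0.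
  rewrite mulr0 subr0 sqnormM sqnorm_real ler_wpM2r ?sqnorm_ge0 //.
  rewrite ler_sqr ?nnegrE ?exprn_ge0 ?(ltW (qV2_gt0 hq _)) // ?(ltW c0) //.
  rewrite lerXn2r ?nnegrE ?(ltW (qV2_gt0 hq _)) ?(ltW c0) //.
  have t0 : (0 < Defs.total k)%N by apply: total_gt0; rewrite eq_sym.
  have -> : Defs.total k = (1 + (Defs.total k).-1)%N by rewrite add1n prednK.
  rewrite qV2D -[(2 * 1)%N]/2%N ler_piMr ?(ltW c0) //.
  exact: qV2_le1.
move=> eps e0; have v1 : 0 < rnorm v + 1 by rewrite ltr_wpDl ?rnorm_ge0.
have [|m hm] := @exp_small R c _ _ (divr_gt0 e0 v1); first by rewrite (ltW c0).
exists m => m' mm; apply: le_lt_trans (bound m') _.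
move: hm; rewrite ltr_pdivlMr //; apply: le_lt_trans.
apply: (@le_trans _ _ (c ^+ m * rnorm v)); last by rewrite ler_wpM2l ?lerDl // exprn_ge0 // ltW.
rewrite ler_wpM2r ?rnorm_ge0 // -(subnK mm) exprD ler_piMl ?exprn_ge0 ?(ltW c0) //.
by rewrite exprn_ile1 ?(ltW c0) ?(ltW c1).
Qed.

Lemma shift_form_invariant v : V v -> v != 0 -> V = setT.
Proof.
move=> Vv v0.
have [k vk] : exists k, inner v (e k) != 0.
  apply: contrapT => nex; move: v0; rewrite (onb_eq0 he (v := v)) ?eqxx // => k.
  by apply/eqP; apply: contraT => vk; case: nex; exists k.
have [w [Vw wn]] := lower_to_vacuum Vv vk.
have Ve : forall l, V (e l).
  elim/multi_ind => [|l j Vl]; first exact: vacuum_in Vw wn.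
  have := VZ (sc (raise l j) j)^-1 (VA (star (x (r.+1 + j))) Vl).
  by rewrite shift_form_star_shift scalerA mulVf ?scale1r // shift_coef_raise_neq0.
by apply/seteqP; split=> // u _; exact: (onb_ind he).
Qed.

End Invariant.

Lemma shift_form_irreducible : irreducible pi.
Proof.
split; first by exists (e k0); exact: shift_form_neq0.
move=> V cV V0 VL VA; have [[v [Vv v0]]|nex] := pselect (exists v, V v /\ v != 0).
  by right; exact: (shift_form_invariant cV V0 VL VA Vv v0).
left; apply/seteqP; split=> [v Vv|v -> //] /=.
by apply/eqP; apply: contraT => v0; case: nex; exists v.
Qed.

End ShiftFormTheory.

Section ShiftFormUniqueness.
Variables (R : realType) (q : R) (hq : 1 < `|q|) (n : nat).
Local Notation A := (even_sphere q n).
Local Notation x := (even_x q n).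

Lemma shift_form_vacuum_neq0 r d lambda (pi : starRep A)
    (e : {ffun 'I_d -> nat} -> rep_space pi) :
  `|lambda| = 1 -> shift_form r lambda e -> pi (x r) (e [ffun=> 0%N]) != 0.
Proof.
move=> hl hf; rewrite (shift_form_diag hf) total_zero expr0 invr1 rmorph1 mulr1.
rewrite scaler_eq0 negb_or (shift_form_neq0 hf) andbT.
by rewrite -normr_eq0 hl oner_eq0.
Qed.

(** Being the least index of a nonzero generator, [r] is an invariant. The image [w] of the vacuum
    is killed by all later generators, hence is proportional to the other vacuum, and [x_r] has the
    same eigenvalue on both. *)
Lemma shift_form_unique r r' d d' lambda lambda' (pi rho : starRep A)
    (e : {ffun 'I_d -> nat} -> rep_space pi) (f : {ffun 'I_d' -> nat} -> rep_space rho) :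
  (r + d)%N = n -> (r' + d')%N = n -> `|lambda| = 1 -> `|lambda'| = 1 ->
  shift_form r lambda e -> shift_form r' lambda' f ->
  unitarily_equivalent pi rho -> r = r' /\ lambda = lambda'.
Proof.
move=> rd rd' hl hl' hf hf' [U [bU Uinner Uint]].
have [V VK UK] := bU.
have U0 v : U v = 0 -> v = 0 by move=> h; rewrite -(VK v) h -(VK 0) linear0.
have er : r = r'.
  case: (ltngtP r r') => // lt.
  - have := shift_form_vacuum_neq0 hl hf; case/eqP; apply: U0.
    by rewrite Uint (shift_form_lt hf').
  - have := shift_form_vacuum_neq0 hl' hf'; case/eqP.
    by rewrite -[f _]UK -Uint (shift_form_lt hf) // linear0.
split=> //; subst r'; have ed : d = d' by apply/eqP; rewrite -(eqn_add2l r) rd rd'.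
subst d'; pose w := U (e [ffun=> 0%N]).
have wX (j : 'I_d) : rho (x (r.+1 + nat_of_ord j)) w = 0.
  rewrite /w -Uint (shift_form_shift hf) shift_coef0; last by rewrite ffunE.
  by rewrite scale0r linear0.
(* A nonzero multi-index is some [raise k j], and [f (raise k j)] is a nonzero multiple of
   [x_(r+1+j)^* f k]. *)
have wk k : k != [ffun=> 0%N] -> inner w (f k) = 0.
  elim/multi_ind: k => [|k j _ _]; first by rewrite eqxx.
  have := rep_star (x (r.+1 + j)) w (f k); rewrite wX inner0l.
  rewrite (shift_form_star_shift hf') innerZr => /esym/eqP; rewrite mulf_eq0 => /orP[|/eqP //].
  by rewrite conj_shift_coef (negbTE (shift_coef_raise_neq0 hq _ _)).
have w0 : inner w (f [ffun=> 0%N]) != 0.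
  apply/negP => /eqP h; have := shift_form_neq0 hf [ffun=> 0%N]; case/eqP; apply: U0.
  apply: (onb_eq0 (shift_form_onb hf')) => k.
  by have [->|/wk] := eqVneq k [ffun=> 0%N].
have := rep_star (x r) w (f [ffun=> 0%N]).
rewrite /w -Uint (shift_form_diag hf) linearZ /= innerZl (shift_form_star_diag hf').
rewrite innerZr total_zero expr0 invr1 rmorph1 !mulr1 Num.Theory.conjCK.
exact: mulIf.
Qed.

Lemma shift_form_equivalent r d lambda (pi rho : starRep A)
    (e : {ffun 'I_d -> nat} -> rep_space pi) (f : {ffun 'I_d -> nat} -> rep_space rho) :
  (r + d)%N = n -> shift_form r lambda e -> shift_form r lambda f ->
  unitarily_equivalent pi rho.
Proof.
move=> rd hf hf'; have he := shift_form_onb hf; have he' := shift_form_onb hf'.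
have [U [bU Uinner Ucoef]] := unitary_of_bases he he'.
exists U; split=> //.
(* [U] is known by its coefficients against [f] only, so the operator is moved onto the basis
   vector: what is assumed of [a] yields intertwining for [star a]. *)
have inter (a : A) : (forall k, exists (z : R[i]) l, pi a (e k) = z *: e l /\
    rho a (f k) = z *: f l) -> forall v, U (pi (star a) v) = rho (star a) (U v).
  move=> h v; apply: (onb_inj he') => k; have [z [l [h1 h2]]] := h k.
  by rewrite Ucoef !rep_starr h1 h2 !innerZr Ucoef.
apply: even_sphere_ind.
- by move=> v; rewrite !rep0 linear0.
- by move=> v; rewrite !rep_1.
- by move=> z a h v; rewrite !repZ linearZ /= h.
- by move=> a b ha hb v; rewrite !repD linearD ha hb.
- by move=> a b ha hb v; rewrite !rep_M ha hb.
move=> i iN.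
suff [h1 h2] : (forall k, exists (z : R[i]) l, pi (x i) (e k) = z *: e l /\
    rho (x i) (f k) = z *: f l) /\
  (forall k, exists (z : R[i]) l, pi (star (x i)) (e k) = z *: e l /\
    rho (star (x i)) (f k) = z *: f l).
  by split; [have := inter _ h2; rewrite starK|exact: inter].
case: (ltngtP i r) => ir.
- split=> k; exists 0, k; rewrite !scale0r.
    by rewrite (shift_form_lt hf) // (shift_form_lt hf').
  by rewrite (shift_form_star_lt hf) // (shift_form_star_lt hf').
- have [j ->] : exists j : 'I_d, i = (r.+1 + j)%N.
    have jd : (i - r.+1 < d)%N by rewrite ltn_subLR // addSn rd ltnS.
    by exists (Ordinal jd); rewrite /= subnKC.
  split=> k.
    by do 2 eexists; split; [exact: (shift_form_shift hf)|exact: (shift_form_shift hf')].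
  by do 2 eexists; split; [exact: (shift_form_star_shift hf)|exact: (shift_form_star_shift hf')].
- rewrite ir; split=> k.
    by do 2 eexists; split; [exact: (shift_form_diag hf)|exact: (shift_form_diag hf')].
  by do 2 eexists; split; [exact: (shift_form_star_diag hf)|exact: (shift_form_star_diag hf')].
Qed.

Lemma psi_even_shift_form s (pi : starRep A) : is_psi_even s pi ->
  exists e : {ffun 'I_n -> nat} -> rep_space pi, shift_form 0 ((-1) ^+ s)%:C e.
Proof.
move=> [e [he h0 hX _]]; exists e; split=> // k.
by rewrite h0 rmorphM.
Qed.

(** The composite sends [x_i] to [odd_x m (i - (n - m.+1))] with truncated subtraction: everything
    below [n - m] goes to [odd_x m 0 = 0], and [x_(n-m)] to the diagonal generator [x_1]. *)
Lemma psi_odd_shift_form (m : 'I_n) lambda (pi : starRep (odd_sphere q m)) :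
  is_psi_odd lambda pi ->
  exists e : {ffun 'I_m -> nat} -> rep_space (pullback (even_to_odd_comp q m) pi),
    shift_form (n - m) (val lambda) e.
Proof.
have mn := ltn_ord m.
move=> [e [he h1 hX]]; exists e; split=> // [i v im|k|j k].
- rewrite -[LHS]/(pi (even_to_odd_comp q m (x i)) v) even_to_odd_comp_x; last first.
    by rewrite (leq_trans (ltnW im)) // leq_subr.
  have -> : (i - (n - m.+1) = 0)%N.
    by apply/eqP; rewrite subn_eq0 -ltnS -subSn // subSS.
  by rewrite odd_x0 rep0.
- rewrite -[LHS]/(pi (even_to_odd_comp q m (x (n - m))) (e k)) even_to_odd_comp_x ?leq_subr //.
  have -> : (n - m - (n - m.+1) = 1)%N by rewrite -(subnSK mn) subSn // subnn.
  exact: h1.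
- rewrite -[LHS]/(pi (even_to_odd_comp q m (x ((n - m).+1 + j))) (e k)).
  rewrite even_to_odd_comp_x; last first.
    by rewrite addSn -addnS -leq_subRL ?leq_subr // subKn // ltnW.
  have -> : ((n - m).+1 + j - (n - m.+1) = j.+2)%N.
    by rewrite -(subnSK mn) !addSn -!addnS addKn.
  exact: hX.
Qed.

End ShiftFormUniqueness.

(** The predicates [is_psi_even] and [is_psi_odd] fix a representation only up to unitary
    equivalence, which explains the two conjuncts: representatives exist, and the classification
    does not depend on their choice. *)
Theorem mainTheorem3 (R : realType) (q : R) (n : nat)
    (hq : 1 < `|q|) (hn : (1 <= n)%N) :
  (exists (psi_even : bool -> starRep (even_sphere q n))
          (psi_odd : forall m : nat, circle R -> starRep (odd_sphere q m)),
      (forall s, is_psi_even s (psi_even s)) /\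
      (forall m lambda, is_psi_odd lambda (psi_odd m lambda))) /\
  (forall (psi_even : bool -> starRep (even_sphere q n))
          (psi_odd : forall m : nat, circle R -> starRep (odd_sphere q m)),
      (forall s, is_psi_even s (psi_even s)) ->
      (forall m lambda, is_psi_odd lambda (psi_odd m lambda)) ->
      [/\ forall l, irreducible (psi_family psi_even psi_odd l),
          forall l l', unitarily_equivalent (psi_family psi_even psi_odd l)
                                            (psi_family psi_even psi_odd l') ->
            l = l' &
          forall pi : starRep (even_sphere q n), irreducible pi ->
            exists l, unitarily_equivalent pi (psi_family psi_even psi_odd l)]).
Proof.
split.
  exists (fun s => sval (cid (exists_psi_even hq n s))).
  exists (fun m lambda => sval (cid (exists_psi_odd hq m lambda))).
  by split=> [s|m lambda]; exact: svalP.
move=> psi_even psi_odd hE hO.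
have sign1 (s : bool) : `|((-1) ^+ s)%:C : R[i]| = 1.
  by rewrite normc_def /= expr0n addr0 sqrr_sign sqrtr1.
have circ1 (lambda : circle R) : `|val lambda| = 1 by apply/eqP; exact: (valP lambda).
have nmK (m : 'I_n) : (n - m + m)%N = n by rewrite subnK // ltnW.
split.
- case=> [s|[m lambda]].
    have [e he] := psi_even_shift_form (hE s).
    exact: (shift_form_irreducible hq (sign1 s) he).
  have [e he] := psi_odd_shift_form (hO m lambda).
  exact: (shift_form_irreducible hq (circ1 lambda) he).
- case=> [s|[m lambda]] [s'|[m' lambda']] eqv.
  + have [e he] := psi_even_shift_form (hE s); have [f hf] := psi_even_shift_form (hE s').
    have [_ /complexI es] :=
      shift_form_unique hq (add0n n) (add0n n) (sign1 s) (sign1 s') he hf eqv.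
    by congr inl; apply: (@signr_inj R).
  + have [e he] := psi_even_shift_form (hE s).
    have [f hf] := psi_odd_shift_form (hO m' lambda').
    (* Equal values of [r] would give [n - m' = 0], against [m' < n]. *)
    have [/eqP] := shift_form_unique hq (add0n n) (nmK m') (sign1 s) (circ1 lambda') he hf eqv.
    by rewrite eq_sym subn_eq0 leqNgt ltn_ord.
  + have [e he] := psi_odd_shift_form (hO m lambda).
    have [f hf] := psi_even_shift_form (hE s').
    have [/eqP] := shift_form_unique hq (nmK m) (add0n n) (circ1 lambda) (sign1 s') he hf eqv.
    by rewrite subn_eq0 leqNgt ltn_ord.
  + have [e he] := psi_odd_shift_form (hO m lambda).
    have [f hf] := psi_odd_shift_form (hO m' lambda').
    have [em el] := shift_form_unique hq (nmK m) (nmK m') (circ1 lambda) (circ1 lambda') he hf eqv.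
    have -> : m = m'.
      by apply: val_inj => /=; rewrite -(subKn (ltnW (ltn_ord m))) em subKn // ltnW.
    by rewrite (val_inj el).
- move=> pi irr.
  have [r [d [lambda [e [rd l1 l0 he]]]]] := irreducible_shift_form hq irr.
  case er : r => [|r'].
    have dn : d = n by rewrite -rd er add0n.
    subst d; rewrite er in he rd; have lreal := l0 er.
    have [s es] : exists s : bool, lambda = ((-1) ^+ s)%:C.
      (* A real [lambda] of modulus 1 satisfies [lambda^2 = lambda * conj lambda = 1], so it is a
         sign. *)
      have : lambda ^+ 2 == 1 by rewrite expr2 -{2}lreal -normCK l1 expr1n.
      rewrite sqrf_eq1 => /orP[/eqP ->|/eqP ->]; first by exists false; rewrite expr0 rmorph1.
      by exists true; rewrite expr1 rmorphN rmorph1.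
    have [f hf] := psi_even_shift_form (hE s).
    exists (inl s); apply: (shift_form_equivalent rd he); rewrite es; exact: hf.
  have dn : (d < n)%N by rewrite -rd er addSn ltnS leq_addl.
  have lc : `|lambda| == 1 by rewrite l1.
  pose m := Ordinal dn; pose z : circle R := exist _ lambda lc.
  have [f hf] := psi_odd_shift_form (hO m z).
  have rm : r = (n - m)%N by rewrite /= -rd addnK.
  exists (inr (m, z)); rewrite rm in he rd.
  exact: (shift_form_equivalent rd he hf).
Qed.
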